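(* Let $\mathcal B$ be a rigid monoidal category and let $\mathcal M$ be a left $\mathcal B$-module that is enriched in $\mathcal B$. If $\mathrm{Fun}_{\mathcal B}(\mathcal M,\mathcal M)$ is enriched in $\overline{\mathfrak Z_1(\mathcal B)}$, then $$\mathfrak Z_0({}^{\mathcal B}\mathcal M)\simeq{}^{\mathfrak Z_1(\mathcal B)}\mathrm{Fun}_{\mathcal B}(\mathcal M,\mathcal M),$$ where $\mathfrak Z_0$ denotes the $E_0$-center in $\mathbf{ECat}$.
   Context: Monoidal categories are written as if strict. **Enriched categories.** For a monoidal category $\mathcal A$, an $\mathcal A$-enriched category ${}^{\mathcal A|}\mathcal L$ has objects, hom objects ${}^{\mathcal A|}\mathcal L(x,y)\in\mathcal A$, identities and compositions satisfying the usual axioms. The underlying category $\mathcal L$ has the same objects and $\mathcal L(x,y)=\mathcal A(\mathbf 1_{\mathcal A},{}^{\mathcal A|}\mathcal L(x,y))$; $f\in\mathcal L(x,y)$ induces ${}^{\mathcal A|}\mathcal L(w,f)$ and ${}^{\mathcal A|}\mathcal L(f,w)$ by composing with $f$. An enriched functor ${}^|F:{}^{\mathcal A|}\mathcal L\to{}^{\mathcal B|}\mathcal M$ consists of a lax-monoidal functor $\hat F:\mathcal A\to\mathcal B$, a map $F$ on objects and morphisms ${}^|F_{x,y}:\hat F({}^{\mathcal A|}\mathcal L(x,y))\to{}^{\mathcal B|}\mathcal M(F(x),F(y))$ compatible with identities and compositions (via the lax structure of $\hat F$). An enriched natural transformation ${}^|\xi:{}^|F\Rightarrow{}^|G$ is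 a lax-monoidal natural transformation $\hat\xi:\hat F\Rightarrow\hat G$ with morphisms $\xi_x:\mathbf 1_{\mathcal B}\to{}^{\mathcal B|}\mathcal M(F(x),G(x))$ such that ${}^{\mathcal B|}\mathcal M(F(x),\xi_y)\circ{}^|F_{x,y}={}^{\mathcal B|}\mathcal M(\xi_x,G(y))\circ{}^|G_{x,y}\circ\hat\xi$. $\mathbf{ECat}$ is the 2-category of enriched categories, enriched functors with $\hat F$ (strong) monoidal, and enriched natural transformations; it is symmetric monoidal under the Cartesian product (background categories and hom objects are paired), with unit $*$. **Canonical construction.** A left $\mathcal A$-module $\mathcal L$ with action $\odot:\mathcal A\times\mathcal L\to\mathcal L$ is enriched in $\mathcal A$ if for all $x,y\in\mathcal L$ there is an internal hom $[x,y]\in\mathcal A$ with $\mathcal L(a\odot x,y)\cong\mathcal A(a,[x,y])$ naturally in $a$; write $\mathrm{ev}_x:[x,y]\odot x\to y$. Then ${}^{\mathcal A}\mathcal L$ denotes the $\mathcal A$-enriched category with the objects of $\mathcal L$, hom objects $[x,y]$, identities corresponding to $\mathbf 1\odot x\to x$ and composition $[y,z]\otimes[x,y]\to[x,z]$ corresponding to $([y,z]\otimes[x,y])\odot x\to[y,z]\odot([x,y]\odot x)\to[y,z]\odot y\to z$. **$E_0$-centers.** In a monoidal 2-category with product $\times$ and unit $*$, a left unital action on $x$ is a pair $(A,u:*\to A)$ with a 1-morphism $g:A\times x\to x$ and an invertible 2-morphism $\alpha:g(u\times1_x)\Rightarrow1_x$. A 1-morphism $((A_1,u_1),g_1,\alpha_1)\to((A_2,u_2),g_2,\alpha_2)$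 is $(p:A_1\to A_2,\ \sigma:u_2\Rightarrow pu_1,\ \rho:g_2(p\times1_x)\Rightarrow g_1)$ with $\sigma,\rho$ invertible and $\alpha_1\cdot(\rho(u_1\times1))\cdot(g_2(\sigma\times1))=\alpha_2$; a 2-morphism $(p,\sigma,\rho)\Rightarrow(q,\beta,\varphi)$ is $\xi:p\Rightarrow q$ with $(\xi u_1)\cdot\sigma=\beta$ and $\varphi\cdot(g_2(\xi\times1))=\rho$. An $E_0$-center $\mathfrak Z_0(x)$ is (the object $A$ underlying) a terminal object of this 2-category (all hom categories into it are contractible groupoids); it is unique up to equivalence, and the claim says that it exists for $x={}^{\mathcal B}\mathcal M$ and is equivalent in $\mathbf{ECat}$ to the right-hand side. **The category $\mathrm{Fun}_{\mathcal B}(\mathcal M,\mathcal M)$.** $\mathfrak Z_1(\mathcal B)$ is the Drinfeld center: objects $(a,\gamma_{-,a})$ with half-braiding $\gamma_{b,a}:b\otimes a\to a\otimes b$, with braiding $\gamma_{a,b}:a\otimes b\to b\otimes a$; $\mathfrak f$ is the forgetful functor to $\mathcal B$. $\overline{\mathfrak Z_1(\mathcal B)}$ is the same monoidal category with the anti-braiding. $\mathrm{Fun}_{\mathcal B}(\mathcal M,\mathcal M)$ is the monoidal category (under composition) of left $\mathcal B$-module functors $\mathcal M\to\mathcal M$ and $\mathcal B$-module natural transformations. It is a monoidal left $\overline{\mathfrak Z_1(\mathcal B)}$-module with $a\odot F=\mathfrak f(a)\odot F(-)$, whose $\mathcal B$-module functor structure is $b\odot(\mathfrak f(a)\odot F(x))\to\mathfrak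 f(a)\odot(b\odot F(x))\to\mathfrak f(a)\odot F(b\odot x)$ using $\gamma_{b,a}$ and the module structure of $F$. ''Enriched in $\overline{\mathfrak Z_1(\mathcal B)}$'' refers to this action, and ${}^{\mathfrak Z_1(\mathcal B)}\mathrm{Fun}_{\mathcal B}(\mathcal M,\mathcal M)$ is the canonical construction for it. *)

(* Defs.v *)
From Stdlib Require Import FunctionalExtensionality ProofIrrelevance.
From Stdlib Require Import Program.Tactics.

Set Implicit Arguments.
Unset Strict Implicit.
Unset Printing Implicit Defensive.

#[local] Obligation Tactic := intros; simpl.

Declare Scope ecat_scope.
Delimit Scope ecat_scope with ecat.
Open Scope ecat_scope.

Record Category : Type := {
  ob :> Type;
  hom : ob -> ob -> Type;
  idm : forall x, hom x x;
  comp : forall x y z, hom y z -> hom x y -> hom x z;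
  comp_idl : forall x y (f : hom x y), comp (idm y) f = f;
  comp_idr : forall x y (f : hom x y), comp f (idm x) = f;
  comp_assoc : forall w x y z (h : hom y z) (g : hom x y) (f : hom w x),
    comp h (comp g f) = comp (comp h g) f }.

Arguments hom {c} _ _.
Arguments idm {c} x.
Arguments comp {c x y z} _ _.

Notation "g ∘ f" := (comp g f) (at level 40, left associativity) : ecat_scope.

Definition is_iso (C : Category) (x y : C) (f : hom x y) : Prop :=
  exists g : hom y x, g ∘ f = idm x /\ f ∘ g = idm y.

Record Functor (C D : Category) : Type := {
  fob :> C -> D;
  fmap : forall x y, hom x y -> hom (fob x) (fob y);
  fmap_id : forall x, fmap (idm x) = idm (fob x);
  fmap_comp : forall x y z (g : hom y z) (f : hom x y),
    fmap (g ∘ f) = fmap g ∘ fmap f }.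

Arguments fmap {C D} _ {x y} _.

Lemma ra (C : Category) (w x y z : C) (g : hom y z) (f : hom x y) h
  (e : g ∘ f = h) (t : hom w x) : g ∘ (f ∘ t) = h ∘ t.
Proof. rewrite comp_assoc, e; reflexivity. Qed.

Lemma ra3 (C : Category) (v w x y z : C) (k : hom y z) (g : hom x y)
  (f : hom w x) h (e : k ∘ (g ∘ f) = h) (t : hom v w) :
  k ∘ (g ∘ (f ∘ t)) = h ∘ t.
Proof. rewrite <- e, <- !comp_assoc; reflexivity. Qed.

Lemma ra4 (C : Category) (u v w x y z : C) (l : hom y z) (k : hom x y)
  (g : hom w x) (f : hom v w) h (e : l ∘ (k ∘ (g ∘ f)) = h) (t : hom u v) :
  l ∘ (k ∘ (g ∘ (f ∘ t))) = h ∘ t.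
Proof. rewrite <- e, <- !comp_assoc; reflexivity. Qed.

Ltac catn :=
  repeat first [rewrite comp_idl | rewrite comp_idr | rewrite <- comp_assoc].
Ltac rw_any H :=
  first [ rewrite H | rewrite (ra H) | rewrite (ra3 H) | rewrite (ra4 H)
        | let H' := open_constr:(H _) in rw_any H' ].
Ltac rwl_any H :=
  first [ rewrite <- H | rewrite (ra (eq_sym H)) | rewrite (ra3 (eq_sym H))
        | rewrite (ra4 (eq_sym H)) | let H' := open_constr:(H _) in rwl_any H' ].
Tactic Notation "rw" open_constr(H) := rw_any H; catn.
Tactic Notation "rwl" open_constr(H) := rwl_any H; catn.

Lemma iso_cancel_r (C : Category) (x y z : C) (i : hom x y) (j : hom y x)
  (f g : hom y z) (e : i ∘ j = idm y) : f ∘ i = g ∘ i -> f = g.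
Proof.
  intros E. rewrite <- (comp_idr f), <- (comp_idr g), <- e, !comp_assoc, E.
  reflexivity.
Qed.

Lemma iso_cancel_l (C : Category) (x y z : C) (i : hom y z) (j : hom z y)
  (f g : hom x y) (e : j ∘ i = idm y) : i ∘ f = i ∘ g -> f = g.
Proof.
  intros E. rewrite <- (comp_idl f), <- (comp_idl g), <- e, <- !comp_assoc, E.
  reflexivity.
Qed.

Lemma is_iso_id (C : Category) (x : C) : is_iso (idm x).
Proof. exists (idm x); split; apply comp_idl. Qed.

Lemma is_iso_comp (C : Category) (x y z : C) (g : hom y z) (f : hom x y) :
  is_iso g -> is_iso f -> is_iso (g ∘ f).
Proof.
  intros [g' [g1 g2]] [f' [f1 f2]]. exists (f' ∘ g'). split; catn.
  - rw g1. exact f1.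
  - rw f2. exact g2.
Qed.

Lemma is_iso_fmap (C D : Category) (F : Functor C D) (x y : C) (f : hom x y) :
  is_iso f -> is_iso (fmap F f).
Proof.
  intros [g [g1 g2]]. exists (fmap F g).
  rewrite <- !fmap_comp, g1, g2, !fmap_id. split; reflexivity.
Qed.

Lemma is_iso_intro (C : Category) (x y : C) (f : hom x y) (g : hom y x) :
  g ∘ f = idm x -> f ∘ g = idm y -> is_iso f.
Proof. intros; exists g; split; assumption. Qed.

Record MonCat : Type := {
  mcat :> Category;
  tens : mcat -> mcat -> mcat;
  tensm : forall a a' b b', hom a a' -> hom b b' ->
    hom (tens a b) (tens a' b');
  one : mcat;
  asc : forall a b c, hom (tens (tens a b) c) (tens a (tens b c));
  asci : forall a b c, hom (tens a (tens b c)) (tens (tens a b) c);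
  lun : forall a, hom (tens one a) a;
  luni : forall a, hom a (tens one a);
  run : forall a, hom (tens a one) a;
  runi : forall a, hom a (tens a one);
  tensm_id : forall a b, tensm (idm a) (idm b) = idm (tens a b);
  tensm_comp : forall a a' a'' b b' b''
    (f' : hom a' a'') (f : hom a a') (g' : hom b' b'') (g : hom b b'),
    tensm (f' ∘ f) (g' ∘ g) = tensm f' g' ∘ tensm f g;
  asci_asc : forall a b c, asci a b c ∘ asc a b c = idm _;
  asc_asci : forall a b c, asc a b c ∘ asci a b c = idm _;
  luni_lun : forall a, luni a ∘ lun a = idm _;
  lun_luni : forall a, lun a ∘ luni a = idm _;
  runi_run : forall a, runi a ∘ run a = idm _;
  run_runi : forall a, run a ∘ runi a = idm _;
  asc_nat : forall a a' b b' c c' (f : hom a a') (g : hom b b') (h : hom c c'),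
    asc a' b' c' ∘ tensm (tensm f g) h = tensm f (tensm g h) ∘ asc a b c;
  lun_nat : forall a a' (f : hom a a'),
    lun a' ∘ tensm (idm one) f = f ∘ lun a;
  run_nat : forall a a' (f : hom a a'),
    run a' ∘ tensm f (idm one) = f ∘ run a;
  pentagon : forall a b c d,
    asc a b (tens c d) ∘ asc (tens a b) c d
    = tensm (idm a) (asc b c d)
      ∘ (asc a (tens b c) d ∘ tensm (asc a b c) (idm d));
  triangle : forall a b,
    tensm (idm a) (lun b) ∘ asc a one b = tensm (run a) (idm b) }.

Arguments tens {m} _ _.
Arguments tensm {m a a' b b'} _ _.
Arguments one m : clear implicits.
Arguments asc {m} _ _ _.
Arguments asci {m} _ _ _.
Arguments lun {m} _.
Arguments luni {m} _.
Arguments run {m} _.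
Arguments runi {m} _.

Notation "a ⊗ b" := (tens a b) (at level 38, left associativity) : ecat_scope.
Notation "f ⊗m g" := (tensm f g) (at level 38, left associativity) : ecat_scope.

Record LModule (A : MonCat) : Type := {
  lcat :> Category;
  act : A -> lcat -> lcat;
  actm : forall (a a' : A) (x x' : lcat), hom a a' -> hom x x' ->
    hom (act a x) (act a' x');
  aasc : forall a b x, hom (act (a ⊗ b) x) (act a (act b x));
  aasci : forall a b x, hom (act a (act b x)) (act (a ⊗ b) x);
  alun : forall x, hom (act (one A) x) x;
  aluni : forall x, hom x (act (one A) x);
  actm_id : forall a x, actm (idm a) (idm x) = idm (act a x);
  actm_comp : forall (a a' a'' : A) (x x' x'' : lcat)
    (f' : hom a' a'') (f : hom a a') (g' : hom x' x'') (g : hom x x'),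
    actm (f' ∘ f) (g' ∘ g) = actm f' g' ∘ actm f g;
  aasci_aasc : forall a b x, aasci a b x ∘ aasc a b x = idm _;
  aasc_aasci : forall a b x, aasc a b x ∘ aasci a b x = idm _;
  aluni_alun : forall x, aluni x ∘ alun x = idm _;
  alun_aluni : forall x, alun x ∘ aluni x = idm _;
  aasc_nat : forall (a a' b b' : A) (x x' : lcat)
    (f : hom a a') (g : hom b b') (h : hom x x'),
    aasc a' b' x' ∘ actm (f ⊗m g) h = actm f (actm g h) ∘ aasc a b x;
  alun_nat : forall (x x' : lcat) (f : hom x x'),
    alun x' ∘ actm (idm (one A)) f = f ∘ alun x;
  act_pentagon : forall a b c x,
    aasc a b (act c x) ∘ aasc (a ⊗ b) c x
    = actm (idm a) (aasc b c x)
      ∘ (aasc a (b ⊗ c) x ∘ actm (asc a b c) (idm x));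
  act_triangle : forall a x,
    actm (idm a) (alun x) ∘ aasc a (one A) x = actm (run a) (idm x) }.

Arguments act {A l} _ _.
Arguments actm {A l a a' x x'} _ _.
Arguments aasc {A l} _ _ _.
Arguments aasci {A l} _ _ _.
Arguments alun {A l} _.
Arguments aluni {A l} _.

Notation "a ⊙ x" := (act a x) (at level 39, right associativity) : ecat_scope.
Notation "f ⊙m g" := (actm f g) (at level 39, right associativity) : ecat_scope.

Lemma tensm_l (A : MonCat) (a b b' b'' : A) (g' : hom b' b'') (g : hom b b') :
  idm a ⊗m (g' ∘ g) = (idm a ⊗m g') ∘ (idm a ⊗m g).
Proof. rewrite <- tensm_comp, comp_idl; reflexivity. Qed.

Lemma tensm_r (A : MonCat) (a b b' b'' : A) (g' : hom b' b'') (g : hom b b') :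
  (g' ∘ g) ⊗m idm a = (g' ⊗m idm a) ∘ (g ⊗m idm a).
Proof. rewrite <- tensm_comp, comp_idl; reflexivity. Qed.

Lemma actm_l (A : MonCat) (M : LModule A) (a : A) (x x' x'' : M)
  (g' : hom x' x'') (g : hom x x') :
  idm a ⊙m (g' ∘ g) = (idm a ⊙m g') ∘ (idm a ⊙m g).
Proof. rewrite <- actm_comp, comp_idl; reflexivity. Qed.

Lemma actm_r (A : MonCat) (M : LModule A) (x : M) (b b' b'' : A)
  (g' : hom b' b'') (g : hom b b') :
  (g' ∘ g) ⊙m idm x = (g' ⊙m idm x) ∘ (g ⊙m idm x).
Proof. rewrite <- actm_comp, comp_idl; reflexivity. Qed.

Lemma actm_lr (A : MonCat) (M : LModule A) (a a' : A) (x x' : M)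
  (f : hom a a') (g : hom x x') :
  (f ⊙m idm x') ∘ (idm a ⊙m g) = (idm a' ⊙m g) ∘ (f ⊙m idm x).
Proof. rewrite <- !actm_comp, !comp_idl, !comp_idr; reflexivity. Qed.

Lemma tensm_lr (A : MonCat) (a a' x x' : A) (f : hom a a') (g : hom x x') :
  (f ⊗m idm x') ∘ (idm a ⊗m g) = (idm a' ⊗m g) ∘ (f ⊗m idm x).
Proof. rewrite <- !tensm_comp, !comp_idl, !comp_idr; reflexivity. Qed.

Definition regular (A : MonCat) : LModule A := {|
  lcat := A; act := @tens A; actm := @tensm A;
  aasc := @asc A; aasci := @asci A; alun := @lun A; aluni := @luni A;
  actm_id := @tensm_id A; actm_comp := @tensm_comp A;
  aasci_aasc := @asci_asc A; aasc_aasci := @asc_asci A;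
  aluni_alun := @luni_lun A; alun_aluni := @lun_luni A;
  aasc_nat := @asc_nat A; alun_nat := @lun_nat A;
  act_pentagon := @pentagon A; act_triangle := @triangle A |}.

Section ModuleCoherence.
Variables (A : MonCat) (M : LModule A).
Implicit Types (a b c : A) (x y : M).

Lemma actm_idl_inj x y (f g : hom x y) :
  idm (one A) ⊙m f = idm (one A) ⊙m g -> f = g.
Proof.
  intros E. apply (iso_cancel_r (alun_aluni x)).
  rewrite <- !alun_nat, E. reflexivity.
Qed.

Lemma aasci_nat (a a' b b' : A) x y (f : hom a a') (g : hom b b') (h : hom x y) :
  aasci a' b' y ∘ (f ⊙m g ⊙m h) = ((f ⊗m g) ⊙m h) ∘ aasci a b x.
Proof.
  apply (iso_cancel_r (aasc_aasci a b x)). catn.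
  rewrite <- aasc_nat. rw (aasci_aasc (l:=M)). rw (aasci_aasc (l:=M)). reflexivity.
Qed.

Lemma aluni_nat x y (f : hom x y) :
  aluni y ∘ f = (idm (one A) ⊙m f) ∘ aluni x.
Proof.
  apply (iso_cancel_l (aluni_alun y)). rw (alun_nat (l:=M)).
  rw (alun_aluni (l:=M)). rw (alun_aluni (l:=M)). reflexivity.
Qed.

Lemma act_triangle' a x :
  (idm a ⊙m aluni x) = aasc a (one A) x ∘ (runi a ⊙m idm x).
Proof.
  apply (@iso_cancel_l _ _ _ _ (idm a ⊙m alun x) (idm a ⊙m aluni x)).
  - rewrite <- actm_l, aluni_alun, actm_id. reflexivity.
  - rw (act_triangle (l:=M)). rewrite <- actm_l, <- actm_r, alun_aluni, run_runi, !actm_id.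
    reflexivity.
Qed.

Lemma alun_aasc a x : alun (a ⊙ x) ∘ aasc (one A) a x = lun a ⊙m idm x.
Proof.
  apply actm_idl_inj.
  apply (@iso_cancel_r _ _ _ _ (aasc (one A) (one A ⊗ a) x)
           (aasci (one A) (one A ⊗ a) x)); [apply aasc_aasci|].
  apply (@iso_cancel_r _ _ _ _ (asc (one A) (one A) a ⊙m idm x)
           (asci (one A) (one A) a ⊙m idm x)).
  { rewrite <- actm_r, asc_asci, actm_id. reflexivity. }
  rewrite actm_l. catn. rwl (act_pentagon (l:=M) _ _ _ _).
  rw (act_triangle (l:=M) _ _).
  rwl (aasc_nat (l:=M) _ _ _). rewrite <- actm_comp, triangle, comp_idl.
  rewrite <- (actm_id (l:=M)). rewrite aasc_nat. reflexivity.
Qed.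

Lemma aasc_aluni a x : aasc (one A) a x ∘ (luni a ⊙m idm x) = aluni (a ⊙ x).
Proof.
  apply (@iso_cancel_l _ _ _ _ (alun (a ⊙ x)) (aluni (a ⊙ x))); [apply aluni_alun|].
  rw (alun_aasc _ _). rewrite <- actm_r, lun_luni, alun_aluni, actm_id. reflexivity.
Qed.

Lemma aasci_aluni a x : aasci (one A) a x ∘ aluni (a ⊙ x) = luni a ⊙m idm x.
Proof. rewrite <- aasc_aluni. rw (aasci_aasc (l:=M) _ _ _). reflexivity. Qed.

Lemma act_pentagon_1 a b c x :
  aasc (a ⊗ b) c x ∘ (asci a b c ⊙m idm x)
  = aasci a b (c ⊙ x) ∘ ((idm a ⊙m aasc b c x) ∘ aasc a (b ⊗ c) x).
Proof.
  apply (@iso_cancel_l _ _ _ _ (aasc a b (c ⊙ x)) (aasci a b (c ⊙ x)));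
    [apply aasci_aasc|].
  rw (aasc_aasci (l:=M) _ _ _). rw (act_pentagon (l:=M) _ _ _ _).
  rewrite <- actm_r, asc_asci, actm_id, comp_idr. reflexivity.
Qed.

Lemma act_pentagon_2 a b c x :
  aasc a (b ⊗ c) x ∘ ((asc a b c ⊙m idm x) ∘ aasci (a ⊗ b) c x)
  = (idm a ⊙m aasci b c x) ∘ aasc a b (c ⊙ x).
Proof.
  apply (@iso_cancel_l _ _ _ _ (idm a ⊙m aasc b c x) (idm a ⊙m aasci b c x)).
  { rewrite <- actm_l, aasci_aasc, actm_id. reflexivity. }
  apply (@iso_cancel_r _ _ _ _ (aasc (a ⊗ b) c x) (aasci (a ⊗ b) c x));
    [apply aasc_aasci|].
  catn. rw (aasci_aasc (l:=M) _ _ _). rwl (act_pentagon (l:=M) _ _ _ _).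
  rewrite (ra (eq_sym (actm_l _ _ _))), aasc_aasci, actm_id, comp_idl. reflexivity.
Qed.

Lemma act_pentagon_3 a b c x :
  (asci a b c ⊙m idm x) ∘ aasci a (b ⊗ c) x
  = aasci (a ⊗ b) c x ∘ (aasci a b (c ⊙ x) ∘ (idm a ⊙m aasc b c x)).
Proof.
  apply (@iso_cancel_l _ _ _ _ (aasc (a ⊗ b) c x) (aasci (a ⊗ b) c x));
    [apply aasci_aasc|].
  rw (act_pentagon_1 _ _ _ _). rw (aasc_aasci (l:=M) _ _ _).
  rw (aasc_aasci (l:=M) _ _ _). reflexivity.
Qed.

Lemma act_pentagon_4 a b c x :
  aasci a b (c ⊙ x) ∘ (idm a ⊙m aasc b c x)
  = aasc (a ⊗ b) c x ∘ ((asci a b c ⊙m idm x) ∘ aasci a (b ⊗ c) x).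
Proof.
  rw (act_pentagon_1 _ _ _ _). rw (aasc_aasci (l:=M) _ _ _). reflexivity.
Qed.

End ModuleCoherence.

Section MonoidalCoherence.
Variable A : MonCat.
Implicit Types a b c d : A.

Lemma asci_nat a a' b b' c c' (f : hom a a') (g : hom b b') (h : hom c c') :
  asci a' b' c' ∘ (f ⊗m (g ⊗m h)) = ((f ⊗m g) ⊗m h) ∘ asci a b c.
Proof. exact (aasci_nat (M := regular A) f g h). Qed.

Lemma luni_nat a b (f : hom a b) : luni b ∘ f = (idm (one A) ⊗m f) ∘ luni a.
Proof. exact (aluni_nat (M := regular A) f). Qed.

Lemma lun_asc a b : lun (a ⊗ b) ∘ asc (one A) a b = lun a ⊗m idm b.
Proof. exact (alun_aasc (M := regular A) a b). Qed.

Lemma asc_luni a b : asc (one A) a b ∘ (luni a ⊗m idm b) = luni (a ⊗ b).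
Proof. exact (aasc_aluni (M := regular A) a b). Qed.

Lemma triangle' a b : idm a ⊗m luni b = asc a (one A) b ∘ (runi a ⊗m idm b).
Proof. exact (act_triangle' (M := regular A) a b). Qed.

Lemma runi_nat a b (f : hom a b) : runi b ∘ f = (f ⊗m idm (one A)) ∘ runi a.
Proof.
  apply (iso_cancel_l (runi_run b)). rw (run_nat (m:=A) _).
  rw (run_runi (m:=A) _). rw (run_runi (m:=A) _). reflexivity.
Qed.

Lemma tensm_idr_inj a b (f g : hom a b) :
  f ⊗m idm (one A) = g ⊗m idm (one A) -> f = g.
Proof.
  intros E. apply (iso_cancel_r (run_runi a)).
  rewrite <- !run_nat, E. reflexivity.
Qed.

Lemma run_asc a b : (idm a ⊗m run b) ∘ asc a b (one A) = run (a ⊗ b).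
Proof.
  apply tensm_idr_inj.
  apply (@iso_cancel_l _ _ _ _ (asc a b (one A)) (asci a b (one A)));
    [apply asci_asc|].
  rewrite tensm_r. rw (asc_nat (m:=A) _ _ _).
  rewrite <- triangle, tensm_l. catn. rwl (pentagon (m:=A) _ _ _ _).
  rwl (asc_nat (m:=A) _ _ _). rewrite tensm_id, triangle. reflexivity.
Qed.

Lemma asc_runi a b : asc a b (one A) ∘ runi (a ⊗ b) = idm a ⊗m runi b.
Proof.
  apply (@iso_cancel_l _ _ _ _ (idm a ⊗m run b) (idm a ⊗m runi b)).
  { rewrite <- tensm_l, runi_run, tensm_id. reflexivity. }
  rw (run_asc _ _). rewrite <- tensm_l, !run_runi, tensm_id. reflexivity.
Qed.

Lemma lun_run_one : lun (one A) = run (one A).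
Proof.
  apply tensm_idr_inj. rewrite <- triangle, <- lun_asc. f_equal.
  apply (@iso_cancel_l _ _ _ _ (lun (one A)) (luni (one A))); [apply luni_lun|].
  rewrite lun_nat. reflexivity.
Qed.

Lemma luni_runi_one : luni (one A) = runi (one A).
Proof.
  apply (iso_cancel_l (luni_lun (one A))).
  rewrite lun_luni, lun_run_one, run_runi. reflexivity.
Qed.

Lemma runi_asc a b : asci a b (one A) ∘ (idm a ⊗m runi b) = runi (a ⊗ b).
Proof. rewrite <- asc_runi. rw (asci_asc (m:=A) _ _ _). reflexivity. Qed.

End MonoidalCoherence.

Record ModFun (B : MonCat) (M N : LModule B) : Type := {
  mfun :> Functor M N;
  mstr : forall (b : B) (x : M), hom (b ⊙ mfun x) (mfun (b ⊙ x));
  mstr_iso : forall b x, is_iso (mstr b x);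
  mstr_nat : forall (b b' : B) (x x' : M) (f : hom b b') (g : hom x x'),
    mstr b' x' ∘ (f ⊙m fmap mfun g) = fmap mfun (f ⊙m g) ∘ mstr b x;
  mstr_asc : forall (b c : B) (x : M),
    fmap mfun (aasc b c x) ∘ mstr (b ⊗ c) x
    = mstr b (c ⊙ x) ∘ ((idm b ⊙m mstr c x) ∘ aasc b c (mfun x));
  mstr_lun : forall x, fmap mfun (alun x) ∘ mstr (one B) x = alun (mfun x) }.

Arguments mstr {B M N} _ _ _.

Record ModNat (B : MonCat) (M N : LModule B) (F G : ModFun M N) : Type := {
  mnat :> forall x : M, hom (F x) (G x);
  mnat_nat : forall (x y : M) (f : hom x y),
    mnat y ∘ fmap F f = fmap G f ∘ mnat x;
  mnat_str : forall (b : B) (x : M),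
    mnat (b ⊙ x) ∘ mstr F b x = mstr G b x ∘ (idm b ⊙m mnat x) }.

Lemma ModNat_eq (B : MonCat) (M N : LModule B) (F G : ModFun M N)
  (s t : ModNat F G) : (forall x, s x = t x) -> s = t.
Proof.
  destruct s as [s s1 s2], t as [t t1 t2]; simpl; intros E.
  apply functional_extensionality_dep in E. subst t.
  f_equal; apply proof_irrelevance.
Qed.

Program Definition modnat_id (B : MonCat) (M N : LModule B) (F : ModFun M N)
  : ModNat F F := {| mnat := fun x => idm (F x) |}.
Next Obligation. intros. rewrite comp_idl, comp_idr. reflexivity. Qed.
Next Obligation. intros. rewrite actm_id, comp_idl, comp_idr. reflexivity. Qed.

Program Definition modnat_comp (B : MonCat) (M N : LModule B)
  (F G H : ModFun M N) (t : ModNat G H) (s : ModNat F G)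
  : ModNat F H := {| mnat := fun x => t x ∘ s x |}.
Next Obligation.
  intros. catn. rw mnat_nat. rw mnat_nat. reflexivity.
Qed.
Next Obligation.
  intros. simpl. catn. rewrite actm_l. rw mnat_str. rw mnat_str. reflexivity.
Qed.

Program Definition ModFunCat (B : MonCat) (M N : LModule B) : Category := {|
  ob := ModFun M N;
  hom := @ModNat B M N;
  idm := @modnat_id B M N;
  comp := @modnat_comp B M N |}.
Next Obligation. intros. apply ModNat_eq; intros; apply comp_idl. Qed.
Next Obligation. intros. apply ModNat_eq; intros; apply comp_idr. Qed.
Next Obligation. intros. apply ModNat_eq; intros; apply comp_assoc. Qed.

Program Definition functor_comp (C D E : Category) (G : Functor D E)
  (F : Functor C D) : Functor C E := {|
  fob := fun x => G (F x);
  fmap := fun x y f => fmap G (fmap F f) |}.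
Next Obligation. intros. rewrite !fmap_id. reflexivity. Qed.
Next Obligation. intros. rewrite !fmap_comp. reflexivity. Qed.

Program Definition modfun_comp (B : MonCat) (M N P : LModule B)
  (G : ModFun N P) (F : ModFun M N) : ModFun M P := {|
  mfun := functor_comp G F;
  mstr := fun b x => fmap G (mstr F b x) ∘ mstr G b (F x) |}.
Next Obligation.
  intros. simpl. apply is_iso_comp; [apply is_iso_fmap|]; apply mstr_iso.
Qed.
Next Obligation.
  intros. simpl. catn. rw mstr_nat. rwl fmap_comp. rewrite mstr_nat, fmap_comp.
  catn. reflexivity.
Qed.
Next Obligation.
  intros. simpl. catn. rwl fmap_comp. rewrite mstr_asc, !fmap_comp. catn.
  rw mstr_asc. rewrite actm_l. catn. f_equal. rwl mstr_nat. reflexivity.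
Qed.
Next Obligation.
  intros. simpl. catn. rwl fmap_comp. rewrite mstr_lun, mstr_lun. reflexivity.
Qed.

(* [hb_one] already follows from the other axioms; it is kept as a field for
   convenience. *)
Record HalfBraiding (B : MonCat) (a : B) : Type := {
  hb :> forall b : B, hom (b ⊗ a) (a ⊗ b);
  hb_iso : forall b, is_iso (hb b);
  hb_nat : forall (b b' : B) (f : hom b b'),
    hb b' ∘ (f ⊗m idm a) = (idm a ⊗m f) ∘ hb b;
  hb_tens : forall b c,
    hb (b ⊗ c)
    = asc a b c ∘ ((hb b ⊗m idm c) ∘ (asci b a c ∘ ((idm b ⊗m hb c) ∘ asc b c a)));
  hb_one : run a ∘ hb (one B) = lun a }.

(* The left [B]-module structure [b ⊙ (a ⊙ x) -> a ⊙ (b ⊙ x)] on the functor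
   [a ⊙ -] induced by a half-braiding on [a]. *)
Definition hbact (B : MonCat) (M : LModule B) (a : B) (g : HalfBraiding a)
  (b : B) (x : M) : hom (b ⊙ a ⊙ x) (a ⊙ b ⊙ x) :=
  aasc a b x ∘ ((g b ⊙m idm x) ∘ aasci b a x).

Section HalfBraidingAction.
Variables (B : MonCat) (M : LModule B).
Implicit Types (a b c : B) (x y : M).

Lemma hbact_iso a (g : HalfBraiding a) b x : is_iso (hbact g b x).
Proof.
  unfold hbact. apply is_iso_comp; [|apply is_iso_comp].
  - exact (is_iso_intro (aasci_aasc a b x) (aasc_aasci a b x)).
  - destruct (hb_iso g b) as [h [h1 h2]]. exists (h ⊙m idm x).
    rewrite <- !actm_r, h1, h2, !actm_id. split; reflexivity.
  - exact (is_iso_intro (aasc_aasci b a x) (aasci_aasc b a x)).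
Qed.

Lemma hbact_nat a (g : HalfBraiding a) b b' x x' (f : hom b b') (h : hom x x') :
  hbact g b' x' ∘ (f ⊙m (idm a ⊙m h)) = (idm a ⊙m (f ⊙m h)) ∘ hbact g b x.
Proof.
  unfold hbact. catn. rw aasci_nat. rewrite (ra (eq_sym (actm_comp _ _ _ _))).
  rewrite comp_idl, hb_nat, <- (comp_idr h), actm_comp. catn.
  rw aasc_nat. reflexivity.
Qed.

Lemma hbact_asc a (g : HalfBraiding a) b c x :
  (idm a ⊙m aasc b c x) ∘ hbact g (b ⊗ c) x
  = hbact g b (c ⊙ x) ∘ ((idm b ⊙m hbact g c x) ∘ aasc b c (a ⊙ x)).
Proof.
  unfold hbact. rewrite hb_tens, !actm_r, !actm_l. catn.
  rwl act_pentagon. rw aasc_nat. rewrite actm_id. do 2 f_equal.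
  rw act_pentagon_1. rw aasc_nat. rw act_pentagon_2. reflexivity.
Qed.

Lemma hbact_lun a (g : HalfBraiding a) x :
  (idm a ⊙m alun x) ∘ hbact g (one B) x = alun (a ⊙ x).
Proof.
  unfold hbact. rw act_triangle. rewrite (ra (eq_sym (actm_r _ _ _))), hb_one.
  rewrite <- alun_aasc. catn. rewrite aasc_aasci, comp_idr. reflexivity.
Qed.

End HalfBraidingAction.

Definition hbreg (B : MonCat) (a : B) (g : HalfBraiding a) (b x : B)
  : hom (b ⊗ (a ⊗ x)) (a ⊗ (b ⊗ x)) :=
  asc a b x ∘ ((g b ⊗m idm x) ∘ asci b a x).

Section HalfBraidingTensor.
Variable B : MonCat.
Implicit Types a b c x y : B.

Lemma hbreg_nat a (g : HalfBraiding a) b b' x x' (f : hom b b') (h : hom x x') :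
  hbreg g b' x' ∘ (f ⊗m (idm a ⊗m h)) = (idm a ⊗m (f ⊗m h)) ∘ hbreg g b x.
Proof. exact (hbact_nat (M := regular B) g f h). Qed.

Lemma hbreg_asc a (g : HalfBraiding a) b c x :
  (idm a ⊗m asc b c x) ∘ hbreg g (b ⊗ c) x
  = hbreg g b (c ⊗ x) ∘ ((idm b ⊗m hbreg g c x) ∘ asc b c (a ⊗ x)).
Proof. exact (hbact_asc (M := regular B) g b c x). Qed.

Lemma hbreg_lun a (g : HalfBraiding a) x :
  (idm a ⊗m lun x) ∘ hbreg g (one B) x = lun (a ⊗ x).
Proof. exact (hbact_lun (M := regular B) g x). Qed.

Lemma hbreg_act (M : LModule B) a (g : HalfBraiding a) b x (y : M) :
  aasc a (b ⊗ x) y ∘ (hbreg g b x ⊙m idm y)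
  = (idm a ⊙m aasci b x y)
    ∘ (hbact g b (x ⊙ y) ∘ ((idm b ⊙m aasc a x y) ∘ aasc b (a ⊗ x) y)).
Proof.
  apply (@iso_cancel_l _ _ _ _ (idm a ⊙m aasc b x y) (idm a ⊙m aasci b x y)).
  { rewrite <- actm_l, aasci_aasc, actm_id. reflexivity. }
  rewrite (ra (eq_sym (actm_l _ _ _))), aasc_aasci, actm_id, comp_idl.
  unfold hbreg, hbact. rewrite !actm_r. catn. rwl act_pentagon. rw aasc_nat.
  rw act_pentagon_1. rewrite actm_id. reflexivity.
Qed.

Lemma hbreg_tens a (g : HalfBraiding a) b x y :
  asc a (b ⊗ x) y ∘ (hbreg g b x ⊗m idm y)
  = (idm a ⊗m asci b x y)
    ∘ (hbreg g b (x ⊗ y) ∘ ((idm b ⊗m asc a x y) ∘ asc b (a ⊗ x) y)).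
Proof. exact (hbreg_act (M := regular B) g b x y). Qed.

Lemma pentagon_1 a b c x :
  asc (a ⊗ b) c x ∘ (asci a b c ⊗m idm x)
  = asci a b (c ⊗ x) ∘ ((idm a ⊗m asc b c x) ∘ asc a (b ⊗ c) x).
Proof. exact (act_pentagon_1 (M := regular B) a b c x). Qed.

End HalfBraidingTensor.

(* [b ⊗ (a ⊗ a') -> a ⊗ (b ⊗ a') -> a ⊗ (a' ⊗ b) -> (a ⊗ a') ⊗ b]. *)
Program Definition hbtens (B : MonCat) (a a' : B) (g : HalfBraiding a)
  (g' : HalfBraiding a') : HalfBraiding (a ⊗ a') := {|
  hb := fun b => asci a a' b ∘ ((idm a ⊗m g' b) ∘ hbreg g b a') |}.
Next Obligation.
  apply is_iso_comp; [|apply is_iso_comp].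
  - exact (is_iso_intro (asc_asci a a' b) (asci_asc a a' b)).
  - destruct (hb_iso g' b) as [h [h1 h2]]. exists (idm a ⊗m h).
    rewrite <- !tensm_l, h1, h2, !tensm_id. split; reflexivity.
  - exact (hbact_iso (M := regular B) g b a').
Qed.
Next Obligation.
  catn. rewrite <- tensm_id. rw hbreg_nat. rewrite (ra (eq_sym (tensm_l _ _ _))).
  rewrite hb_nat, tensm_l. catn. rw asci_nat. reflexivity.
Qed.
Next Obligation.
  rewrite !tensm_r, !tensm_l. catn. rw pentagon_1.
  f_equal. rw asc_nat. rw hbreg_tens. rw asc_asci.
  rewrite (ra (eq_sym (tensm_l _ _ (asci a a' c)))), asc_asci, tensm_id, comp_idl.
  rw hbreg_nat. rwl hbreg_asc. rewrite hb_tens, !tensm_l. catn. reflexivity.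
Qed.
Next Obligation.
  rewrite <- run_asc. catn. rw asc_asci. rewrite (ra (eq_sym (tensm_l _ _ _))).
  rewrite hb_one. apply hbreg_lun.
Qed.

Lemma hbtens_act (B : MonCat) (M : LModule B) (a a' : B) (g : HalfBraiding a)
  (g' : HalfBraiding a') (b : B) (x : M) :
  aasc a a' (b ⊙ x) ∘ hbact (hbtens g g') b x
  = (idm a ⊙m hbact g' b x)
    ∘ (hbact g b (a' ⊙ x) ∘ (idm b ⊙m aasc a a' x)).
Proof.
  unfold hbact at 1; simpl. rewrite !actm_r. catn. rw act_pentagon_1.
  rw aasc_aasci. rw aasc_nat. rw hbreg_act. rewrite aasc_aasci, comp_idr.
  unfold hbact at 2. rewrite !actm_l. catn. reflexivity.
Qed.

Program Definition hbone (B : MonCat) : HalfBraiding (one B) := {|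
  hb := fun b => luni b ∘ run b |}.
Next Obligation.
  apply is_iso_comp.
  - exact (is_iso_intro (lun_luni b) (luni_lun b)).
  - exact (is_iso_intro (runi_run b) (run_runi b)).
Qed.
Next Obligation. catn. rewrite run_nat, comp_assoc, luni_nat. catn. reflexivity. Qed.
Next Obligation.
  rewrite tensm_l, tensm_r. catn. rw run_asc. rw triangle'. rw asci_asc.
  rw asc_luni. rewrite (ra (eq_sym (tensm_r _ _ _))), run_runi, tensm_id, comp_idl.
  reflexivity.
Qed.
Next Obligation. rewrite <- lun_run_one. rw lun_luni. reflexivity. Qed.

Record Z1Ob (B : MonCat) : Type := {
  z1ob :> B;
  z1hb : HalfBraiding z1ob }.

Record Z1Hom (B : MonCat) (a a' : Z1Ob B) : Type := {
  z1hom :> hom a a';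
  z1hom_hb : forall b,
    (z1hom ⊗m idm b) ∘ z1hb a b = z1hb a' b ∘ (idm b ⊗m z1hom) }.

Lemma Z1Hom_eq (B : MonCat) (a a' : Z1Ob B) (f g : Z1Hom a a') :
  z1hom f = z1hom g -> f = g.
Proof.
  destruct f as [f Hf], g as [g Hg]; simpl; intros E; subst g.
  f_equal; apply proof_irrelevance.
Qed.

Program Definition Z1_id (B : MonCat) (a : Z1Ob B) : Z1Hom a a :=
  {| z1hom := idm (z1ob a) |}.
Next Obligation. rewrite !tensm_id, comp_idl, comp_idr. reflexivity. Qed.

Program Definition Z1_comp (B : MonCat) (a a' a'' : Z1Ob B)
  (g : Z1Hom a' a'') (f : Z1Hom a a') : Z1Hom a a'' :=
  {| z1hom := z1hom g ∘ z1hom f |}.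
Next Obligation.
  rewrite tensm_r, tensm_l. catn. rw z1hom_hb. rw z1hom_hb. reflexivity.
Qed.

Program Definition Z1Cat (B : MonCat) : Category := {|
  ob := Z1Ob B; hom := @Z1Hom B; idm := @Z1_id B; comp := @Z1_comp B |}.
Next Obligation. apply Z1Hom_eq, comp_idl. Qed.
Next Obligation. apply Z1Hom_eq, comp_idr. Qed.
Next Obligation. apply Z1Hom_eq, comp_assoc. Qed.

Definition Z1_tens (B : MonCat) (a a' : Z1Ob B) : Z1Ob B :=
  {| z1ob := z1ob a ⊗ z1ob a'; z1hb := hbtens (z1hb a) (z1hb a') |}.

Definition Z1_one (B : MonCat) : Z1Ob B :=
  {| z1ob := one B; z1hb := hbone B |}.

Lemma z1hom_act (B : MonCat) (M : LModule B) (a a' : Z1Ob B) (f : Z1Hom a a')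
  (b : B) (x : M) :
  (z1hom f ⊙m idm (b ⊙ x)) ∘ hbact (z1hb a) b x
  = hbact (z1hb a') b x ∘ (idm b ⊙m (z1hom f ⊙m idm x)).
Proof.
  unfold hbact. catn. rw aasci_nat. rewrite (ra (eq_sym (actm_r _ _ _))).
  rewrite <- z1hom_hb, actm_r, <- actm_id. catn. rw aasc_nat. reflexivity.
Qed.

Program Definition Z1_tensm (B : MonCat) (a a' b b' : Z1Ob B)
  (f : Z1Hom a a') (g : Z1Hom b b') : Z1Hom (Z1_tens a b) (Z1_tens a' b') :=
  {| z1hom := z1hom f ⊗m z1hom g |}.
Next Obligation.
  rename b0 into c.
  pose proof (z1hom_act (M := regular B) f c b) as E.
  change ((z1hom f ⊗m idm (c ⊗ b)) ∘ hbreg (z1hb a) c b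
  = hbreg (z1hb a') c b ∘ (idm c ⊗m (z1hom f ⊗m idm (z1ob b)))) in E.
  catn. rwl asci_nat.
  rewrite (ra (eq_sym (tensm_comp _ _ _ _))), z1hom_hb, comp_idr.
  transitivity (asci a' b' c ∘ ((idm (z1ob a') ⊗m z1hb b' c)
    ∘ ((idm (z1ob a') ⊗m (idm c ⊗m z1hom g))
       ∘ ((z1hom f ⊗m idm (c ⊗ b)) ∘ hbreg (z1hb a) c b)))).
  - rewrite (ra (eq_sym (tensm_comp _ _ _ _))), (ra (eq_sym (tensm_comp _ _ _ _))).
    catn. reflexivity.
  - rewrite E, (ra (eq_sym (hbreg_nat _ _ _))). catn.
    rewrite <- tensm_l, <- tensm_comp, comp_idl, comp_idr. reflexivity.
Qed.

Program Definition Z1_asc (B : MonCat) (a b c : Z1Ob B)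
  : Z1Hom (Z1_tens (Z1_tens a b) c) (Z1_tens a (Z1_tens b c)) :=
  {| z1hom := asc (z1ob a) (z1ob b) (z1ob c) |}.
Next Obligation.
  rename b0 into d.
  pose proof (hbtens_act (M := regular B) (z1hb a) (z1hb b) d c) as E.
  change (asc (z1ob a) (z1ob b) (d ⊗ c) ∘ hbreg (hbtens (z1hb a) (z1hb b)) d c
    = (idm (z1ob a) ⊗m hbreg (z1hb b) d c)
      ∘ (hbreg (z1hb a) d (b ⊗ c) ∘ (idm d ⊗m asc (z1ob a) (z1ob b) (z1ob c)))) in E.
  rewrite !tensm_l. catn. rwl E.
  apply (@iso_cancel_l _ _ _ _ (asc (z1ob a) (b ⊗ c) d) (asci (z1ob a) (b ⊗ c) d));
    [apply asci_asc|].
  rw asc_asci.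
  apply (@iso_cancel_l _ _ _ _ (idm (z1ob a) ⊗m asc (z1ob b) (z1ob c) d)
    (idm (z1ob a) ⊗m asci (z1ob b) (z1ob c) d)).
  { rewrite <- tensm_l, asci_asc, tensm_id. reflexivity. }
  rwl pentagon. rw asc_asci.
  rewrite (ra (eq_sym (tensm_l _ (asc _ _ _) _))), asc_asci, tensm_id, comp_idl.
  rwl asc_nat. rewrite tensm_id. reflexivity.
Qed.

Lemma z1_inv (B : MonCat) (a a' : Z1Ob B) (f : hom (z1ob a) a')
  (g : hom (z1ob a') a) : g ∘ f = idm _ -> f ∘ g = idm _ ->
  (forall b, (f ⊗m idm b) ∘ z1hb a b = z1hb a' b ∘ (idm b ⊗m f)) ->
  forall b, (g ⊗m idm b) ∘ z1hb a' b = z1hb a b ∘ (idm b ⊗m g).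
Proof.
  intros gf fg H b.
  apply (@iso_cancel_l _ _ _ _ (f ⊗m idm b) (g ⊗m idm b)).
  { rewrite <- tensm_r, gf, tensm_id. reflexivity. }
  rw H. rewrite <- tensm_l, (ra (eq_sym (tensm_r _ _ _))), fg, !tensm_id.
  catn. reflexivity.
Qed.

Program Definition Z1_asci (B : MonCat) (a b c : Z1Ob B)
  : Z1Hom (Z1_tens a (Z1_tens b c)) (Z1_tens (Z1_tens a b) c) :=
  {| z1hom := asci (z1ob a) (z1ob b) (z1ob c) |}.
Next Obligation.
  exact (z1_inv (a := Z1_tens (Z1_tens a b) c) (a' := Z1_tens a (Z1_tens b c))
    (asci_asc _ _ _) (asc_asci _ _ _) (z1hom_hb (Z1_asc a b c)) b0).
Qed.

Program Definition Z1_lun (B : MonCat) (a : Z1Ob B)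
  : Z1Hom (Z1_tens (Z1_one B) a) a := {| z1hom := lun (z1ob a) |}.
Next Obligation.
  rewrite <- lun_asc. catn. rw asc_asci. rw lun_nat. f_equal.
  unfold hbreg; simpl. rewrite tensm_r. catn. rw asc_luni. rw lun_luni.
  rewrite <- triangle. catn. rewrite asc_asci, comp_idr. reflexivity.
Qed.

Program Definition Z1_luni (B : MonCat) (a : Z1Ob B)
  : Z1Hom a (Z1_tens (Z1_one B) a) := {| z1hom := luni (z1ob a) |}.
Next Obligation.
  exact (z1_inv (a := Z1_tens (Z1_one B) a) (a' := a)
    (luni_lun _) (lun_luni _) (z1hom_hb (Z1_lun a)) b).
Qed.

Program Definition Z1_run (B : MonCat) (a : Z1Ob B)
  : Z1Hom (Z1_tens a (Z1_one B)) a := {| z1hom := run (z1ob a) |}.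
Next Obligation.
  unfold hbreg. rewrite tensm_l. catn. rewrite <- triangle. catn. rw asc_asci.
  rewrite (ra (eq_sym (tensm_l _ (lun b) _))), lun_luni, tensm_id, comp_idl.
  rw run_asc. rw run_nat. rewrite <- run_asc. catn. rewrite asc_asci, comp_idr.
  reflexivity.
Qed.

Program Definition Z1_runi (B : MonCat) (a : Z1Ob B)
  : Z1Hom a (Z1_tens a (Z1_one B)) := {| z1hom := runi (z1ob a) |}.
Next Obligation.
  exact (z1_inv (a := Z1_tens a (Z1_one B)) (a' := a)
    (runi_run _) (run_runi _) (z1hom_hb (Z1_run a)) b).
Qed.

(* The Drinfeld center as a monoidal category. It also serves as the center with
   the anti-braiding: the two have the same underlying monoidal category, and
   modules and enrichment only involve the latter. *)
Program Definition Z1 (B : MonCat) : MonCat := {|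
  mcat := Z1Cat B;
  tens := @Z1_tens B; tensm := @Z1_tensm B; one := Z1_one B;
  asc := @Z1_asc B; asci := @Z1_asci B; lun := @Z1_lun B; luni := @Z1_luni B;
  run := @Z1_run B; runi := @Z1_runi B |}.
Next Obligation. apply Z1Hom_eq, tensm_id. Qed.
Next Obligation. apply Z1Hom_eq, tensm_comp. Qed.
Next Obligation. apply Z1Hom_eq, asci_asc. Qed.
Next Obligation. apply Z1Hom_eq, asc_asci. Qed.
Next Obligation. apply Z1Hom_eq, luni_lun. Qed.
Next Obligation. apply Z1Hom_eq, lun_luni. Qed.
Next Obligation. apply Z1Hom_eq, runi_run. Qed.
Next Obligation. apply Z1Hom_eq, run_runi. Qed.
Next Obligation. apply Z1Hom_eq, asc_nat. Qed.
Next Obligation. apply Z1Hom_eq, lun_nat. Qed.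
Next Obligation. apply Z1Hom_eq, run_nat. Qed.
Next Obligation. apply Z1Hom_eq, pentagon. Qed.
Next Obligation. apply Z1Hom_eq, triangle. Qed.

Program Definition act_functor (B : MonCat) (M : LModule B) (a : B)
  : Functor M M := {| fob := fun x => a ⊙ x; fmap := fun x y f => idm a ⊙m f |}.
Next Obligation. apply actm_id. Qed.
Next Obligation. apply actm_l. Qed.

Program Definition Z1_act_functor (B : MonCat) (M : LModule B) (a : Z1 B)
  : ModFun M M := {|
  mfun := act_functor M (z1ob a);
  mstr := fun b x => hbact (z1hb a) b x |}.
Next Obligation. apply hbact_iso. Qed.
Next Obligation. apply hbact_nat. Qed.
Next Obligation. apply hbact_asc. Qed.
Next Obligation. apply hbact_lun. Qed.

Section CenterAction.
Variables (B : MonCat) (M N : LModule B).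

Definition Z1_act (a : Z1 B) (F : ModFun M N) : ModFun M N :=
  modfun_comp (Z1_act_functor N a) F.

Program Definition Z1_actm (a a' : Z1 B) (F F' : ModFun M N)
  (f : hom a a') (t : ModNat F F') : ModNat (Z1_act a F) (Z1_act a' F') :=
  {| mnat := fun x => z1hom f ⊙m t x |}.
Next Obligation.
  rewrite <- !actm_comp, comp_idl, comp_idr, mnat_nat. reflexivity.
Qed.
Next Obligation.
  transitivity ((idm (z1ob a') ⊙m mstr F' b x)
    ∘ ((idm (z1ob a') ⊙m (idm b ⊙m t x))
       ∘ ((z1hom f ⊙m idm (b ⊙ F x)) ∘ hbact (z1hb a) b (F x)))).
  - rewrite !comp_assoc, <- !actm_comp, !comp_idl, !comp_idr, mnat_str.
    reflexivity.
  - rewrite (z1hom_act f), (ra (eq_sym (hbact_nat _ _ _))). catn.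
    rewrite <- actm_l, <- actm_comp, comp_idl, comp_idr. reflexivity.
Qed.

Program Definition Z1_aasc (a a' : Z1 B) (F : ModFun M N)
  : ModNat (Z1_act (a ⊗ a') F) (Z1_act a (Z1_act a' F)) :=
  {| mnat := fun x => aasc (z1ob a) (z1ob a') (F x) |}.
Next Obligation. rewrite <- aasc_nat, tensm_id. reflexivity. Qed.
Next Obligation.
  rewrite actm_l. catn. rewrite <- hbtens_act. rw (eq_sym (aasc_nat _ _ (mstr F b x))).
  rewrite tensm_id. reflexivity.
Qed.

Lemma modnat_inv (F G : ModFun M N) (s : ModNat F G)
  (t : forall x, hom (G x) (F x)) (ts : forall x, t x ∘ s x = idm _)
  (st : forall x, s x ∘ t x = idm _) :
  (forall x y (f : hom x y), t y ∘ fmap G f = fmap F f ∘ t x) /\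
  (forall b x, t (b ⊙ x) ∘ mstr G b x = mstr F b x ∘ (idm b ⊙m t x)).
Proof.
  split; intros.
  - apply (iso_cancel_l (ts y)). rw st. rw mnat_nat. rw st. reflexivity.
  - apply (iso_cancel_l (ts (b ⊙ x))). rw st. rw mnat_str.
    rewrite <- actm_l, st, actm_id, comp_idr. reflexivity.
Qed.

Program Definition Z1_aasci (a a' : Z1 B) (F : ModFun M N)
  : ModNat (Z1_act a (Z1_act a' F)) (Z1_act (a ⊗ a') F) :=
  {| mnat := fun x => aasci (z1ob a) (z1ob a') (F x) |}.
Next Obligation.
  exact (proj1 (modnat_inv (s := Z1_aasc a a' F)
    (fun x => aasci_aasc _ _ _) (fun x => aasc_aasci _ _ _)) x y f).
Qed.
Next Obligation.
  exact (proj2 (modnat_inv (s := Z1_aasc a a' F)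
    (fun x => aasci_aasc _ _ _) (fun x => aasc_aasci _ _ _)) b x).
Qed.

Program Definition Z1_alun (F : ModFun M N)
  : ModNat (Z1_act (one (Z1 B)) F) F :=
  {| mnat := fun x => alun (F x) |}.
Next Obligation. apply alun_nat. Qed.
Next Obligation.
  rw alun_nat. f_equal. unfold hbact; simpl. rewrite actm_r. catn.
  rw aasc_aluni. rw alun_aluni. rewrite <- act_triangle. catn.
  rewrite aasc_aasci, comp_idr. reflexivity.
Qed.

Program Definition Z1_aluni (F : ModFun M N)
  : ModNat F (Z1_act (one (Z1 B)) F) :=
  {| mnat := fun x => aluni (F x) |}.
Next Obligation.
  exact (proj1 (modnat_inv (s := Z1_alun F)
    (fun x => aluni_alun _) (fun x => alun_aluni _)) x y f).
Qed.
Next Obligation.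
  exact (proj2 (modnat_inv (s := Z1_alun F)
    (fun x => aluni_alun _) (fun x => alun_aluni _)) b x).
Qed.

(* [Fun_B(M, N)] as a left module over the center, [a ⊙ F = a ⊙ F(-)]. *)
Program Definition FunMod : LModule (Z1 B) := {|
  lcat := ModFunCat M N;
  act := Z1_act; actm := Z1_actm;
  aasc := Z1_aasc; aasci := Z1_aasci; alun := Z1_alun; aluni := Z1_aluni |}.
Next Obligation. apply ModNat_eq; intros; apply actm_id. Qed.
Next Obligation. apply ModNat_eq; intros; apply actm_comp. Qed.
Next Obligation. apply ModNat_eq; intros; apply aasci_aasc. Qed.
Next Obligation. apply ModNat_eq; intros; apply aasc_aasci. Qed.
Next Obligation. apply ModNat_eq; intros; apply aluni_alun. Qed.
Next Obligation. apply ModNat_eq; intros; apply alun_aluni. Qed.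
Next Obligation. apply ModNat_eq; intros; apply aasc_nat. Qed.
Next Obligation. apply ModNat_eq; intros; apply alun_nat. Qed.
Next Obligation. apply ModNat_eq; intros; apply act_pentagon. Qed.
Next Obligation. apply ModNat_eq; intros; apply act_triangle. Qed.

End CenterAction.

Record LaxMon (A B : MonCat) : Type := {
  lfun :> Functor A B;
  lmu : forall a b : A, hom (lfun a ⊗ lfun b) (lfun (a ⊗ b));
  leta : hom (one B) (lfun (one A));
  lmu_nat : forall (a a' b b' : A) (f : hom a a') (g : hom b b'),
    lmu a' b' ∘ (fmap lfun f ⊗m fmap lfun g) = fmap lfun (f ⊗m g) ∘ lmu a b;
  lmu_asc : forall a b c : A,
    fmap lfun (asc a b c) ∘ (lmu (a ⊗ b) c ∘ (lmu a b ⊗m idm (lfun c)))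
    = lmu a (b ⊗ c) ∘ ((idm (lfun a) ⊗m lmu b c)
                        ∘ asc (lfun a) (lfun b) (lfun c));
  lmu_lun : forall a : A,
    fmap lfun (lun a) ∘ (lmu (one A) a ∘ (leta ⊗m idm (lfun a)))
    = lun (lfun a);
  lmu_run : forall a : A,
    fmap lfun (run a) ∘ (lmu a (one A) ∘ (idm (lfun a) ⊗m leta))
    = run (lfun a) }.

Arguments lmu {A B} _ _ _.
Arguments leta {A B} _.

Definition is_strong (A B : MonCat) (F : LaxMon A B) : Prop :=
  is_iso (leta F) /\ forall a b, is_iso (lmu F a b).

Record MonNat (A B : MonCat) (F G : LaxMon A B) : Type := {
  mn :> forall a : A, hom (F a) (G a);
  mn_nat : forall (a b : A) (f : hom a b), mn b ∘ fmap F f = fmap G f ∘ mn a;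
  mn_mu : forall a b, mn (a ⊗ b) ∘ lmu F a b = lmu G a b ∘ (mn a ⊗m mn b);
  mn_eta : mn (one A) ∘ leta F = leta G }.

Program Definition functor_id (C : Category) : Functor C C := {|
  fob := fun x => x; fmap := fun x y f => f |}.
Next Obligation. reflexivity. Qed.
Next Obligation. reflexivity. Qed.

Program Definition lax_id (A : MonCat) : LaxMon A A := {|
  lfun := functor_id A;
  lmu := fun a b => idm (a ⊗ b);
  leta := idm (one A) |}.
Next Obligation. catn. reflexivity. Qed.
Next Obligation. rewrite !tensm_id. catn. reflexivity. Qed.
Next Obligation. rewrite !tensm_id. catn. reflexivity. Qed.
Next Obligation. rewrite !tensm_id. catn. reflexivity. Qed.

Program Definition lax_comp (A B C : MonCat) (G : LaxMon B C) (F : LaxMon A B)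
  : LaxMon A C := {|
  lfun := functor_comp G F;
  lmu := fun a b => fmap G (lmu F a b) ∘ lmu G (F a) (F b);
  leta := fmap G (leta F) ∘ leta G |}.
Next Obligation.
  catn. rw lmu_nat. rewrite (ra (eq_sym (fmap_comp _ _ _))), lmu_nat, fmap_comp.
  catn. reflexivity.
Qed.
Next Obligation.
  rewrite tensm_r, tensm_l. catn.
  rewrite <- (fmap_id G (F c)), <- (fmap_id G (F a)).
  rw lmu_nat. rw lmu_nat. rewrite !fmap_id. rw (eq_sym (lmu_asc G _ _ _)).
  pose proof (f_equal (fmap G) (lmu_asc F a b c)) as E.
  rewrite !fmap_comp in E. rw E. reflexivity.
Qed.
Next Obligation.
  rewrite tensm_r. catn. rewrite <- (fmap_id G (F a)). rw lmu_nat.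
  pose proof (f_equal (fmap G) (lmu_lun F a)) as E.
  rewrite !fmap_comp in E. rw E. rewrite fmap_id. apply lmu_lun.
Qed.
Next Obligation.
  rewrite tensm_l. catn. rewrite <- (fmap_id G (F a)). rw lmu_nat.
  pose proof (f_equal (fmap G) (lmu_run F a)) as E.
  rewrite !fmap_comp in E. rw E. rewrite fmap_id. apply lmu_run.
Qed.

Lemma is_strong_id (A : MonCat) : is_strong (lax_id A).
Proof. split; intros; apply is_iso_id. Qed.

Lemma is_strong_comp (A B C : MonCat) (G : LaxMon B C) (F : LaxMon A B) :
  is_strong G -> is_strong F -> is_strong (lax_comp G F).
Proof.
  intros [G1 G2] [F1 F2]. split; intros; simpl; apply is_iso_comp; auto;
    apply is_iso_fmap; auto.
Qed.

Program Definition mn_id (A B : MonCat) (F : LaxMon A B) : MonNat F F :=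
  {| mn := fun a => idm (F a) |}.
Next Obligation. catn. reflexivity. Qed.
Next Obligation. rewrite tensm_id. catn. reflexivity. Qed.
Next Obligation. catn. reflexivity. Qed.

Program Definition mn_comp (A B : MonCat) (F G H : LaxMon A B)
  (t : MonNat G H) (s : MonNat F G) : MonNat F H :=
  {| mn := fun a => t a ∘ s a |}.
Next Obligation. catn. rw mn_nat. rw mn_nat. reflexivity. Qed.
Next Obligation. catn. rewrite tensm_comp. rw mn_mu. rw mn_mu. reflexivity. Qed.
Next Obligation. catn. rw mn_eta. rw mn_eta. reflexivity. Qed.

Program Definition mn_whisk_l (A B C : MonCat) (H : LaxMon B C)
  (F G : LaxMon A B) (s : MonNat F G) : MonNat (lax_comp H F) (lax_comp H G) :=
  {| mn := fun a => fmap H (s a) |}.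
Next Obligation. rewrite <- !fmap_comp, mn_nat. reflexivity. Qed.
Next Obligation.
  catn. rw lmu_nat. rewrite !comp_assoc, <- !fmap_comp, mn_mu. reflexivity.
Qed.
Next Obligation. rewrite !comp_assoc, <- !fmap_comp, mn_eta. reflexivity. Qed.

Program Definition mn_whisk_r (A B C : MonCat) (F G : LaxMon B C)
  (s : MonNat F G) (K : LaxMon A B) : MonNat (lax_comp F K) (lax_comp G K) :=
  {| mn := fun a => s (K a) |}.
Next Obligation. apply mn_nat. Qed.
Next Obligation. catn. rw mn_nat. rw mn_mu. reflexivity. Qed.
Next Obligation. catn. rw mn_nat. rw mn_eta. reflexivity. Qed.

Lemma MonNat_eq (A B : MonCat) (F G : LaxMon A B) (s t : MonNat F G) :
  (forall a, s a = t a) -> s = t.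
Proof.
  destruct s as [s s1 s2 s3], t as [t t1 t2 t3]; simpl; intros E.
  apply functional_extensionality_dep in E. subst t.
  f_equal; apply proof_irrelevance.
Qed.

Program Definition prod_cat (C D : Category) : Category := {|
  ob := (C * D)%type;
  hom := fun x y => (hom (fst x) (fst y) * hom (snd x) (snd y))%type;
  idm := fun x => (idm (fst x), idm (snd x));
  comp := fun x y z g f => (fst g ∘ fst f, snd g ∘ snd f) |}.
Next Obligation. rewrite !comp_idl. destruct f; reflexivity. Qed.
Next Obligation. rewrite !comp_idr. destruct f; reflexivity. Qed.
Next Obligation. rewrite !comp_assoc. reflexivity. Qed.

Program Definition prod_mon (A B : MonCat) : MonCat := {|
  mcat := prod_cat A B;
  tens := fun x y => (fst x ⊗ fst y, snd x ⊗ snd y);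
  tensm := fun _ _ _ _ f g => (fst f ⊗m fst g, snd f ⊗m snd g);
  one := (one A, one B);
  asc := fun x y z =>
    (asc (fst x) (fst y) (fst z), asc (snd x) (snd y) (snd z));
  asci := fun x y z =>
    (asci (fst x) (fst y) (fst z), asci (snd x) (snd y) (snd z));
  lun := fun x => (lun (fst x), lun (snd x));
  luni := fun x => (luni (fst x), luni (snd x));
  run := fun x => (run (fst x), run (snd x));
  runi := fun x => (runi (fst x), runi (snd x)) |}.
Next Obligation. f_equal; apply tensm_id. Qed.
Next Obligation. f_equal; apply tensm_comp. Qed.
Next Obligation. f_equal; apply asci_asc. Qed.
Next Obligation. f_equal; apply asc_asci. Qed.
Next Obligation. f_equal; apply luni_lun. Qed.
Next Obligation. f_equal; apply lun_luni. Qed.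
Next Obligation. f_equal; apply runi_run. Qed.
Next Obligation. f_equal; apply run_runi. Qed.
Next Obligation. f_equal; apply asc_nat. Qed.
Next Obligation. f_equal; apply lun_nat. Qed.
Next Obligation. f_equal; apply run_nat. Qed.
Next Obligation. f_equal; apply pentagon. Qed.
Next Obligation. f_equal; apply triangle. Qed.

Lemma is_iso_pair (C D : Category) (x y : prod_cat C D)
  (f : hom (fst x) (fst y)) (g : hom (snd x) (snd y)) :
  is_iso f -> is_iso g -> is_iso ((f, g) : hom x y).
Proof.
  intros [f' [f1 f2]] [g' [g1 g2]]. exists (f', g'); simpl.
  rewrite f1, f2, g1, g2. split; reflexivity.
Qed.

Program Definition prod_functor (C D C' D' : Category) (F : Functor C C')
  (G : Functor D D') : Functor (prod_cat C D) (prod_cat C' D') := {|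
  fob := fun x => (F (fst x), G (snd x));
  fmap := fun x y f => (fmap F (fst f), fmap G (snd f)) |}.
Next Obligation. rewrite !fmap_id. reflexivity. Qed.
Next Obligation. rewrite !fmap_comp. reflexivity. Qed.

Program Definition prod_lax (A B A' B' : MonCat) (F : LaxMon A A')
  (G : LaxMon B B') : LaxMon (prod_mon A B) (prod_mon A' B') := {|
  lfun := prod_functor F G;
  lmu := fun x y => (lmu F (fst x) (fst y), lmu G (snd x) (snd y));
  leta := (leta F, leta G) |}.
Next Obligation. f_equal; apply lmu_nat. Qed.
Next Obligation. f_equal; apply lmu_asc. Qed.
Next Obligation. f_equal; apply lmu_lun. Qed.
Next Obligation. f_equal; apply lmu_run. Qed.

Lemma is_strong_prod (A B A' B' : MonCat) (F : LaxMon A A') (G : LaxMon B B') :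
  is_strong F -> is_strong G -> is_strong (prod_lax F G).
Proof.
  intros [F1 F2] [G1 G2].
  split; intros; apply (is_iso_pair (C := A') (D := B')); simpl; auto.
Qed.

Program Definition prod_mn (A B A' B' : MonCat) (F F' : LaxMon A A')
  (G G' : LaxMon B B') (s : MonNat F F') (t : MonNat G G')
  : MonNat (prod_lax F G) (prod_lax F' G') :=
  {| mn := fun x => (s (fst x), t (snd x)) |}.
Next Obligation. f_equal; apply mn_nat. Qed.
Next Obligation. f_equal; apply mn_mu. Qed.
Next Obligation. f_equal; apply mn_eta. Qed.

Program Definition unit_cat : Category := {|
  ob := unit; hom := fun _ _ => unit; idm := fun _ => tt;
  comp := fun _ _ _ _ _ => tt |}.
Next Obligation. destruct f; reflexivity. Qed.
Next Obligation. destruct f; reflexivity. Qed.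
Next Obligation. reflexivity. Qed.

Program Definition unit_mon : MonCat := {|
  mcat := unit_cat;
  tens := fun _ _ => tt; tensm := fun _ _ _ _ _ _ => tt; one := tt;
  asc := fun _ _ _ => tt; asci := fun _ _ _ => tt;
  lun := fun _ => tt; luni := fun _ => tt;
  run := fun _ => tt; runi := fun _ => tt |}.
Solve Obligations with
  intros; repeat match goal with u : _ |- _ => destruct u end; reflexivity.

Program Definition snd_functor (C D : Category) : Functor (prod_cat C D) D := {|
  fob := fun x => snd x; fmap := fun x y f => snd f |}.
Next Obligation. reflexivity. Qed.
Next Obligation. reflexivity. Qed.

Program Definition snd_lax (A B : MonCat) : LaxMon (prod_mon A B) B := {|
  lfun := snd_functor A B;
  lmu := fun x y => idm (snd x ⊗ snd y);
  leta := idm (one B) |}.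
Next Obligation. catn. reflexivity. Qed.
Next Obligation. rewrite !tensm_id. catn. reflexivity. Qed.
Next Obligation. rewrite !tensm_id. catn. reflexivity. Qed.
Next Obligation. rewrite !tensm_id. catn. reflexivity. Qed.

Lemma is_strong_snd (A B : MonCat) : is_strong (snd_lax A B).
Proof. split; intros; apply is_iso_id. Qed.

Record ECategory (A : MonCat) : Type := {
  eob :> Type;
  ehom : eob -> eob -> A;
  eid : forall x, hom (one A) (ehom x x);
  ecomp : forall x y z, hom (ehom y z ⊗ ehom x y) (ehom x z);
  ecomp_idl : forall x y,
    ecomp x y y ∘ (eid y ⊗m idm (ehom x y)) = lun (ehom x y);
  ecomp_idr : forall x y,
    ecomp x x y ∘ (idm (ehom x y) ⊗m eid x) = run (ehom x y);
  ecomp_assoc : forall w x y z,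
    ecomp w x z ∘ (ecomp x y z ⊗m idm (ehom w x))
    = ecomp w y z ∘ ((idm (ehom y z) ⊗m ecomp w x y)
                      ∘ asc (ehom y z) (ehom x y) (ehom w x)) }.

Arguments ehom {A e} _ _.
Arguments eid {A e} _.
Arguments ecomp {A e} _ _ _.

Definition uhom (A : MonCat) (L : ECategory A) (x y : L) : Type :=
  hom (one A) (ehom x y).

Definition ucomp (A : MonCat) (L : ECategory A) (x y z : L)
  (g : uhom y z) (f : uhom x y) : uhom x z :=
  ecomp x y z ∘ ((g ⊗m f) ∘ luni (one A)).

(* The morphisms [L(w, f)] and [L(f, w)] induced by [f]. *)
Definition epost (A : MonCat) (L : ECategory A) (w x y : L) (f : uhom x y)
  : hom (ehom w x) (ehom w y) :=
  ecomp w x y ∘ ((f ⊗m idm (ehom w x)) ∘ luni (ehom w x)).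

Definition epre (A : MonCat) (L : ECategory A) (x y w : L) (f : uhom x y)
  : hom (ehom y w) (ehom x w) :=
  ecomp x y w ∘ ((idm (ehom y w) ⊗m f) ∘ runi (ehom y w)).

Arguments epost {A L} w {x y} f.
Arguments epre {A L x y} w f.

Section Underlying.
Variables (A : MonCat) (L : ECategory A).
Implicit Types w x y z : L.

Lemma epost_id w x : epost w (eid x) = idm (ehom w x).
Proof. unfold epost. rw ecomp_idl. apply lun_luni. Qed.

Lemma epre_id w x : epre w (eid x) = idm (ehom x w).
Proof. unfold epre. rw ecomp_idr. apply run_runi. Qed.

Lemma ucomp_post x y z (g : uhom y z) (f : uhom x y) :
  ucomp g f = epost x g ∘ f.
Proof.
  unfold ucomp, epost. catn. rw luni_nat.
  rewrite (ra (eq_sym (tensm_comp _ _ _ _))), comp_idl, comp_idr. reflexivity.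
Qed.

Lemma ucomp_pre x y z (g : uhom y z) (f : uhom x y) :
  ucomp g f = epre z f ∘ g.
Proof.
  unfold ucomp, epre. catn. rw runi_nat.
  rewrite (ra (eq_sym (tensm_comp _ _ _ _))), comp_idl, comp_idr.
  rewrite luni_runi_one. reflexivity.
Qed.

Lemma epost_comp w x y z (g : uhom y z) (f : uhom x y) :
  epost w (ucomp g f) = epost w g ∘ epost w f.
Proof.
  unfold epost, ucomp. rewrite !tensm_r. catn. rw ecomp_assoc. rw asc_nat.
  rw asc_luni. rewrite luni_nat. rw luni_nat.
  rewrite !comp_assoc. f_equal. rewrite <- !comp_assoc. f_equal.
  rewrite !comp_assoc, <- !tensm_comp. rewrite !comp_idl, !comp_idr.
  catn. reflexivity.
Qed.

Lemma epre_comp x y z w (g : uhom y z) (f : uhom x y) :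
  epre w (ucomp g f) = epre w f ∘ epre w g.
Proof.
  transitivity (ecomp x z w ∘ ((idm (ehom z w) ⊗m ecomp x y z) ∘
    ((idm (ehom z w) ⊗m (g ⊗m f)) ∘
    ((idm (ehom z w) ⊗m luni (one A)) ∘ runi (ehom z w))))).
  { unfold epre, ucomp. rewrite !tensm_l. catn. reflexivity. }
  rewrite triangle'. catn. rw (eq_sym (asc_nat (idm (ehom z w)) g f)).
  rw (eq_sym (ecomp_assoc x y z w)). unfold epre. catn.
  rewrite (runi_nat (ecomp y z w ∘ _)), !tensm_r. catn.
  rewrite !comp_assoc, <- !(comp_assoc (ecomp x y w)), <- !tensm_comp.
  rewrite !comp_idl, !comp_idr. reflexivity.
Qed.

Lemma epost_epre x x' y y' (g : uhom y y') (f : uhom x x') :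
  epost x g ∘ epre y f = epre y' f ∘ epost x' g.
Proof.
  transitivity (ecomp x y y' ∘ ((idm (ehom y y') ⊗m ecomp x x' y) ∘
    ((g ⊗m (idm (ehom x' y) ⊗m f)) ∘
    ((idm (one A) ⊗m runi (ehom x' y)) ∘ luni (ehom x' y))))).
  - unfold epost, epre. catn. rewrite luni_nat, !tensm_l. catn.
    rewrite !comp_assoc, <- !(comp_assoc (ecomp x y y')), <- !tensm_comp.
    rewrite !comp_idl, !comp_idr. reflexivity.
  - rewrite <- luni_nat, <- asc_luni. catn.
    rewrite (ra (eq_sym (asc_nat g (idm (ehom x' y)) f))). catn.
    rw (eq_sym (ecomp_assoc x x' y y')).
    unfold epost, epre. catn. rewrite (runi_nat (ecomp x' y y' ∘ _)), !tensm_r.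
    catn.
    rewrite !comp_assoc, <- !(comp_assoc (ecomp x x' y')), <- !tensm_comp.
    rewrite !comp_idl, !comp_idr. reflexivity.
Qed.

Lemma ucomp_assoc w x y z (h : uhom y z) (g : uhom x y) (f : uhom w x) :
  ucomp h (ucomp g f) = ucomp (ucomp h g) f.
Proof.
  rewrite (ucomp_post h), (ucomp_post g f), (ucomp_post (ucomp h g)), epost_comp.
  catn. reflexivity.
Qed.

Lemma ucomp_idl x y (f : uhom x y) : ucomp (eid y) f = f.
Proof. rewrite ucomp_post, epost_id, comp_idl. reflexivity. Qed.

Lemma ucomp_idr x y (f : uhom x y) : ucomp f (eid x) = f.
Proof. rewrite ucomp_pre, epre_id, comp_idl. reflexivity. Qed.

End Underlying.

(* [ehat] is only lax here; strength is imposed on the 1-morphisms [ECat1]. *)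
Record EFunctor (A B : MonCat) (L : ECategory A) (M : ECategory B) : Type := {
  ehat : LaxMon A B;
  efob :> L -> M;
  efhom : forall x y : L, hom (ehat (ehom x y)) (ehom (efob x) (efob y));
  efhom_id : forall x : L,
    efhom x x ∘ (fmap ehat (eid x) ∘ leta ehat) = eid (efob x);
  efhom_comp : forall x y z : L,
    efhom x z ∘ (fmap ehat (ecomp x y z) ∘ lmu ehat (ehom y z) (ehom x y))
    = ecomp (efob x) (efob y) (efob z) ∘ (efhom y z ⊗m efhom x y) }.

Arguments efhom {A B L M} _ _ _.

Record ENat (A B : MonCat) (L : ECategory A) (M : ECategory B)
  (F G : EFunctor L M) : Type := {
  enhat : MonNat (ehat F) (ehat G);
  enat :> forall x : L, uhom (F x) (G x);
  enat_nat : forall x y : L,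
    epost (F x) (enat y) ∘ efhom F x y
    = epre (G y) (enat x) ∘ (efhom G x y ∘ enhat (ehom x y)) }.

Lemma ENat_eq (A B : MonCat) (L : ECategory A) (M : ECategory B)
  (F G : EFunctor L M) (s t : ENat F G) :
  (forall a, enhat s a = enhat t a) -> (forall x, s x = t x) -> s = t.
Proof.
  destruct s as [s0 s s1], t as [t0 t t1]; simpl; intros E0 E.
  apply MonNat_eq in E0. apply functional_extensionality_dep in E. subst t t0.
  f_equal; apply proof_irrelevance.
Qed.

Definition umap (A B : MonCat) (L : ECategory A) (M : ECategory B)
  (F : EFunctor L M) (x y : L) (f : uhom x y) : uhom (F x) (F y) :=
  efhom F x y ∘ (fmap (ehat F) f ∘ leta (ehat F)).

Section Umap.
Variables (A B : MonCat) (L : ECategory A) (M : ECategory B).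
Variable F : EFunctor L M.

Lemma lmu_luni (H : LaxMon A B) a :
  lmu H (one A) a ∘ ((leta H ⊗m idm (H a)) ∘ luni (H a)) = fmap H (luni a).
Proof.
  apply (@iso_cancel_l _ _ _ _ (fmap H (lun a)) (fmap H (luni a))).
  { rewrite <- fmap_comp, luni_lun, fmap_id. reflexivity. }
  rw lmu_lun. rewrite <- fmap_comp, !lun_luni, fmap_id. reflexivity.
Qed.

Lemma lmu_runi (H : LaxMon A B) a :
  lmu H a (one A) ∘ ((idm (H a) ⊗m leta H) ∘ runi (H a)) = fmap H (runi a).
Proof.
  apply (@iso_cancel_l _ _ _ _ (fmap H (run a)) (fmap H (runi a))).
  { rewrite <- fmap_comp, runi_run, fmap_id. reflexivity. }
  rw lmu_run. rewrite <- fmap_comp, !run_runi, fmap_id. reflexivity.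
Qed.

Lemma umap_post w x y (f : uhom x y) :
  efhom F w y ∘ fmap (ehat F) (epost w f)
  = epost (F w) (umap F f) ∘ efhom F w x.
Proof.
  unfold epost, umap. rewrite !fmap_comp, <- lmu_luni. catn.
  rewrite (ra (eq_sym (lmu_nat _ _ _))), fmap_id. catn. rw efhom_comp.
  rewrite luni_nat, !comp_assoc, <- !(comp_assoc (ecomp _ _ _)), <- !tensm_comp.
  rewrite !comp_idl, !comp_idr. reflexivity.
Qed.

Lemma umap_pre x y w (f : uhom x y) :
  efhom F x w ∘ fmap (ehat F) (epre w f)
  = epre (F w) (umap F f) ∘ efhom F y w.
Proof.
  unfold epre, umap. rewrite !fmap_comp, <- lmu_runi. catn.
  rewrite (ra (eq_sym (lmu_nat _ _ _))), fmap_id. catn. rw efhom_comp.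
  rewrite runi_nat, !comp_assoc, <- !(comp_assoc (ecomp _ _ _)), <- !tensm_comp.
  rewrite !comp_idl, !comp_idr. reflexivity.
Qed.

Lemma umap_comp x y z (g : uhom y z) (f : uhom x y) :
  umap F (ucomp g f) = ucomp (umap F g) (umap F f).
Proof.
  rewrite !ucomp_post. unfold umap at 1. rewrite fmap_comp. catn.
  rw umap_post. reflexivity.
Qed.

Lemma umap_id x : umap F (eid x) = eid (F x).
Proof. apply efhom_id. Qed.

End Umap.

Program Definition efun_id (A : MonCat) (L : ECategory A) : EFunctor L L := {|
  ehat := lax_id A; efob := fun x => x; efhom := fun x y => idm (ehom x y) |}.
Next Obligation. catn. reflexivity. Qed.
Next Obligation. rewrite tensm_id. catn. reflexivity. Qed.

Program Definition efun_comp (A B C : MonCat) (L : ECategory A)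
  (M : ECategory B) (N : ECategory C) (G : EFunctor M N) (F : EFunctor L M)
  : EFunctor L N := {|
  ehat := lax_comp (ehat G) (ehat F);
  efob := fun x => G (F x);
  efhom := fun x y => efhom G (F x) (F y) ∘ fmap (ehat G) (efhom F x y) |}.
Next Obligation.
  rewrite <- umap_id, <- umap_id. unfold umap. rewrite !fmap_comp. catn.
  reflexivity.
Qed.
Next Obligation.
  catn. rewrite tensm_comp. pose proof (f_equal (fmap (ehat G)) (efhom_comp F x y z)) as E.
  rewrite !fmap_comp in E. rw E. rwl lmu_nat. rw efhom_comp. reflexivity.
Qed.

Program Definition enat_id (A B : MonCat) (L : ECategory A) (M : ECategory B)
  (F : EFunctor L M) : ENat F F :=
  {| enhat := mn_id (ehat F); enat := fun x => eid (F x) |}.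
Next Obligation. rewrite epost_id, epre_id. catn. reflexivity. Qed.

Program Definition enat_comp (A B : MonCat) (L : ECategory A) (M : ECategory B)
  (F G H : EFunctor L M) (t : ENat G H) (s : ENat F G) : ENat F H :=
  {| enhat := mn_comp (enhat t) (enhat s); enat := fun x => ucomp (t x) (s x) |}.
Next Obligation.
  rewrite epost_comp, epre_comp. catn. rw enat_nat. rewrite (ra (epost_epre _ _)).
  catn. rw enat_nat. reflexivity.
Qed.

Program Definition enat_whisk_l (A B C : MonCat) (L : ECategory A)
  (M : ECategory B) (N : ECategory C) (H : EFunctor M N) (F G : EFunctor L M)
  (s : ENat F G) : ENat (efun_comp H F) (efun_comp H G) :=
  {| enhat := mn_whisk_l (ehat H) (enhat s); enat := fun x => umap H (s x) |}.
Next Obligation.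
  catn. rwl umap_post. rwl umap_pre. rewrite <- !fmap_comp, enat_nat.
  reflexivity.
Qed.

Program Definition enat_whisk_r (A B C : MonCat) (L : ECategory A)
  (M : ECategory B) (N : ECategory C) (F G : EFunctor M N) (s : ENat F G)
  (K : EFunctor L M) : ENat (efun_comp F K) (efun_comp G K) :=
  {| enhat := mn_whisk_r (enhat s) (ehat K); enat := fun x => s (K x) |}.
Next Obligation.
  catn. rw enat_nat. rw (mn_nat (enhat s)). reflexivity.
Qed.

Program Definition prod_ecat (A B : MonCat) (L : ECategory A)
  (M : ECategory B) : ECategory (prod_mon A B) := {|
  eob := (L * M)%type;
  ehom := fun x y => (ehom (fst x) (fst y), ehom (snd x) (snd y));
  eid := fun x => (eid (fst x), eid (snd x));
  ecomp := fun x y z =>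
    (ecomp (fst x) (fst y) (fst z), ecomp (snd x) (snd y) (snd z)) |}.
Next Obligation. f_equal; apply ecomp_idl. Qed.
Next Obligation. f_equal; apply ecomp_idr. Qed.
Next Obligation. f_equal; apply ecomp_assoc. Qed.

Program Definition prod_efun (A B A' B' : MonCat) (L : ECategory A)
  (M : ECategory B) (L' : ECategory A') (M' : ECategory B')
  (F : EFunctor L L') (G : EFunctor M M')
  : EFunctor (prod_ecat L M) (prod_ecat L' M') := {|
  ehat := prod_lax (ehat F) (ehat G);
  efob := fun x => (F (fst x), G (snd x));
  efhom := fun x y => (efhom F (fst x) (fst y), efhom G (snd x) (snd y)) |}.
Next Obligation. f_equal; apply efhom_id. Qed.
Next Obligation. f_equal; apply efhom_comp. Qed.

Program Definition prod_enat (A B A' B' : MonCat) (L : ECategory A)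
  (M : ECategory B) (L' : ECategory A') (M' : ECategory B')
  (F F' : EFunctor L L') (G G' : EFunctor M M') (s : ENat F F')
  (t : ENat G G') : ENat (prod_efun F G) (prod_efun F' G') := {|
  enhat := prod_mn (enhat s) (enhat t);
  enat := fun x => (s (fst x), t (snd x)) |}.
Next Obligation. f_equal; apply enat_nat. Qed.

Program Definition unit_ecat : ECategory unit_mon := {|
  eob := unit; ehom := fun _ _ => tt; eid := fun _ => tt;
  ecomp := fun _ _ _ => tt |}.
Solve Obligations with reflexivity.

Program Definition snd_efun (A B : MonCat) (L : ECategory A) (M : ECategory B)
  : EFunctor (prod_ecat L M) M := {|
  ehat := snd_lax A B; efob := fun x => snd x;
  efhom := fun x y => idm (ehom (snd x) (snd y)) |}.
Next Obligation. catn. reflexivity. Qed.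
Next Obligation. rewrite tensm_id. catn. reflexivity. Qed.

Record ECat : Type := {
  bg : MonCat;
  ecat :> ECategory bg }.

(* 1-morphisms: enriched functors whose background functor is strong. *)
Record ECat1 (L M : ECat) : Type := {
  efun :> EFunctor L M;
  efun_strong : is_strong (ehat efun) }.

(* The category of 1-morphisms [L -> M] and 2-morphisms between them; its
   composition is the vertical composition. *)
Program Definition ECatHom (L M : ECat) : Category := {|
  ob := ECat1 L M;
  hom := fun F G => ENat F G;
  idm := fun F => enat_id F;
  comp := fun F G H t s => enat_comp t s |}.
Next Obligation.
  apply ENat_eq; intros; [apply comp_idl | apply ucomp_idl].
Qed.
Next Obligation.
  apply ENat_eq; intros; [apply comp_idr | apply ucomp_idr].
Qed.
Next Obligation.
  apply ENat_eq; intros; [apply comp_assoc | apply ucomp_assoc].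
Qed.

Notation "F ⇒ G" := (@hom (ECatHom _ _) F G) (at level 70) : ecat_scope.

Definition one1 (L : ECat) : ECat1 L L :=
  {| efun := efun_id L; efun_strong := is_strong_id (bg L) |}.

Definition comp1 (L M N : ECat) (G : ECat1 M N) (F : ECat1 L M) : ECat1 L N :=
  {| efun := efun_comp G F;
     efun_strong := is_strong_comp (efun_strong G) (efun_strong F) |}.

Definition prod0 (L M : ECat) : ECat := {| ecat := prod_ecat L M |}.

Definition prod1 (L M L' M' : ECat) (F : ECat1 L L') (G : ECat1 M M')
  : ECat1 (prod0 L M) (prod0 L' M') :=
  {| efun := prod_efun F G : EFunctor (prod0 L M) (prod0 L' M');
     efun_strong := is_strong_prod (efun_strong F) (efun_strong G) |}.

Definition unit0 : ECat := {| ecat := unit_ecat |}.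

(* The left unitor [unit0 × L -> L] of the Cartesian product. *)
Definition lunit1 (L : ECat) : ECat1 (prod0 unit0 L) L :=
  {| efun := snd_efun unit0 L : EFunctor (prod0 unit0 L) L;
     efun_strong := is_strong_snd unit_mon (bg L) |}.

Definition whisk_l (L M N : ECat) (H : ECat1 M N) (F G : ECat1 L M)
  (s : F ⇒ G) : comp1 H F ⇒ comp1 H G := enat_whisk_l H s.

Definition whisk_r (L M N : ECat) (F G : ECat1 M N) (s : F ⇒ G)
  (K : ECat1 L M) : comp1 F K ⇒ comp1 G K := enat_whisk_r s K.

Definition prod2 (L M L' M' : ECat) (F F' : ECat1 L L') (G G' : ECat1 M M')
  (s : F ⇒ F') (t : G ⇒ G') : prod1 F G ⇒ prod1 F' G' :=
  prod_enat s t.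

(* Coherence 2-morphisms, with identity components. *)
Program Definition assoc2 (L M N P : ECat) (H : ECat1 N P) (G : ECat1 M N)
  (F : ECat1 L M) : comp1 H (comp1 G F) ⇒ comp1 (comp1 H G) F :=
  {| enhat := {| mn := fun a => idm (ehat H (ehat G (ehat F a))) |};
     enat := fun x => eid (H (G (F x))) |}.
Next Obligation. catn. reflexivity. Qed.
Next Obligation. rewrite tensm_id, fmap_comp. catn. reflexivity. Qed.
Next Obligation. rewrite fmap_comp. catn. reflexivity. Qed.
Next Obligation. rewrite epost_id, epre_id, fmap_comp. catn. reflexivity. Qed.

Program Definition prod_comp2 (K L L' M : ECat) (F : ECat1 L L')
  (G : ECat1 K L)
  : prod1 (comp1 F G) (one1 M) ⇒ comp1 (prod1 F (one1 M)) (prod1 G (one1 M)) :=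
  {| enhat := {| mn := fun a => (idm (ehat F (ehat G (fst a))), idm (snd a)) |};
     enat := fun x => (eid (F (G (fst x))), eid (snd x)) |}.
Next Obligation. catn. reflexivity. Qed.
Next Obligation. rewrite !tensm_id. catn. reflexivity. Qed.
Next Obligation. catn. reflexivity. Qed.
Next Obligation.
  apply (f_equal2 pair); simpl.
  - etransitivity; [exact (f_equal (fun z => z ∘ _) (epost_id _ _))|].
    etransitivity; [|exact (eq_sym (f_equal (fun z => z ∘ _) (epre_id _ _)))].
    catn. reflexivity.
  - etransitivity; [exact (f_equal (fun z => z ∘ _) (epost_id _ _))|].
    etransitivity; [|exact (eq_sym (f_equal (fun z => z ∘ _) (epre_id _ _)))].
    catn. reflexivity.
Qed.

Definition ecat_equiv (L M : ECat) : Prop :=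
  exists (F : ECat1 L M) (G : ECat1 M L)
    (eta : one1 L ⇒ comp1 G F) (eps : comp1 F G ⇒ one1 M),
    is_iso eta /\ is_iso eps.

Section TwoCategory.
Variables (L M N L' M' : ECat).

Lemma whisk_l_id (H : ECat1 M N) (F : ECat1 L M) :
  whisk_l H (idm (c := ECatHom L M) F) = idm (c := ECatHom L N) (comp1 H F).
Proof. apply ENat_eq; intros; [exact (fmap_id (ehat H) _) | exact (umap_id H _)]. Qed.

Lemma whisk_l_comp (H : ECat1 M N) (F G K : ECat1 L M) (t : G ⇒ K) (s : F ⇒ G) :
  whisk_l H (t ∘ s) = whisk_l H t ∘ whisk_l H s.
Proof. apply ENat_eq; intros; [exact (fmap_comp (ehat H) _ _) | exact (umap_comp H _ _)]. Qed.

Lemma whisk_r_id (F : ECat1 M N) (K : ECat1 L M) :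
  whisk_r (idm (c := ECatHom M N) F) K = idm (c := ECatHom L N) (comp1 F K).
Proof. apply ENat_eq; intros; reflexivity. Qed.

Lemma whisk_r_comp (F G H : ECat1 M N) (t : G ⇒ H) (s : F ⇒ G)
  (K : ECat1 L M) : whisk_r (t ∘ s) K = whisk_r t K ∘ whisk_r s K.
Proof. apply ENat_eq; intros; reflexivity. Qed.

Lemma prod2_id (F : ECat1 L L') (G : ECat1 M M') :
  prod2 (idm (c := ECatHom L L') F) (idm (c := ECatHom M M') G)
  = idm (c := ECatHom _ _) (prod1 F G).
Proof. apply ENat_eq; intros; reflexivity. Qed.

Lemma prod2_comp (F F' F'' : ECat1 L L') (G G' G'' : ECat1 M M')
  (s' : F' ⇒ F'') (s : F ⇒ F') (t' : G' ⇒ G'') (t : G ⇒ G') :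
  prod2 (s' ∘ s) (t' ∘ t) = prod2 s' t' ∘ prod2 s t.
Proof. apply ENat_eq; intros; reflexivity. Qed.

End TwoCategory.

Record LeftUnitalAction (x : ECat) : Type := {
  la_ob :> ECat;
  la_unit : ECat1 unit0 la_ob;
  la_act : ECat1 (prod0 la_ob x) x;
  la_alpha : comp1 la_act (prod1 la_unit (one1 x)) ⇒ lunit1 x;
  la_alpha_iso : is_iso la_alpha }.

#[local] Obligation Tactic := intros.

Section LeftUnitalActions.
Variable x : ECat.
Implicit Types X Y Z : LeftUnitalAction x.

Record LUA1 X Y : Type := {
  l1_fun :> ECat1 X Y;
  l1_sigma : la_unit Y ⇒ comp1 l1_fun (la_unit X);
  l1_rho : comp1 (la_act Y) (prod1 l1_fun (one1 x)) ⇒ la_act X;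
  l1_sigma_iso : is_iso l1_sigma;
  l1_rho_iso : is_iso l1_rho;
  (* [alpha_X . (rho (u_X × 1)) . (g_Y (sigma × 1)) = alpha_Y], up to the
     canonical isomorphism
     [g_Y (p u_X × 1) => (g_Y (p × 1)) (u_X × 1)] in the middle. *)
  l1_eq :
    la_alpha X
    ∘ whisk_r l1_rho (prod1 (la_unit X) (one1 x))
    ∘ (assoc2 (la_act Y) (prod1 l1_fun (one1 x)) (prod1 (la_unit X) (one1 x))
       ∘ whisk_l (la_act Y) (prod_comp2 x l1_fun (la_unit X)))
    ∘ whisk_l (la_act Y) (prod2 l1_sigma (idm (c := ECatHom x x) (one1 x)))
    = la_alpha Y }.

Record LUA2 X Y (p q : LUA1 X Y) : Type := {
  l2_nat :> p ⇒ q;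
  l2_sigma : whisk_r l2_nat (la_unit X) ∘ l1_sigma p = l1_sigma q;
  l2_rho :
    l1_rho q
    ∘ whisk_l (la_act Y) (prod2 l2_nat (idm (c := ECatHom x x) (one1 x)))
    = l1_rho p }.

Lemma LUA2_eq X Y (p q : LUA1 X Y) (s t : LUA2 p q) :
  l2_nat s = l2_nat t -> s = t.
Proof.
  destruct s, t; simpl; intros E; subst. f_equal; apply proof_irrelevance.
Qed.

Program Definition LUA2_id X Y (p : LUA1 X Y) : LUA2 p p :=
  {| l2_nat := idm (c := ECatHom X Y) p |}.
Next Obligation. rewrite whisk_r_id. apply comp_idl. Qed.
Next Obligation. rewrite prod2_id, whisk_l_id. apply comp_idr. Qed.

Program Definition LUA2_comp X Y (p q r : LUA1 X Y) (t : LUA2 q r)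
  (s : LUA2 p q) : LUA2 p r :=
  {| l2_nat := comp (c := ECatHom X Y) t s |}.
Next Obligation.
  rewrite whisk_r_comp, <- comp_assoc, l2_sigma. apply l2_sigma.
Qed.
Next Obligation.
  rewrite <- (comp_idl (idm (c := ECatHom x x) (one1 x))), prod2_comp.
  rewrite whisk_l_comp, comp_assoc, l2_rho. apply l2_rho.
Qed.

Program Definition LUAHom X Y : Category := {|
  ob := LUA1 X Y; hom := @LUA2 X Y;
  idm := @LUA2_id X Y; comp := @LUA2_comp X Y |}.
Next Obligation. apply LUA2_eq, (comp_idl (c := ECatHom X Y)). Qed.
Next Obligation. apply LUA2_eq, (comp_idr (c := ECatHom X Y)). Qed.
Next Obligation. apply LUA2_eq, (comp_assoc (c := ECatHom X Y)). Qed.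

End LeftUnitalActions.

#[local] Obligation Tactic := intros; simpl.

Definition contractible_groupoid (C : Category) : Prop :=
  inhabited C /\
  (forall (x y : C) (f : hom x y), is_iso f) /\
  (forall x y : C, exists f : hom x y, forall g : hom x y, g = f).

Definition is_terminal (x : ECat) (Z : LeftUnitalAction x) : Prop :=
  forall X : LeftUnitalAction x, contractible_groupoid (LUAHom X Z).

Record E0Center (x : ECat) : Type := {
  e0_action :> LeftUnitalAction x;
  e0_terminal : is_terminal e0_action }.

(* Internal homs for a left module: a natural bijection
   [L(a ⊙ x, y) = A(a, [x, y])]. *)
Record EnrichedModule (A : MonCat) (L : LModule A) : Type := {
  ihom : L -> L -> A;
  curry : forall (a : A) (x y : L), hom (a ⊙ x) y -> hom a (ihom x y);
  uncurry : forall (a : A) (x y : L), hom a (ihom x y) -> hom (a ⊙ x) y;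
  uncurry_curry : forall a x y (f : hom (a ⊙ x) y), uncurry (curry f) = f;
  curry_uncurry : forall a x y (f : hom a (ihom x y)), curry (uncurry f) = f;
  curry_nat : forall (a a' : A) (x y : L) (f : hom (a ⊙ x) y) (h : hom a' a),
    curry (f ∘ (h ⊙m idm x)) = curry f ∘ h }.

Arguments curry {A L} _ {a x y} _.
Arguments uncurry {A L} _ {a x y} _.

Definition ev (A : MonCat) (L : LModule A) (E : EnrichedModule L) (x y : L)
  : hom (ihom E x y ⊙ x) y := uncurry E (idm (ihom E x y)).

Section Canonical.
Variables (A : MonCat) (L : LModule A) (E : EnrichedModule L).

Lemma uncurryE (a : A) (x y : L) (f : hom a (ihom E x y)) :
  uncurry E f = ev E x y ∘ (f ⊙m idm x).
Proof.
  rewrite <- (uncurry_curry E (ev E x y ∘ (f ⊙m idm x))), curry_nat.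
  unfold ev. rewrite curry_uncurry, comp_idl. reflexivity.
Qed.

Lemma ev_curry (a : A) (x y : L) (f : hom (a ⊙ x) y) :
  ev E x y ∘ (curry E f ⊙m idm x) = f.
Proof. rewrite <- uncurryE. apply uncurry_curry. Qed.

Lemma ev_inj (a : A) (x y : L) (f g : hom a (ihom E x y)) :
  ev E x y ∘ (f ⊙m idm x) = ev E x y ∘ (g ⊙m idm x) -> f = g.
Proof.
  rewrite <- !uncurryE. intros H.
  rewrite <- (curry_uncurry f), H. apply curry_uncurry.
Qed.

Program Definition canonical_ecat : ECategory A := {|
  eob := L;
  ehom := ihom E;
  eid := fun x => curry E (alun x);
  ecomp := fun x y z =>
    curry E (ev E y z ∘ ((idm (ihom E y z) ⊙m ev E x y)
                         ∘ aasc (ihom E y z) (ihom E x y) x)) |}.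
Next Obligation.
  apply ev_inj. rewrite actm_r. rw ev_curry. rw aasc_nat. rewrite actm_id.
  rewrite (ra (eq_sym (actm_lr _ _))). catn. rw ev_curry. rw alun_nat.
  rewrite <- alun_aasc. reflexivity.
Qed.
Next Obligation.
  apply ev_inj. rewrite actm_r. rw ev_curry. rw aasc_nat.
  rewrite (ra (eq_sym (actm_l _ _ _))), ev_curry. rw act_triangle. reflexivity.
Qed.
Next Obligation.
  apply ev_inj. rewrite !actm_r. catn. rw ev_curry. rw ev_curry.
  rw aasc_nat. rewrite actm_id. rewrite (ra (eq_sym (actm_lr _ _))). catn.
  rw ev_curry. rw aasc_nat. rewrite (ra (eq_sym (actm_l _ _ _))), ev_curry.
  rewrite !actm_l. catn. rewrite <- act_pentagon.
  rewrite <- tensm_id, (ra (aasc_nat _ _ _)). catn. reflexivity.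
Qed.

Definition canonical : ECat := {| ecat := canonical_ecat |}.

End Canonical.

Definition is_dual (A : MonCat) (l a : A) : Prop :=
  exists (e : hom (l ⊗ a) (one A)) (c : hom (one A) (a ⊗ l)),
    run a ∘ (idm a ⊗m e) ∘ asc a l a ∘ (c ⊗m idm a) ∘ luni a = idm a /\
    lun l ∘ (e ⊗m idm l) ∘ asci l a l ∘ (idm l ⊗m c) ∘ runi l = idm l.

Definition rigid (A : MonCat) : Prop :=
  forall a : A, (exists l, is_dual l a) /\ (exists r, is_dual a r).

(* Main.v *)
Require Import Defs.
From Stdlib Require Import IndefiniteDescription.

(** The center is realised by evaluation. Module functors pair with objects of [M]
    by [(F, x) |-> F x], and hom objects pair by
    [([F, G] ⊗ [x, y]) ⊙ F x -> [F, G] ⊙ F ([x, y] ⊙ x) -> [F, G] ⊙ F y -> G y].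
    The background of this pairing is [(a, b) |-> a ⊗ b] on [Z1 B × B], which is
    monoidal because the half-braiding of [a'] moves it past [b] in
    [(a ⊗ b) ⊗ (a' ⊗ b')]. Together with the identity functor as unit this is a left
    unital action ([eval_action]) whose underlying object is the canonical enriched
    category of [FunMod M M] itself. The theorem thus says that [eval_action] is
    terminal: for every action [X], the category of 1-morphisms into it is inhabited
    ([lua1_exists]) and has exactly one morphism between any two objects ([lua2],
    [lua2_unique]).

    Existence is a transposition. Let [g] be the action of [X] and
    [G : A × B -> B] its background. The unit constraint of [X] identifies [b] with
    [G (1, b)], so that [G (a, 1)] can absorb [b] from the right or from the left:
    [G (a, 1) ⊗ b -> G (a, b) <- b ⊗ G (a, 1)]. Both maps are invertible since [G]
    is strong, and their comparison is a half-braiding on [G (a, 1)]. This gives a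
    strong monoidal functor [A -> Z1 B] ([center_lax]). An object [a] of [X] gives
    [x |-> g (a, x)], on which a map [c ⊙ x -> y] acts as a map
    [c ⊙ g (a, x) -> g (a, y)]. That is a lax [B]-module functor, and rigidity of
    [B] makes it strong ([lift_map_id_iso]). Hom objects of [X] act by
    [G (X(a, a'), 1) ⊙ g (a, x) -> g (a', x)], which are module transformations for
    the half-braiding just built ([gmodnat]). The result is the enriched functor
    [transpose_efun]; its [sigma] comes from the unit constraint of [X] and its [rho]
    is the absorption [G (a, 1) ⊗ b -> G (a, b)] on backgrounds and the identity on
    objects.

    For uniqueness, two 1-morphisms [p] and [q] into [eval_action] differ by
    [theta = rho_q^-1 rho_p], a transformation between evaluation along [p] and
    evaluation along [q], and a 2-morphism [p => q] is a transformation that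
    evaluation turns into [theta]. The unit axioms fix the background of [theta] on
    pairs [(1, b)]. As [(a, b)] is the product [(a, 1) (1, b)], that background is
    [xi a ⊗ b] for a unique [xi a] ([th_hat_xi]); the product in the other order,
    [(1, b) (a, 1)], says that [xi a] commutes with the half-braidings ([xi_hb]).
    Naturality of [theta] then makes its components at the pairs [(a, x)] a module
    transformation in [x] and an enriched transformation in [a]. *)

Set Implicit Arguments.
Unset Strict Implicit.
Unset Printing Implicit Defensive.

#[local] Obligation Tactic := intros; simpl.

(** * Invertible morphisms *)

Definition iso_inv (C : Category) (x y : C) (f : hom x y) (H : is_iso f) : hom y x :=
  proj1_sig (constructive_indefinite_description _ H).

Lemma iso_inv_l (C : Category) (x y : C) (f : hom x y) (H : is_iso f) :
  iso_inv H ∘ f = idm x.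
Proof. exact (proj1 (proj2_sig (constructive_indefinite_description _ H))). Qed.

Lemma iso_inv_r (C : Category) (x y : C) (f : hom x y) (H : is_iso f) :
  f ∘ iso_inv H = idm y.
Proof. exact (proj2 (proj2_sig (constructive_indefinite_description _ H))). Qed.

Lemma is_iso_iso_inv (C : Category) (x y : C) (f : hom x y) (H : is_iso f) :
  is_iso (iso_inv H).
Proof. exact (is_iso_intro (iso_inv_r H) (iso_inv_l H)). Qed.

Lemma iso_epi (C : Category) (x y z : C) (i : hom x y) (f g : hom y z) :
  is_iso i -> f ∘ i = g ∘ i -> f = g.
Proof. intros [j [_ e]]. exact (iso_cancel_r e). Qed.

Lemma iso_mono (C : Category) (x y z : C) (i : hom y z) (f g : hom x y) :
  is_iso i -> i ∘ f = i ∘ g -> f = g.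
Proof. intros [j [e _]]. exact (iso_cancel_l e). Qed.

Lemma is_iso_tensm (A : MonCat) (a a' b b' : A) (f : hom a a') (g : hom b b') :
  is_iso f -> is_iso g -> is_iso (f ⊗m g).
Proof.
  intros [f' [f1 f2]] [g' [g1 g2]]. exists (f' ⊗m g').
  rewrite <- !tensm_comp, f1, f2, g1, g2, !tensm_id. split; reflexivity.
Qed.

Lemma is_iso_actm (A : MonCat) (M : LModule A) (a a' : A) (x x' : M)
  (f : hom a a') (g : hom x x') : is_iso f -> is_iso g -> is_iso (f ⊙m g).
Proof.
  intros [f' [f1 f2]] [g' [g1 g2]]. exists (f' ⊙m g').
  rewrite <- !actm_comp, f1, f2, g1, g2, !actm_id. split; reflexivity.
Qed.

Lemma is_iso_asc (A : MonCat) (a b c : A) : is_iso (asc a b c).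
Proof. exact (is_iso_intro (asci_asc a b c) (asc_asci a b c)). Qed.
Lemma is_iso_asci (A : MonCat) (a b c : A) : is_iso (asci a b c).
Proof. exact (is_iso_intro (asc_asci a b c) (asci_asc a b c)). Qed.
Lemma is_iso_lun (A : MonCat) (a : A) : is_iso (lun a).
Proof. exact (is_iso_intro (luni_lun a) (lun_luni a)). Qed.
Lemma is_iso_luni (A : MonCat) (a : A) : is_iso (luni a).
Proof. exact (is_iso_intro (lun_luni a) (luni_lun a)). Qed.
Lemma is_iso_run (A : MonCat) (a : A) : is_iso (run a).
Proof. exact (is_iso_intro (runi_run a) (run_runi a)). Qed.
Lemma is_iso_runi (A : MonCat) (a : A) : is_iso (runi a).
Proof. exact (is_iso_intro (run_runi a) (runi_run a)). Qed.
Lemma is_iso_aasc (A : MonCat) (M : LModule A) (a b : A) (x : M) : is_iso (aasc a b x).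
Proof. exact (is_iso_intro (aasci_aasc a b x) (aasc_aasci a b x)). Qed.
Lemma is_iso_aasci (A : MonCat) (M : LModule A) (a b : A) (x : M) : is_iso (aasci a b x).
Proof. exact (is_iso_intro (aasc_aasci a b x) (aasci_aasc a b x)). Qed.
Lemma is_iso_alun (A : MonCat) (M : LModule A) (x : M) : is_iso (alun x).
Proof. exact (is_iso_intro (aluni_alun x) (alun_aluni x)). Qed.
Lemma is_iso_aluni (A : MonCat) (M : LModule A) (x : M) : is_iso (aluni x).
Proof. exact (is_iso_intro (alun_aluni x) (aluni_alun x)). Qed.

#[export] Hint Resolve is_iso_id is_iso_comp is_iso_fmap is_iso_tensm is_iso_actm
  is_iso_asc is_iso_asci is_iso_lun is_iso_luni is_iso_run is_iso_runi
  is_iso_aasc is_iso_aasci is_iso_alun is_iso_aluni is_iso_iso_inv : iso.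

(** * Enriched categories of the canonical construction *)

Section Decode.
Variables (A : MonCat) (N : LModule A) (E : EnrichedModule N).
Notation EN := (canonical_ecat E).
Implicit Types (x y z w : N) (a b c : A).

Lemma uncurry_comp a b x y (f : hom a (ihom E x y)) (h : hom b a) :
  uncurry E (f ∘ h) = uncurry E f ∘ (h ⊙m idm x).
Proof. rewrite !uncurryE, actm_r. catn. reflexivity. Qed.

Lemma uncurry_inj a x y (f g : hom a (ihom E x y)) :
  uncurry E f = uncurry E g -> f = g.
Proof. intros H. rewrite <- (curry_uncurry f), H. apply curry_uncurry. Qed.

Lemma curry_comp a b x y (f : hom (a ⊙ x) y) (h : hom b a) :
  curry E f ∘ h = curry E (f ∘ (h ⊙m idm x)).
Proof. symmetry. apply curry_nat. Qed.

Lemma uncurry_ecomp a b x y z (f : hom a (ihom E y z)) (g : hom b (ihom E x y)) :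
  uncurry E (ecomp (e := EN) x y z ∘ (f ⊗m g))
  = uncurry E f ∘ ((idm a ⊙m uncurry E g) ∘ aasc a b x).
Proof.
  rewrite uncurry_comp. simpl. rewrite uncurry_curry, (uncurryE f), (uncurryE g). catn.
  rw aasc_nat. do 2 rewrite (ra (eq_sym (actm_comp _ _ _ _))). catn. reflexivity.
Qed.

Lemma uncurry_ecomp1 x y z : uncurry E (ecomp (e := EN) x y z)
  = ev E y z ∘ ((idm (ihom E y z) ⊙m ev E x y) ∘ aasc _ _ x).
Proof. apply uncurry_curry. Qed.

Lemma uncurry_eid x : uncurry E (eid (e := EN) x) = alun x.
Proof. apply uncurry_curry. Qed.

(** The bijection between the underlying category of the enriched category and
    the module that it comes from. *)
Definition dec x y (f : uhom (L := EN) x y) : hom x y := uncurry E f ∘ aluni x.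

Definition enc x y (h : hom x y) : uhom (L := EN) x y := curry E (h ∘ alun x).

Lemma dec_enc x y (h : hom x y) : dec (enc h) = h.
Proof. unfold dec, enc. rewrite uncurry_curry. catn. rewrite alun_aluni. catn.
    reflexivity. Qed.

Lemma uncurry_dec x y (f : uhom (L := EN) x y) : uncurry E f = dec f ∘ alun x.
Proof. unfold dec. catn. rewrite aluni_alun. catn. reflexivity. Qed.

Lemma dec_inj x y (f g : uhom (L := EN) x y) : dec f = dec g -> f = g.
Proof. intros H. apply uncurry_inj. rewrite !uncurry_dec, H. reflexivity. Qed.

Lemma dec_eid x : dec (eid (e := EN) x) = idm x.
Proof. unfold dec. rewrite uncurry_eid. apply alun_aluni. Qed.

(** Under the bijection of morphisms, the enriched actions of [f] on hom objects
    are composition with [dec f], after and before. *)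
Lemma uncurry_epost a w x y (f : uhom (L := EN) x y) (k : hom a (ihom E w x)) :
  uncurry E (epost (L := EN) w f ∘ k) = dec f ∘ uncurry E k.
Proof.
  unfold epost. catn. rewrite luni_nat.
  rewrite (ra (eq_sym (tensm_comp _ _ _ _))), comp_idl, comp_idr.
  rewrite comp_assoc, uncurry_comp, uncurry_ecomp. catn. rw aasc_aluni.
  unfold dec. catn. rewrite aluni_nat. reflexivity.
Qed.

Lemma uncurry_epre a x y w (f : uhom (L := EN) x y) (k : hom a (ihom E y w)) :
  uncurry E (epre (L := EN) w f ∘ k) = uncurry E k ∘ (idm a ⊙m dec f).
Proof.
  unfold epre. catn. rewrite runi_nat.
  rewrite (ra (eq_sym (tensm_comp _ _ _ _))), comp_idl, comp_idr.
  rewrite comp_assoc, uncurry_comp, uncurry_ecomp. catn.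
  unfold dec. rewrite actm_l, act_triangle'. catn. reflexivity.
Qed.

Lemma dec_ucomp x y z (g : uhom (L := EN) y z) (f : uhom (L := EN) x y) :
  dec (ucomp g f) = dec g ∘ dec f.
Proof.
  rewrite ucomp_post. unfold dec at 1. rewrite uncurry_epost. catn. reflexivity.
Qed.

End Decode.

Section FunctorsToCanonical.
Variables (A C : MonCat) (N : LModule A) (E : EnrichedModule N) (L : ECategory C).
Notation EN := (canonical_ecat E).

Lemma uncurry_efhom_id (F : EFunctor L EN) x :
  uncurry E (efhom F x x) ∘ ((fmap (ehat F) (eid x) ∘ leta (ehat F)) ⊙m idm (F x))
  = alun (F x).
Proof. rewrite <- uncurry_comp, efhom_id. apply uncurry_eid. Qed.

Lemma uncurry_efhom_comp (F : EFunctor L EN) x y z :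
  uncurry E (efhom F x z)
    ∘ ((fmap (ehat F) (ecomp x y z) ∘ lmu (ehat F) (ehom y z) (ehom x y))
       ⊙m idm (F x))
  = uncurry E (efhom F y z)
    ∘ ((idm (ehat F (ehom y z)) ⊙m uncurry E (efhom F x y)) ∘ aasc _ _ _).
Proof. rewrite <- uncurry_comp, efhom_comp. apply uncurry_ecomp. Qed.

(** Enriched functors into the enriched category of a module are families of
    evaluations [H(L(x, y)) ⊙ F x -> F y]. *)
Program Definition mk_efun (H : LaxMon C A) (F : L -> N)
  (e : forall x y, hom (H (ehom x y) ⊙ F x) (F y))
  (e_id : forall x, e x x ∘ ((fmap H (eid x) ∘ leta H) ⊙m idm (F x)) = alun (F x))
  (e_comp : forall x y z,
    e x z ∘ ((fmap H (ecomp x y z) ∘ lmu H (ehom y z) (ehom x y)) ⊙m idm (F x))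
    = e y z ∘ ((idm (H (ehom y z)) ⊙m e x y) ∘ aasc _ _ _)) : EFunctor L EN :=
  {| ehat := H; efob := F : L -> EN; efhom := fun x y => curry E (e x y) |}.
Next Obligation. rewrite curry_comp, e_id. reflexivity. Qed.
Next Obligation.
  apply (uncurry_inj (E := E)). etransitivity; [|symmetry; apply uncurry_ecomp].
  rewrite curry_comp, !uncurry_curry. apply e_comp.
Qed.

Lemma dec_nat (F G : EFunctor L EN) (s : ENat F G) x y :
  dec (s y) ∘ uncurry E (efhom F x y)
  = uncurry E (efhom G x y) ∘ (enhat s (ehom x y) ⊙m dec (s x)).
Proof.
  rewrite <- uncurry_epost, enat_nat.
  etransitivity; [apply uncurry_epre|].
  rewrite uncurry_comp. catn. rewrite <- actm_comp. catn. reflexivity.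
Qed.

Program Definition mk_enat (F G : EFunctor L EN) (h : MonNat (ehat F) (ehat G))
  (s : forall x, hom (F x : N) (G x))
  (Hs : forall x y, s y ∘ uncurry E (efhom F x y)
     = uncurry E (efhom G x y) ∘ (h (ehom x y) ⊙m s x)) : ENat F G :=
  {| enhat := h; enat := fun x => enc E (s x) |}.
Next Obligation.
  apply (uncurry_inj (E := E)).
  etransitivity; [apply uncurry_epost|].
  etransitivity; [|symmetry; apply uncurry_epre].
  rewrite uncurry_comp, !dec_enc, Hs. catn. rewrite <- actm_comp. catn. reflexivity.
Qed.

End FunctorsToCanonical.

(** Invertibility in the underlying category, which is not packaged as a
    [Category]. *)
Definition uiso (A : MonCat) (L : ECategory A) (x y : L) (f : uhom x y) : Prop :=
  exists g : uhom y x, ucomp g f = eid x /\ ucomp f g = eid y.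

Lemma uiso_dec (A : MonCat) (N : LModule A) (E : EnrichedModule N) (x y : N)
  (f : uhom (L := canonical_ecat E) x y) : is_iso (dec f) <-> uiso f.
Proof.
  split; intros [g [g1 g2]].
  - exists (enc E g). split; apply dec_inj; rewrite dec_ucomp, dec_enc, dec_eid; assumption.
  - exists (dec g). rewrite <- !dec_ucomp, g1, g2, !dec_eid. split; reflexivity.
Qed.

Program Definition mn_inv (A B : MonCat) (F G : LaxMon A B) (s : MonNat F G)
  (H : forall a, is_iso (s a)) : MonNat G F := {| mn := fun a => iso_inv (H a) |}.
Next Obligation.
  apply (iso_mono (H b)). rewrite comp_assoc, iso_inv_r. rw mn_nat. rewrite iso_inv_r.
  catn. reflexivity.
Qed.
Next Obligation.
  apply (iso_mono (H (a ⊗ b))). rewrite comp_assoc, iso_inv_r. rw mn_mu.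
  rewrite <- tensm_comp, !iso_inv_r, tensm_id. catn. reflexivity.
Qed.
Next Obligation.
  apply (iso_mono (H (one A))). rewrite comp_assoc, iso_inv_r. rw mn_eta. reflexivity.
Qed.

(** The inverse components satisfy the enriched naturality square because pre- and
    postcomposition commute, so the square can be conjugated by the components. *)
Lemma ecat2_iso (L M : ECat) (F G : ECat1 L M) (s : F ⇒ G) :
  (forall a, is_iso (enhat s a)) -> (forall x, uiso (s x)) -> is_iso s.
Proof.
  intros H1 H2.
  pose (t := fun x => proj1_sig (constructive_indefinite_description _ (H2 x))).
  assert (ts : forall x, ucomp (t x) (s x) = eid _ /\ ucomp (s x) (t x) = eid _).
  { intros x. exact (proj2_sig (constructive_indefinite_description _ (H2 x))). }
  unshelve refine (let r : ENat G F := {| enhat := mn_inv H1; enat := t |} in _).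
  { intros x y. simpl.
    transitivity (epost (G x) (t y) ∘ (epre (G y) (t x) ∘ (epre (G y) (s x)
       ∘ (efhom G x y ∘ (enhat s (ehom x y) ∘ iso_inv (H1 (ehom x y))))))).
    - rewrite iso_inv_r. catn. rwl epre_comp. rewrite (proj2
        (ts x)), epre_id. catn. reflexivity.
    - rw (eq_sym (enat_nat s x y)). rewrite (ra (epost_epre _ _)). catn.
      rwl epost_comp. rewrite (proj1 (ts y)), epost_id. catn. reflexivity. }
  exists r. split; apply ENat_eq; intros; simpl.
  - apply iso_inv_l.
  - apply ts.
  - apply iso_inv_r.
  - apply ts.
Qed.

Lemma ecat2_iso_hat (L M : ECat) (F G : ECat1 L M) (s : F ⇒ G) a :
  is_iso s -> is_iso (enhat s a).
Proof.
  intros [t [t1 t2]]. exists (enhat t a).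
  split; [exact (f_equal (fun r : ENat F F => enhat r a) t1)
         | exact (f_equal (fun r : ENat G G => enhat r a) t2)].
Qed.

Lemma ecat2_iso_uiso (L M : ECat) (F G : ECat1 L M) (s : F ⇒ G) (x : L) :
  is_iso s -> uiso (s x).
Proof.
  intros [t [t1 t2]]. exists (enat t x).
  split; [exact (f_equal (fun r : ENat F F => enat r x) t1)
         | exact (f_equal (fun r : ENat G G => enat r x) t2)].
Qed.

(** * Module functors in one operation *)

(** A module functor acts on morphisms [c ⊙ x -> y]. This single operation
    determines both the functor (at [c = 1]) and its module structure (at the identity
    of [c ⊙ x]). *)
Definition mlift (B : MonCat) (M N : LModule B) (F : ModFun M N) (c : B) (x y : M)
  (h : hom (c ⊙ x) y) : hom (c ⊙ F x) (F y) := fmap F h ∘ mstr F c x.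

(** A lax [B]-module functor in terms of the operation above. When [M] is enriched in
    [B] this is a [B]-enriched functor with the identity on backgrounds: [lift_map]
    is a map [[x, y] -> [F x, F y]] seen on generalised elements. *)
Record LiftFunctor (B : MonCat) (M N : LModule B) : Type := {
  lift_ob :> M -> N;
  lift_map : forall (c : B) (x y : M), hom (c ⊙ x) y -> hom (c ⊙ lift_ob x) (lift_ob y);
  lift_map_nat : forall (c c' : B) (x y : M) (h : hom (c ⊙ x) y) (k : hom c' c),
    lift_map (h ∘ (k ⊙m idm x)) = lift_map h ∘ (k ⊙m idm (lift_ob x));
  lift_map_comp : forall (c d : B) (x y z : M) (h' : hom (d ⊙ y) z) (h : hom (c ⊙ x) y),
    lift_map (h' ∘ ((idm d ⊙m h) ∘ aasc d c x))
    = lift_map h' ∘ ((idm d ⊙m lift_map h) ∘ aasc d c (lift_ob x));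
  lift_map_alun : forall x, lift_map (alun x) = alun (lift_ob x) }.

Arguments lift_map {B M N} _ {c x y} _.

Section LiftFunctorTheory.
Variables (B : MonCat) (M N : LModule B) (F : LiftFunctor M N).

Definition lift_fmap (x y : M) (f : hom x y) : hom (F x) (F y) :=
  lift_map F (f ∘ alun x) ∘ aluni (F x).

Lemma lift_fmap_map c x y z (f : hom y z) (h : hom (c ⊙ x) y) :
  lift_fmap f ∘ lift_map F h = lift_map F (f ∘ h).
Proof.
  unfold lift_fmap. catn. rewrite aluni_nat.
  rewrite <- aasc_aluni, (ra3 (eq_sym (lift_map_comp F (f ∘ alun y) h))), <- lift_map_nat.
  catn. rw alun_nat. rw alun_aasc. rewrite <- actm_r, lun_luni, actm_id. catn.
  reflexivity.
Qed.

Lemma lift_map_fmap c x y z (h : hom (c ⊙ y) z) (f : hom x y) :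
  lift_map F h ∘ (idm c ⊙m lift_fmap f) = lift_map F (h ∘ (idm c ⊙m f)).
Proof.
  unfold lift_fmap. rewrite actm_l, act_triangle'. catn.
  rewrite (ra3 (eq_sym (lift_map_comp F h (f ∘ alun x)))), <- lift_map_nat.
  rewrite actm_l. catn. rw act_triangle. rewrite <- actm_r, run_runi, actm_id. catn.
  reflexivity.
Qed.

Program Definition lift_functor : Functor M N := {| fob := F; fmap := lift_fmap |}.
Next Obligation. unfold lift_fmap. rewrite comp_idl, lift_map_alun. apply alun_aluni. Qed.
Next Obligation.
  unfold lift_fmap at 1 3. rewrite comp_assoc, lift_fmap_map. catn. reflexivity.
Qed.

(** The triangle identity of a duality also holds for the action on an object of a
    module, which is not itself a tensor product. *)
Lemma zigzag (P : LModule B) (b l : B) (e : hom (l ⊗ b) (one B))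
  (c : hom (one B) (b ⊗ l))
  (H : run b ∘ (idm b ⊗m e) ∘ asc b l b ∘ (c ⊗m idm b) ∘ luni b = idm b) (y : P) :
  (idm b ⊙m (alun y ∘ ((e ⊙m idm y) ∘ aasci l b y)))
    ∘ (aasc b l (b ⊙ y) ∘ (c ⊙m idm (b ⊙ y)))
  = alun (b ⊙ y).
Proof.
  apply (iso_epi (is_iso_aluni (b ⊙ y))). rewrite alun_aluni, <- aasc_aluni.
  rewrite !actm_l, <- (actm_id b y). catn. rw (eq_sym (aasc_nat c (idm b) (idm y))).
  rw (eq_sym (act_pentagon_2 b l b y)). rw aasci_aasc.
  rw (eq_sym (aasc_nat (idm b) e (idm y))). rw act_triangle.
  rewrite <- !actm_r. repeat rewrite <- comp_assoc in H. rewrite H. reflexivity.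
Qed.

(** Over a rigid category, a lax module structure is invertible: with [l] dual to
    [b], the inverse of [b ⊙ F x -> F (b ⊙ x)] is
    [F (b ⊙ x) -> b ⊙ l ⊙ F (b ⊙ x) -> b ⊙ F x], where the last map comes from
    [l ⊙ b ⊙ x -> x]. *)
Lemma lift_map_id_iso (HB : rigid B) (b : B) (x : M) : is_iso (lift_map F (idm (b ⊙ x))).
Proof.
  destruct (HB b) as [[l [e [c [H _]]]] _].
  (* the counit of the duality acting on [x] *)
  pose (h := alun x ∘ ((e ⊙m idm x) ∘ aasci l b x)).
  exists ((idm b ⊙m lift_map F h) ∘ (aasc b l (F (b ⊙ x)) ∘ ((c ⊙m idm _) ∘ aluni _))).
  split; catn.
  - rewrite aluni_nat. rewrite (ra (actm_lr _ _)). catn.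
    rewrite <- (tensm_id b l), (ra (aasc_nat _ _ _)). catn.
    rewrite (ra (eq_sym (actm_l _ _ _))).
    replace (lift_map F h ∘ (idm l ⊙m lift_map F (idm (b ⊙ x))))
      with (alun (F x) ∘ ((e ⊙m idm (F x)) ∘ aasci l b (F x))).
    + rw (zigzag (P := N) H (F x)). apply alun_aluni.
    + apply (iso_epi (is_iso_aasc l b (F x))). catn. rw aasci_aasc.
      rewrite <- lift_map_comp, actm_id, comp_idl. unfold h. catn. rw aasci_aasc.
      rewrite lift_map_nat, lift_map_alun. reflexivity.
  - rewrite (ra3 (eq_sym (lift_map_comp F _ h))), (ra (eq_sym (lift_map_nat F _ _))).
    catn. unfold h. rw (zigzag H x). rewrite lift_map_alun. apply alun_aluni.
Qed.

Program Definition lift_modfun (HB : rigid B) : ModFun M N := {|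
  mfun := lift_functor;
  mstr := fun b x => lift_map F (idm (b ⊙ x)) |}.
Next Obligation. apply lift_map_id_iso, HB. Qed.
Next Obligation.
  rewrite lift_fmap_map, comp_idr, <- (comp_idl (f ⊙m g)).
  transitivity (lift_map F (idm (b' ⊙ x')) ∘ ((idm b' ⊙m lift_fmap g) ∘ (f ⊙m idm (F x)))).
  - rewrite <- actm_comp. catn. reflexivity.
  - rewrite comp_assoc, lift_map_fmap, <- lift_map_nat. catn. rewrite <- actm_comp.
    catn. reflexivity.
Qed.
Next Obligation.
  rewrite lift_fmap_map, <- lift_map_comp, actm_id. catn. reflexivity.
Qed.
Next Obligation. rewrite lift_fmap_map, comp_idr. apply lift_map_alun. Qed.

Lemma mlift_lift (HB : rigid B) c x y (h : hom (c ⊙ x) y) :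
  mlift (lift_modfun HB) h = lift_map F h.
Proof. unfold mlift. simpl. rewrite lift_fmap_map, comp_idr. reflexivity. Qed.

End LiftFunctorTheory.

Section Mlift.
Variables (B : MonCat) (M N : LModule B).
Implicit Types F G : ModFun M N.

Lemma mlift_nat F (c c' : B) (x y : M) (h : hom (c ⊙ x) y) (k : hom c' c) :
  mlift F (h ∘ (k ⊙m idm x)) = mlift F h ∘ (k ⊙m idm (F x)).
Proof.
  unfold mlift. rewrite fmap_comp, <- (fmap_id F x). catn. rw mstr_nat. reflexivity.
Qed.

Lemma mlift_comp F (c d : B) (x y z : M) (h' : hom (d ⊙ y) z) (h : hom (c ⊙ x) y) :
  mlift F (h' ∘ ((idm d ⊙m h) ∘ aasc d c x))
  = mlift F h' ∘ ((idm d ⊙m mlift F h) ∘ aasc d c (F x)).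
Proof.
  unfold mlift. rewrite !fmap_comp, actm_l. catn. rw mstr_asc. rw mstr_nat. reflexivity.
Qed.

Lemma mlift_alun F x : mlift F (alun x) = alun (F x).
Proof. apply mstr_lun. Qed.

Lemma mlift_fmap F x y (f : hom x y) : mlift F (f ∘ alun x) = fmap F f ∘ alun (F x).
Proof. unfold mlift. rewrite fmap_comp. catn. rewrite mstr_lun. reflexivity. Qed.

Lemma modnat_mlift F G (n : ModNat F G) c x y (h : hom (c ⊙ x) y) :
  n y ∘ mlift F h = mlift G h ∘ (idm c ⊙m n x).
Proof. unfold mlift. catn. rw mnat_nat. rw mnat_str. reflexivity. Qed.

(** One square for [mlift] contains both naturality and compatibility with the module
    structures. *)
Program Definition mk_modnat F G (n : forall x, hom (F x) (G x))
  (Hn : forall c x y (h : hom (c ⊙ x) y),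
     n y ∘ mlift F h = mlift G h ∘ (idm c ⊙m n x)) : ModNat F G :=
  {| mnat := n |}.
Next Obligation.
  apply (iso_epi (is_iso_alun (F x))). catn.
  rewrite <- mlift_fmap, Hn, mlift_fmap. catn. rw alun_nat. reflexivity.
Qed.
Next Obligation.
  pose proof (Hn b x (b ⊙ x) (idm _)) as E. unfold mlift in E.
  rewrite !fmap_id, !comp_idl in E. exact E.
Qed.

Lemma modnat_iso F G (n : ModNat F G) :
  (forall x, is_iso (n x)) -> is_iso (C := ModFunCat M N) n.
Proof.
  intros H.
  pose proof (modnat_inv (fun x => iso_inv_l (H x)) (fun x => iso_inv_r (H x))) as [H1 H2].
  exists ({| mnat := fun x => iso_inv (H x); mnat_nat := H1;
      mnat_str := H2 |} : ModNat G F).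
  split; apply ModNat_eq; intros x; [apply iso_inv_l | apply iso_inv_r].
Qed.

Lemma mlift_act (a : Z1 B) F (c : B) (x y : M) (h : hom (c ⊙ x) y) :
  mlift (Z1_act a F) h = (idm (z1ob a) ⊙m mlift F h) ∘ hbact (z1hb a) c (F x).
Proof. unfold mlift. simpl. rewrite actm_l. catn. reflexivity. Qed.

End Mlift.

Lemma z1_iso (B : MonCat) (a b : Z1 B) (f : Z1Hom a b) :
  is_iso (z1hom f) -> is_iso (C := Z1 B) f.
Proof.
  intros H.
  exists ({| z1hom := iso_inv H;
    z1hom_hb := z1_inv (iso_inv_l H) (iso_inv_r H) (z1hom_hb f) |} : Z1Hom b a).
  split; apply Z1Hom_eq; [apply iso_inv_l | apply iso_inv_r].
Qed.

(** [B] acts faithfully on itself, so that identities between morphisms with many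
    tensor factors can be checked after acting on an object, where the associators on
    the left of the action disappear. *)
Lemma act_faithful (B : MonCat) (a b : B) (f g : hom a b) :
  (forall (M : LModule B) (y : M), f ⊙m idm y = g ⊙m idm y) -> f = g.
Proof. intros H. apply tensm_idr_inj, (H (regular B) (one B)). Qed.

Lemma actm_l_eq (A : MonCat) (M : LModule A) (a : A) (x x' x'' : M)
  (g : hom x' x'') (f : hom x x') k :
  g ∘ f = k -> (idm a ⊙m g) ∘ (idm a ⊙m f) = idm a ⊙m k.
Proof. intros <-. symmetry. apply actm_l. Qed.

Lemma tensm_l_eq (A : MonCat) (a x x' x'' : A)
  (g : hom x' x'') (f : hom x x') k :
  g ∘ f = k -> (idm a ⊗m g) ∘ (idm a ⊗m f) = idm a ⊗m k.
Proof. intros <-. symmetry. apply tensm_l. Qed.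

Lemma aasc_nat_l (A : MonCat) (M : LModule A) (a b : A) (x y : M) (h : hom x y) :
  aasc a b y ∘ (idm (a ⊗ b) ⊙m h) = (idm a ⊙m (idm b ⊙m h)) ∘ aasc a b x.
Proof. rewrite <- tensm_id. apply aasc_nat. Qed.

Lemma aasc_nat_r (A : MonCat) (M : LModule A) (a b a' b' : A) (f : hom a a')
  (g : hom b b') (x : M) :
  aasc a' b' x ∘ ((f ⊗m g) ⊙m idm x) = (f ⊙m (g ⊙m idm x)) ∘ aasc a b x.
Proof. apply aasc_nat. Qed.

Section IdentityModuleFunctor.
Variables (B : MonCat) (M : LModule B).

Program Definition idmod : ModFun M M := {|
  mfun := functor_id M; mstr := fun b x => idm (b ⊙ x) |}.
Next Obligation. apply is_iso_id. Qed.
Next Obligation. catn. reflexivity. Qed.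
Next Obligation. rewrite actm_id. catn. reflexivity. Qed.
Next Obligation. catn. reflexivity. Qed.

Lemma mlift_idmod c x y (h : hom (c ⊙ x) y) : mlift idmod h = h.
Proof. apply comp_idr. Qed.

End IdentityModuleFunctor.

(** * The tensor product as a monoidal functor on the center times [B] *)

Section Mu.
Variables (B : MonCat).
Implicit Types (a : Z1Ob B) (b : B).

Definition tens_mu a b a' b' : hom ((z1ob a ⊗ b) ⊗ (z1ob a' ⊗ b')) ((z1ob a ⊗ z1ob a') ⊗
    (b ⊗ b')) :=
  asci (z1ob a) a' (b ⊗ b')
  ∘ ((idm (z1ob a) ⊗m hbreg (z1hb a') b b') ∘ asc (z1ob a) b (z1ob a' ⊗ b')).

Lemma tens_mu_iso a b a' b' : is_iso (tens_mu a b a' b').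
Proof.
  unfold tens_mu. apply is_iso_comp; [auto with iso|]. apply is_iso_comp; [|auto with iso].
  apply is_iso_tensm; [auto with iso|]. exact (hbact_iso (M := regular B) _ _ _).
Qed.

Variable M : LModule B.

(** As an operation on [a ⊙ b ⊙ a' ⊙ b' ⊙ y], the structure map is just the
    half-braiding of [a'] past [b]. *)
Lemma tens_mu_act a b a' b' (y : M) :
  aasc (z1ob a) a' (b ⊙ b' ⊙ y) ∘ ((idm (z1ob a ⊗ a') ⊙m aasc b b' y)
    ∘ (aasc (z1ob a ⊗ a') (b ⊗ b') y ∘ (tens_mu a b a' b' ⊙m idm y)))
  = (idm (z1ob a) ⊙m hbact (z1hb a') b (b' ⊙ y))
    ∘ (aasc (z1ob a) b (z1ob a' ⊙ b' ⊙ y) ∘ ((idm (z1ob a ⊗ b) ⊙m aasc (z1ob a') b' y)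
    ∘ aasc (z1ob a ⊗ b) (z1ob a' ⊗ b') y)).
Proof.
  unfold tens_mu. rewrite !actm_r. catn.
  rw (act_pentagon_1 (z1ob a) a' (b ⊗ b') y).
  rewrite <- (tensm_id (z1ob a) a'). rw aasc_nat. rw aasc_aasci.
  rw aasc_nat. rw (actm_l_eq _ (hbreg_act (z1hb a') b b' y)). rewrite !actm_l. catn.
  rw (actm_l_eq _ (actm_l_eq _ (aasc_aasci b b' y))). rewrite !actm_id. catn. rw (eq_sym
      (act_pentagon (z1ob a) b (z1ob a' ⊗ b') y)).
  rewrite <- (tensm_id (z1ob a) b). rw aasc_nat. reflexivity.
Qed.

End Mu.

Section TensorFunctor.
Variable B : MonCat.

Program Definition tens_functor : Functor (prod_cat (Z1 B) B) B := {|
  fob := fun p => z1ob (fst p) ⊗ snd p;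
  fmap := fun p q f => z1hom (fst f) ⊗m snd f |}.
Next Obligation. apply tensm_id. Qed.
Next Obligation. apply tensm_comp. Qed.

Lemma tens_mu_nat (a a' c c' : Z1 B) (b b' d d' : B) (f : Z1Hom a a') (g : hom b b')
  (h : Z1Hom c c') (k : hom d d') :
  tens_mu a' b' c' d' ∘ ((z1hom f ⊗m g) ⊗m (z1hom h ⊗m k))
  = ((z1hom f ⊗m z1hom h) ⊗m (g ⊗m k)) ∘ tens_mu a b c d.
Proof.
  unfold tens_mu. catn. rw asc_nat. rewrite (ra (eq_sym (tensm_comp _ _ _ _))).
  rw (eq_sym (asci_nat (z1hom f) (z1hom h) (g ⊗m k))).
  rewrite (ra (eq_sym (tensm_comp _ _ _ _))). catn.
  do 2 f_equal. f_equal.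
  transitivity (hbreg (z1hb c') b' d' ∘ ((idm b' ⊗m (z1hom h ⊗m idm d'))
      ∘ (g ⊗m (idm (z1ob c) ⊗m k)))).
  { rewrite <- !tensm_comp. catn. reflexivity. }
  pose proof (z1hom_act (M := regular B) h b' d') as E.
  change ((z1hom h ⊗m idm (b' ⊗ d')) ∘ hbreg (z1hb c) b' d'
    = hbreg (z1hb c') b' d' ∘ (idm b' ⊗m (z1hom h ⊗m idm d'))) in E.
  rewrite (ra (eq_sym E)). catn. rewrite hbreg_nat.
  rewrite (ra (eq_sym (tensm_comp _ _ _ _))). catn. reflexivity.
Qed.

(** Acting on [y], both sides permute the factors of
    [a ⊙ b ⊙ a' ⊙ b' ⊙ a'' ⊙ b'' ⊙ y]. On the left [a''] moves past [b ⊗ b'] after [a']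
    has moved past [b]; on the right [a' ⊗ a''] moves past [b] after [a''] has moved
    past [b']. The hexagons split these moves into the same three crossings. *)
Lemma tens_mu_asc (a a' a'' : Z1 B) (b b' b'' : B) :
  (asc (z1ob a) a' a'' ⊗m asc b b' b'') ∘ (tens_mu (Z1_tens a a') (b ⊗ b') a'' b''
     ∘ (tens_mu a b a' b' ⊗m idm (z1ob a'' ⊗ b'')))
  = tens_mu a b (Z1_tens a' a'') (b' ⊗ b'')
    ∘ ((idm (z1ob a ⊗ b) ⊗m tens_mu a' b' a'' b'')
       ∘ asc (z1ob a ⊗ b) (z1ob a' ⊗ b') (z1ob a'' ⊗ b'')).
Proof.
  apply act_faithful; intros M y. rewrite !actm_r.
  apply (iso_mono (is_iso_aasc _ _ y)).
  set (w := b'' ⊙ y).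
  (* strip all parentheses from the target *)
  assert (I : is_iso ((idm (z1ob a) ⊙m aasc (z1ob a') a'' (b ⊙ b' ⊙ w))
    ∘ (aasc (z1ob a) (a' ⊗ a'') (b ⊙ b' ⊙ w)
    ∘ (idm (z1ob a ⊗ (z1ob a' ⊗ z1ob a'')) ⊙m ((idm b ⊙m aasc b' b'' y)
        ∘ aasc b (b' ⊗ b'') y)))))
    by auto 10 with iso.
  apply (iso_mono I); clear I. catn.
  (* the three crossings in their common order *)
  transitivity ((idm (z1ob a) ⊙m (idm (z1ob a') ⊙m (hbact (z1hb a'') b (b' ⊙ w)
      ∘ (idm b ⊙m hbact (z1hb a'') b' w))))
    ∘ ((idm (z1ob a) ⊙m hbact (z1hb a') b (b' ⊙ z1ob a'' ⊙ w))
    ∘ (aasc (z1ob a) b _ ∘ ((idm _ ⊙m aasc (z1ob a') b' _)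
    ∘ (aasc _ _ _ ∘ ((idm _ ⊙m aasc (z1ob a'') b'' y)
    ∘ aasc ((z1ob a ⊗ b) ⊗ (z1ob a' ⊗ b')) (z1ob a'' ⊗ b'') y)))))).
  - rw aasc_nat.
    assert (J : (idm (z1ob a) ⊙m aasc (z1ob a') a'' (b ⊙ b' ⊙ w))
       ∘ (aasc (z1ob a) (a' ⊗ a'') (b ⊙ b' ⊙ w)
       ∘ ((idm (z1ob a ⊗ (z1ob a' ⊗ z1ob a'')) ⊙m ((idm b ⊙m aasc b' b'' y)
           ∘ aasc b (b' ⊗ b'') y))
       ∘ (asc (z1ob a) a' a'' ⊙m (asc b b' b'' ⊙m idm y))))
      = aasc (z1ob a) a' _ ∘ ((idm (z1ob a ⊗ z1ob a') ⊙m (idm (z1ob a'') ⊙m aasc b b' w))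
        ∘ (aasc (z1ob a ⊗ a') a'' _ ∘ (idm _ ⊙m aasc (b ⊗ b') b'' y)))).
    { rewrite <- actm_comp. catn. rewrite <- act_pentagon.
      transitivity ((idm (z1ob a) ⊙m aasc (z1ob a') a'' (b ⊙ b' ⊙ w))
       ∘ (aasc (z1ob a) (a' ⊗ a'') (b ⊙ b' ⊙ w) ∘ ((asc (z1ob a) a' a'' ⊙m idm _)
         ∘ (idm _ ⊙m (aasc b b' w ∘ aasc (b ⊗ b') b'' y))))).
      { rewrite <- actm_comp. catn. reflexivity. }
      rw (eq_sym (act_pentagon (z1ob a) a' a'' (b ⊙ b' ⊙ w))).
      rw (eq_sym (aasc_nat (idm (z1ob a ⊗ z1ob a')) (idm (z1ob a'')) (aasc b b' w))).
      rewrite tensm_id, actm_l. reflexivity. }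
    rewrite (ra4 J). clear J. catn.
    rw (tens_mu_act (Z1_tens a a') (b ⊗ b') a'' b'' y). simpl.
    rw aasc_nat. rewrite actm_id. rewrite (ra (eq_sym (actm_lr _ _))). catn.
    rw (actm_l_eq (z1ob a ⊗ a') (hbact_asc (z1hb a'') b b' w)).
    rewrite !actm_l. catn. rw (aasc_nat_l (z1ob a) a').
    rw (aasc_nat_l (z1ob a) a'). rw (tens_mu_act a b a' b'). reflexivity.
  - rw (aasc_nat_l (z1ob a) (z1ob a' ⊗ z1ob a'')).
    rewrite !actm_l. catn.
    rw (eq_sym (aasc_nat_l (z1ob a) (z1ob a' ⊗ a'') (aasc b (b' ⊗ b'') y))).
    rw (tens_mu_act a b (Z1_tens a' a'') (b' ⊗ b'') y).
    rw (aasc_nat_r (idm (z1ob a ⊗ b)) (tens_mu a' b' a'' b'') y).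
    rw (actm_l_eq (z1ob a) (eq_sym (hbact_nat (M := M) (z1hb (Z1_tens a' a'')) (idm b)
        (aasc b' b'' y)))).
    simpl. rewrite !actm_l. catn.
    rw (actm_l_eq (z1ob a) (hbtens_act (M := M) (z1hb a') (z1hb a'') b (b' ⊙ b'' ⊙ y))).
    rewrite !actm_l. catn.
    rw (eq_sym (aasc_nat_l (z1ob a) b (idm (z1ob a' ⊗ a'') ⊙m aasc b' b'' y))).
    rw (eq_sym (aasc_nat_l (z1ob a) b (aasc (z1ob a') a'' (b' ⊙ b'' ⊙ y)))).
    pose proof (tens_mu_act a' b' a'' b'' y) as E.
    apply (f_equal (actm (idm (z1ob a ⊗ b)))) in E. rewrite !actm_l in E.
    rw E. rw (aasc_nat_l (z1ob a) b (idm (z1ob a') ⊙m hbact (z1hb a'') b' (b'' ⊙ y))).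
    rw (actm_l_eq (z1ob a) (hbact_nat (M := M) (z1hb a') (idm b) (hbact (z1hb a'') b'
        (b'' ⊙ y)))).
    rewrite !actm_l. catn.
    rw (eq_sym (act_pentagon (z1ob a ⊗ b) (z1ob a' ⊗ b') (z1ob a'' ⊗ b'') y)).
    rw (aasc_nat_l (z1ob a ⊗ b) (z1ob a' ⊗ b') (aasc (z1ob a'') b'' y)).
    reflexivity.
Qed.

Lemma tens_mu_lun (a : Z1 B) (b : B) :
  (lun (z1ob a) ⊗m lun b) ∘ (tens_mu (Z1_one B) (one B) a b
     ∘ (luni (one B) ⊗m idm (z1ob a ⊗ b))) = lun (z1ob a ⊗ b).
Proof.
  transitivity ((idm (z1ob a) ⊗m lun b) ∘ ((lun (z1ob a) ⊗m idm (one B ⊗ b))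
      ∘ (tens_mu (Z1_one B) (one B) a b
     ∘ (luni (one B) ⊗m idm (z1ob a ⊗ b))))).
  { rewrite (ra (eq_sym (tensm_comp _ _ _ _))). catn. reflexivity. }
  unfold tens_mu. rewrite <- lun_asc. simpl. catn. rw asc_asci. rw lun_nat.
  rw hbreg_lun. rw asc_luni. rewrite lun_luni. catn. reflexivity.
Qed.

Lemma hbreg_hbone (b x : B) : hbreg (hbone B) b x = luni (b ⊗ x) ∘ (idm b ⊗m lun x).
Proof.
  unfold hbreg. simpl. rewrite tensm_r. catn. rw asc_luni. rewrite <- triangle. catn.
  rewrite asc_asci. catn. reflexivity.
Qed.

Lemma tens_mu_run (a : Z1 B) (b : B) :
  (run (z1ob a) ⊗m run b) ∘ (tens_mu a b (Z1_one B) (one B)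
     ∘ (idm (z1ob a ⊗ b) ⊗m luni (one B))) = run (z1ob a ⊗ b).
Proof.
  transitivity ((idm (z1ob a) ⊗m run b) ∘ ((run (z1ob a) ⊗m idm (b ⊗ one B))
      ∘ (tens_mu a b (Z1_one B) (one B)
     ∘ (idm (z1ob a ⊗ b) ⊗m luni (one B))))).
  { rewrite (ra (eq_sym (tensm_comp _ _ _ _))). catn. reflexivity. }
  unfold tens_mu. simpl. rewrite hbreg_hbone, <- triangle, tensm_l. catn. rw asc_asci.
  rw (tensm_l_eq (z1ob a) (lun_luni (b ⊗ one B))). rewrite tensm_id. catn.
  rewrite <- tensm_id, asc_nat. rw (tensm_l_eq (z1ob a) (tensm_l_eq b (lun_luni (one B)))).
  rewrite !tensm_id. catn. apply run_asc.
Qed.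

Program Definition tens_lax : LaxMon (prod_mon (Z1 B) B) B := {|
  lfun := tens_functor;
  lmu := fun p q => tens_mu (fst p) (snd p) (fst q) (snd q);
  leta := luni (one B) |}.
Next Obligation. apply tens_mu_nat. Qed.
Next Obligation. apply tens_mu_asc. Qed.
Next Obligation. apply tens_mu_lun. Qed.
Next Obligation. apply tens_mu_run. Qed.

Lemma tens_lax_strong : is_strong tens_lax.
Proof. split; [apply is_iso_luni|]. intros; apply tens_mu_iso. Qed.

Variables (M : LModule B) (EM : EnrichedModule M) (EF : EnrichedModule (FunMod M M)).
Notation CM := (canonical_ecat EM).

(** Evaluating twice is evaluating a composite: [n'] can be applied before or after
    [h] because it is a module transformation out of [a' ⊙ F], whose module structure
    contains the half-braiding of [a'] that also occurs in [tens_mu]. *)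
Lemma eval_tens_mu (F G H : ModFun M M) (a a' : Z1 B) (b b' : B) (x y z : M)
  (n : ModNat (Z1_act a G) H) (n' : ModNat (Z1_act a' F) G)
  (h : hom (b ⊙ y) z) (h' : hom (b' ⊙ x) y) :
  mnat n z ∘ ((idm (z1ob a) ⊙m mlift G h) ∘ (aasc (z1ob a) b (G y)
    ∘ ((idm (z1ob a ⊗ b) ⊙m (mnat n' y ∘ ((idm (z1ob a') ⊙m mlift F h')
        ∘ aasc (z1ob a') b' (F x))))
    ∘ aasc (z1ob a ⊗ b) (z1ob a' ⊗ b') (F x))))
  = mnat n z ∘ ((idm (z1ob a) ⊙m mnat n' z) ∘ (aasc (z1ob a) (z1ob a') (F z)
    ∘ ((idm (z1ob a ⊗ a') ⊙m mlift F (h ∘ ((idm b ⊙m h') ∘ aasc b b' x)))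
    ∘ (aasc (z1ob a ⊗ a') (b ⊗ b') (F x) ∘ (tens_mu a b a' b' ⊙m idm (F x)))))).
Proof.
  rewrite mlift_comp, !actm_l. catn. f_equal.
  rw (aasc_nat_l (z1ob a) (z1ob a') (mlift F h)).
  rw (aasc_nat_l (z1ob a) (z1ob a') (idm b ⊙m mlift F h')).
  rw (tens_mu_act a b a' b' (F x)).
  rw (aasc_nat_l (z1ob a) b (mnat n' y)).
  rw (actm_l_eq (z1ob a) (eq_sym (modnat_mlift n' h))).
  rewrite mlift_act, !actm_l. catn.
  rw (aasc_nat_l (z1ob a) b (idm (z1ob a') ⊙m mlift F h')).
  do 2 f_equal. rw (actm_l_eq (z1ob a) (hbact_nat (z1hb a') (idm b) (mlift F h'))).
  rewrite !actm_l. catn. reflexivity.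
Qed.
Notation CF := (canonical_ecat EF).

Definition eval_hom (F G : ModFun M M) (x y : M) :
  hom ((z1ob (ihom EF F G) ⊗ ihom EM x y) ⊙ F x) (G y) :=
  mnat (ev EF F G) y ∘ ((idm _ ⊙m mlift F (ev EM x y)) ∘ aasc _ _ (F x)).

Lemma eval_hom_tens (F G : ModFun M M) (x y : M) (a : Z1 B) (b : B)
  (t : hom a (ihom EF F G)) (h : hom b (ihom EM x y)) :
  eval_hom F G x y ∘ ((z1hom t ⊗m h) ⊙m idm (F x))
  = mnat (uncurry EF t) y ∘ ((idm (z1ob a) ⊙m mlift F (uncurry EM h))
      ∘ aasc (z1ob a) b (F x)).
Proof.
  unfold eval_hom. catn. rw aasc_nat_r. rewrite !uncurryE, mlift_nat. simpl. catn.
  rewrite !(ra (eq_sym (actm_comp _ _ _ _))). catn. reflexivity.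
Qed.

Lemma eval_hom_id (F : ModFun M M) (x : M) :
  eval_hom F F x x ∘ (((z1hom (eid (e := CF) F) ⊗m eid (e := CM) x)
      ∘ luni (one B)) ⊙m idm (F x))
  = alun (F x).
Proof.
  rewrite actm_r, comp_assoc.
  etransitivity; [exact (f_equal (fun k => k ∘ _) (eval_hom_tens (eid (e :=
      CF) F) (eid (e := CM) x)))|].
  rewrite !uncurry_eid.
  simpl. rewrite mlift_alun. catn. rewrite aasc_aluni.
  rewrite <- aluni_nat. rewrite (ra (alun_aluni _)). catn. reflexivity.
Qed.

Lemma eval_hom_comp (F G H : ModFun M M) (x y z : M) :
  eval_hom F H x z ∘ (((z1hom (ecomp (e := CF) F G H) ⊗m ecomp (e := CM) x y z)
      ∘ tens_mu _ _ _ _) ⊙m idm (F x))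
  = eval_hom G H y z ∘ ((idm _ ⊙m eval_hom F G x y) ∘ aasc _ _ (F x)).
Proof.
  rewrite actm_r, comp_assoc.
  etransitivity; [exact (f_equal (fun k => k ∘ _) (eval_hom_tens (ecomp (e :=
      CF) F G H) (ecomp (e := CM) x y z)))|].
  rewrite !uncurry_ecomp1. simpl.
  unfold eval_hom. catn. symmetry. apply eval_tens_mu.
Qed.

Definition eval_efun : EFunctor (prod_ecat CF CM) CM :=
  mk_efun EM (H := tens_lax) (L := prod_ecat CF CM)
    (F := fun p => mfun (fst p : ModFun M M) (snd p))
    (e := fun p q => eval_hom (fst p) (fst q) (snd p) (snd q))
    (fun p => eval_hom_id (fst p) (snd p))
    (fun p q r => eval_hom_comp (fst p) (fst q) (fst r) (snd p) (snd q) (snd r)).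

Lemma uncurry_eval_efun p q : uncurry EM (efhom eval_efun p q)
    = eval_hom (fst p) (fst q) (snd p) (snd q).
Proof. apply uncurry_curry. Qed.

Lemma dec_umap_eval_efun (F G : ModFun M M) (x y : M) (s : uhom (L := CF) F G)
  (t : uhom (L := CM) x y) :
  dec (umap eval_efun (x := (F, x)) (y := (G, y)) (s, t)) = mnat (dec s) y ∘ fmap F (dec t).
Proof.
  unfold dec at 1, umap. rewrite uncurry_comp, uncurry_eval_efun. simpl.
  rewrite actm_r, comp_assoc.
  etransitivity; [exact (f_equal (fun k => k ∘ _ ∘ _) (eval_hom_tens s t))|].
  rewrite !uncurry_dec, mlift_fmap. simpl. catn.
  rw (aasc_aluni (one B) (F x)). rw (alun_nat (l := M)).
  repeat rw (alun_aluni (l := M)). rewrite aluni_nat. reflexivity.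
Qed.

(** The value on objects of the unit axiom for a 1-morphism between left unital
    actions; the two inner factors are coherence transformations. *)
Lemma dec_unit_chain (F : ModFun M M) (x y z : M) (al : uhom (L := CM) y z)
  (r : uhom (L := CM) (F x) y) (s : uhom (L := CF) (idmod M) F) :
  dec (ucomp (ucomp (ucomp al r)
       (ucomp (eid (e := CM) (F x))
         (umap eval_efun (x := (F, x)) (y := (F, x)) (eid (e := CF) F, eid (e := CM) x))))
     (umap eval_efun (x := (idmod M, x)) (y := (F, x)) (s, eid (e := CM) x)))
  = dec al ∘ (dec r ∘ mnat (dec s) x).
Proof.
  assert (T1 : dec (umap eval_efun (x := (F, x)) (y := (F, x))
     (eid (e := CF) F, eid (e := CM) x)) = idm (F x)).
  { etransitivity; [exact (f_equal (fun k => dec k) (umap_id eval_efun (F, x)))|].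
    apply (dec_eid EM). }
  assert (T2 : dec (umap eval_efun (x := (idmod M, x)) (y := (F, x)) (s, eid (e := CM) x))
    = mnat (dec s) x).
  { etransitivity; [exact (dec_umap_eval_efun s (eid (e := CM) x))|].
    rewrite dec_eid, fmap_id. apply comp_idr. }
  rewrite !dec_ucomp, dec_eid.
  etransitivity; [exact (f_equal2 (fun k l => dec al ∘ dec r ∘ (idm (F x) ∘ k)
      ∘ l) T1 T2)|].
  catn. reflexivity.
Qed.

End TensorFunctor.

(** * The evaluation action *)

Program Definition unit_lax (A : MonCat) : LaxMon unit_mon A := {|
  lfun := {| fob := fun _ : unit_cat => one A; fmap := fun _ _ _ => idm (one A) |};
  lmu := fun _ _ => lun (one A);
  leta := idm (one A) |}.
Next Obligation. reflexivity. Qed.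
Next Obligation. catn. reflexivity. Qed.
Next Obligation. rewrite tensm_id. catn. reflexivity. Qed.
Next Obligation.
  catn. rewrite triangle, <- lun_run_one. reflexivity.
Qed.
Next Obligation. rewrite tensm_id. catn. reflexivity. Qed.
Next Obligation. rewrite tensm_id. catn. apply lun_run_one. Qed.

Lemma unit_lax_strong A : is_strong (unit_lax A).
Proof. split; intros; simpl; auto with iso. Qed.

Program Definition point (A : MonCat) (L : ECategory A) (x : L) : EFunctor unit_ecat L := {|
  ehat := unit_lax A; efob := fun _ => x; efhom := fun _ _ => eid x |}.
Next Obligation. catn. reflexivity. Qed.
Next Obligation.
  catn. rewrite <- (comp_idl (eid x)) at 3. rewrite <- (comp_idr (eid x)) at 2.
  rewrite tensm_comp. rw ecomp_idl. rewrite lun_nat. reflexivity.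
Qed.

Program Definition mn_unit (A : MonCat) (F : LaxMon unit_mon A) : MonNat (unit_lax A) F :=
  {| mn := fun x => match x with tt => leta F end |}.
Next Obligation.
  destruct a, b, f. change (tt : hom (c := unit_mon) tt tt) with (idm (c := unit_mon) tt).
  rewrite fmap_id. catn. reflexivity.
Qed.
Next Obligation.
  destruct a, b. pose proof (lmu_lun F tt) as E.
  change (lun (tt : unit_mon)) with (idm (c := unit_mon) tt) in E.
  rewrite fmap_id, comp_idl in E. simpl in E.
  rewrite <- lun_nat, <- E. catn. rewrite <- tensm_comp. catn. reflexivity.
Qed.
Next Obligation. catn. reflexivity. Qed.

(** A transformation out of a point is determined by one morphism: its background
    component is forced to be the unit of the monoidal functor, and naturality holds
    because an enriched functor out of the point sends the hom object to the
    identity. *)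
Program Definition enat_point (A : MonCat) (L : ECategory A) (x : L)
  (F : EFunctor unit_ecat L) (s : uhom x (F tt)) : ENat (point x) F :=
  {| enhat := mn_unit (ehat F); enat := fun z => match z with tt => s end |}.
Next Obligation.
  destruct x0, y. pose proof (efhom_id F tt) as E.
  change (eid (tt : unit_ecat)) with (idm (c := unit_mon) tt) in E.
  rewrite fmap_id, comp_idl in E. simpl in E. rewrite E.
  exact (eq_trans (eq_sym (ucomp_post s (eid x)))
    (eq_trans (ucomp_idr s) (eq_trans (eq_sym (ucomp_idl s)) (ucomp_pre (eid _) s)))).
Qed.

Lemma enhat_point (A : MonCat) (L : ECategory A) (x : L)
  (F : EFunctor unit_ecat L) (t : ENat (point x) F) : enhat t tt = leta (ehat F).
Proof. rewrite <- (mn_eta (enhat t)). simpl. symmetry. apply comp_idr. Qed.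

Definition point1 (L : ECat) (x : L) : ECat1 unit0 L :=
  {| efun := point x : EFunctor unit0 L; efun_strong := unit_lax_strong (bg L) |}.

Section EvaluationAction.
Variables (B : MonCat) (M : LModule B) (EM : EnrichedModule M) (EF
    : EnrichedModule (FunMod M M)).

Definition eval_efun1 : ECat1 (prod0 (canonical EF) (canonical EM)) (canonical EM) :=
  {| efun := eval_efun EM EF : EFunctor (prod0 (canonical EF) (canonical EM))
      (canonical EM);
     efun_strong := tens_lax_strong B |}.

Definition idmod_point : ECat1 unit0 (canonical EF) := point1 (L := canonical EF) (idmod M).

Notation gu := (comp1 eval_efun1 (prod1 idmod_point (one1 (canonical EM)))).

Program Definition eval_alpha_hat : MonNat (ehat gu) (ehat (lunit1 (canonical EM))) :=
  {| mn := fun b => lun (snd b) |}.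
Next Obligation. apply lun_nat. Qed.
Next Obligation.
  unfold tens_mu. simpl. rewrite hbreg_hbone. catn.
  rewrite <- lun_asc, tensm_l. catn. rw asc_asci. rw (lun_nat (luni (snd a ⊗ snd b))).
  rw lun_luni. rw lun_nat. rw lun_asc. rewrite <- tensm_comp. catn. reflexivity.
Qed.
Next Obligation. rewrite tensm_id. catn. apply lun_luni. Qed.

Lemma eval_alpha_nat (x y : M) :
  idm y ∘ uncurry EM (efhom gu (tt, x) (tt, y))
  = uncurry EM (efhom (lunit1 (canonical EM)) (tt, x) (tt, y))
      ∘ (lun (ihom EM x y) ⊙m idm x).
Proof.
  change (uncurry EM (efhom (lunit1 (canonical EM)) (tt, x) (tt, y))) with (ev EM x y).
  etransitivity; [apply comp_idl|].
  etransitivity; [exact (uncurry_comp (efhom (eval_efun EM EF) ((idmod M), x)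
      ((idmod M), y)) _)|].
  rewrite uncurry_eval_efun. simpl.
  etransitivity; [exact (eval_hom_tens (eid (e := canonical_ecat EF) (idmod M)) (idm
      (ihom EM x y)))|].
  rewrite uncurry_eid. simpl. rewrite mlift_idmod. rw (alun_nat (l := M)). rw alun_aasc.
  reflexivity.
Qed.

Definition eval_alpha : gu ⇒ lunit1 (canonical EM) :=
  mk_enat (E := EM) (F := efun gu) (G := efun (lunit1 (canonical EM))) (h := eval_alpha_hat)
    (s := fun p => idm (snd p : M)) (fun p q => eval_alpha_nat (snd p) (snd q)).

Lemma eval_alpha_iso : is_iso eval_alpha.
Proof.
  apply ecat2_iso; intros x; simpl.
  - apply is_iso_lun.
  - apply uiso_dec. rewrite dec_enc. apply is_iso_id.
Qed.

Definition eval_action : LeftUnitalAction (canonical EM) := {|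
  la_ob := canonical EF; la_unit := idmod_point; la_act := eval_efun1;
  la_alpha := eval_alpha; la_alpha_iso := eval_alpha_iso |}.

End EvaluationAction.

(* Unfolding these constructions last lets composites be compared part by part. *)
Strategy 100 [efun_comp prod_efun efun_id eval_efun point snd_efun lax_comp prod_lax lax_id
  canonical_ecat prod_ecat unit_ecat mk_efun tens_lax unit_lax enat_comp enat_id
      enat_whisk_l enat_whisk_r prod_enat prod_mon unit_mon Z1 FunMod].

(** * Strong monoidal functors [A × B -> B] *)

(** Let [G] be strong monoidal with a monoidal isomorphism [phi] from the identity to
    [G (1, -)]. Then [G] is determined by [a |-> G (a, 1)], which lands in the
    center. *)
Section Background.
Variables (A B : MonCat) (G : LaxMon (prod_mon A B) B) (HG : is_strong G).
Variable phi : forall b : B, hom b (G (one A, b)).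

Definition bimap (a a' : A) (b b' : B) (f : hom a a') (g : hom b b')
  : hom (G (a, b)) (G (a', b')) := fmap G (x := (a, b)) (y := (a', b')) (f, g).

Definition bimu (a a' : A) (b b' : B)
  : hom (G (a, b) ⊗ G (a', b')) (G (a ⊗ a', b ⊗ b')) := lmu G (a, b) (a', b').

(** The structure map of [G] followed by maps out of the two products. Units in [A]
    and [B] are absorbed by the choice of [f] and [h], so that no identity below has to
    mention how they are inserted. *)
Definition bimul (a a' c : A) (b b' d : B) (f : hom (a ⊗ a') c) (h : hom (b ⊗ b') d)
  : hom (G (a, b) ⊗ G (a', b')) (G (c, d)) := bimap f h ∘ bimu a a' b b'.

Hypothesis phi_nat : forall b b' (g : hom b b'), bimap (idm _) g ∘ phi b = phi b' ∘ g.
Hypothesis phi_mul : forall b b',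
  bimul (lun (one A)) (idm (b ⊗ b')) ∘ (phi b ⊗m phi b') = phi (b ⊗ b').
Hypothesis phi_one : phi (one B) = leta G.
Hypothesis phi_iso : forall b, is_iso (phi b).

Lemma bimap_id a b : bimap (idm a) (idm b) = idm (G (a, b)).
Proof. exact (fmap_id G (a, b)). Qed.

Lemma bimap_comp a a' a'' b b' b'' (f' : hom a' a'') (f : hom a a') (g' : hom b' b'') (g
    : hom b b') :
  bimap (f' ∘ f) (g' ∘ g) = bimap f' g' ∘ bimap f g.
Proof. exact (fmap_comp G (x := (a, b)) (y := (a', b')) (z :=
    (a'', b'')) (f', g') (f, g)). Qed.

Lemma bimap_bimul a a' c c' b b' d d' (u : hom c c') (v : hom d d') (f
    : hom (a ⊗ a') c) (h : hom (b ⊗ b') d) :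
  bimap u v ∘ bimul f h = bimul (u ∘ f) (v ∘ h).
Proof. unfold bimul. rewrite bimap_comp. catn. reflexivity. Qed.

Lemma bimul_bimap a1 a1' a2 a2' c b1 b1' b2 b2' d (f : hom (a1' ⊗ a2') c) (h
    : hom (b1' ⊗ b2') d)
  (u1 : hom a1 a1') (v1 : hom b1 b1') (u2 : hom a2 a2') (v2 : hom b2 b2') :
  bimul f h ∘ (bimap u1 v1 ⊗m bimap u2 v2) = bimul (f ∘ (u1 ⊗m u2)) (h ∘ (v1 ⊗m v2)).
Proof.
  unfold bimul. rewrite bimap_comp. catn.
  pose proof (E := lmu_nat G (a := (a1, b1)) (a' := (a1', b1')) (b := (a2, b2)) (b' :=
      (a2', b2')) (u1, v1) (u2, v2)).
  exact (f_equal (fun k => bimap f h ∘ k) E).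
Qed.

(** Associativity with coherence confined to two side conditions, one in [A] and one
    in [B]. *)
Lemma bimul_assoc a1 a2 a3 a12 a23 a b1 b2 b3 b12 b23 b
  (f : hom (a12 ⊗ a3) a) (f' : hom (a1 ⊗ a2) a12)
  (k : hom (a1 ⊗ a23) a) (k' : hom (a2 ⊗ a3) a23)
  (h : hom (b12 ⊗ b3) b) (h' : hom (b1 ⊗ b2) b12)
  (l : hom (b1 ⊗ b23) b) (l' : hom (b2 ⊗ b3) b23) :
  f ∘ (f' ⊗m idm a3) = k ∘ ((idm a1 ⊗m k') ∘ asc a1 a2 a3) ->
  h ∘ (h' ⊗m idm b3) = l ∘ ((idm b1 ⊗m l') ∘ asc b1 b2 b3) ->
  bimul f h ∘ (bimul f' h' ⊗m idm (G (a3, b3)))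
  = bimul k l ∘ ((idm (G (a1, b1)) ⊗m bimul k' l') ∘ asc _ _ _).
Proof.
  intros E1 E2.
  transitivity (bimul (f ∘ (f' ⊗m idm a3)) (h ∘ (h' ⊗m idm b3))
      ∘ (bimu a1 a2 b1 b2 ⊗m idm _)).
  { rewrite <- bimul_bimap, bimap_id. unfold bimul at 2. rewrite tensm_r. catn.
      reflexivity. }
  transitivity (bimul (k ∘ (idm a1 ⊗m k')) (l ∘ (idm b1 ⊗m l')) ∘
      ((idm (G (a1, b1)) ⊗m bimu a2 a3 b2 b3) ∘ asc _ _ _)).
  - assert (E : bimap (asc a1 a2 a3) (asc b1 b2 b3) ∘ (bimu _ _ _ _
      ∘ (bimu a1 a2 b1 b2 ⊗m idm _))
      = bimu _ _ _ _ ∘ ((idm (G (a1, b1)) ⊗m bimu a2 a3 b2 b3) ∘ asc _ _ _))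
      by exact (lmu_asc G (a1, b1) (a2, b2) (a3, b3)).
    rewrite E1, E2. unfold bimul. rewrite !bimap_comp. catn. rewrite E. reflexivity.
  - rewrite <- bimul_bimap, bimap_id. unfold bimul at 3. rewrite tensm_l. catn. reflexivity.
Qed.

Lemma bimul_lun a b : bimul (lun a) (lun b) ∘ (phi (one B) ⊗m idm (G (a, b)))
    = lun (G (a, b)).
Proof. rewrite phi_one. unfold bimul. catn. exact (lmu_lun G (a, b)). Qed.

Lemma bimul_run a b : bimul (run a) (run b) ∘ (idm (G (a, b)) ⊗m phi (one B))
    = run (G (a, b)).
Proof. rewrite phi_one. unfold bimul. catn. exact (lmu_run G (a, b)). Qed.

Definition absorb_r a b : hom (G (a, one B) ⊗ b) (G (a, b)) :=
  bimul (run a) (lun b) ∘ (idm _ ⊗m phi b).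

Definition absorb_l a b : hom (b ⊗ G (a, one B)) (G (a, b)) :=
  bimul (lun a) (run b) ∘ (phi b ⊗m idm _).

Definition rmul a b c : hom (G (a, b) ⊗ c) (G (a, b ⊗ c)) :=
  bimul (run a) (idm (b ⊗ c)) ∘ (idm _ ⊗m phi c).

Definition lmul a b c : hom (b ⊗ G (a, c)) (G (a, b ⊗ c)) :=
  bimul (lun a) (idm (b ⊗ c)) ∘ (phi b ⊗m idm _).

Lemma absorb_r_nat a a' b b' (f : hom a a') (g : hom b b') :
  bimap f g ∘ absorb_r a b = absorb_r a' b' ∘ (bimap f (idm _) ⊗m g).
Proof.
  unfold absorb_r. catn. rewrite <- tensm_comp. catn. rewrite <- phi_nat.
  transitivity (bimul (run a') (lun b') ∘ ((bimap f (idm (one B)) ⊗m bimap (idm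
      (one A)) g) ∘ (idm _ ⊗m phi b))).
  - rewrite !comp_assoc, bimap_bimul, bimul_bimap, run_nat, lun_nat. reflexivity.
  - rewrite <- tensm_comp. catn. reflexivity.
Qed.

Lemma absorb_l_nat a a' b b' (f : hom a a') (g : hom b b') :
  bimap f g ∘ absorb_l a b = absorb_l a' b' ∘ (g ⊗m bimap f (idm _)).
Proof.
  unfold absorb_l. catn. rewrite <- tensm_comp. catn. rewrite <- phi_nat.
  transitivity (bimul (lun a') (run b') ∘ ((bimap (idm (one A)) g ⊗m bimap f (idm
      (one B))) ∘ (phi b ⊗m idm _))).
  - rewrite !comp_assoc, bimap_bimul, bimul_bimap, run_nat, lun_nat. reflexivity.
  - rewrite <- tensm_comp. catn. reflexivity.
Qed.

Lemma bimul_iso a a' c b b' d (f : hom (a ⊗ a') c) (h : hom (b ⊗ b') d) :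
  is_iso f -> is_iso h -> is_iso (bimul f h).
Proof.
  intros. apply is_iso_comp; [|apply HG]. apply is_iso_fmap.
  apply (is_iso_pair (C := A) (D := B)); assumption.
Qed.

Lemma absorb_r_iso a b : is_iso (absorb_r a b).
Proof. apply is_iso_comp; [apply bimul_iso|]; auto with iso. Qed.

Lemma absorb_l_iso a b : is_iso (absorb_l a b).
Proof. apply is_iso_comp; [apply bimul_iso|]; auto with iso. Qed.

(** The side conditions of [bimul_assoc] that occur: the ways to cancel a unit among
    three factors. *)
Lemma run_lun_one (C : MonCat) (a : C) :
  run a ∘ (run a ⊗m idm (one C)) = run a ∘ ((idm a ⊗m lun (one C)) ∘ asc a (one C) (one C)).
Proof. rewrite triangle. reflexivity. Qed.

Lemma lun_lun (C : MonCat) (a : C) :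
  lun a ∘ (lun (one C) ⊗m idm a) = lun a ∘ ((idm (one C) ⊗m lun a) ∘ asc (one C) (one C) a).
Proof. rw (lun_nat (m := C)). rewrite <- lun_asc. reflexivity. Qed.

Lemma run_lun (C : MonCat) (a : C) :
  run a ∘ (lun a ⊗m idm (one C)) = lun a ∘ ((idm (one C) ⊗m run a) ∘ asc (one C) a (one C)).
Proof. rw (lun_nat (m := C)). rewrite lun_asc. reflexivity. Qed.

Lemma bimul_assoc_pre a1 a2 a3 a12 a23 a b1 b2 b3 b12 b23 b
  (f : hom (a12 ⊗ a3) a) (f' : hom (a1 ⊗ a2) a12)
  (k : hom (a1 ⊗ a23) a) (k' : hom (a2 ⊗ a3) a23)
  (h : hom (b12 ⊗ b3) b) (h' : hom (b1 ⊗ b2) b12)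
  (l : hom (b1 ⊗ b23) b) (l' : hom (b2 ⊗ b3) b23)
  x y z (p : hom x (G (a1, b1))) (q : hom y (G (a2, b2))) (r : hom z (G (a3, b3))) :
  f ∘ (f' ⊗m idm a3) = k ∘ ((idm a1 ⊗m k') ∘ asc a1 a2 a3) ->
  h ∘ (h' ⊗m idm b3) = l ∘ ((idm b1 ⊗m l') ∘ asc b1 b2 b3) ->
  bimul f h ∘ ((bimul f' h' ∘ (p ⊗m q)) ⊗m r)
  = bimul k l ∘ ((p ⊗m (bimul k' l' ∘ (q ⊗m r))) ∘ asc x y z).
Proof.
  intros E1 E2.
  transitivity (bimul f h ∘ (bimul f' h' ⊗m idm (G (a3, b3))) ∘ ((p ⊗m q) ⊗m r)).
  - catn. rewrite <- tensm_comp. catn. reflexivity.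
  - rewrite (bimul_assoc E1 E2). catn. rewrite asc_nat.
    rewrite (ra (eq_sym (tensm_comp _ _ _ _))). catn. reflexivity.
Qed.

Lemma run_tens (C : MonCat) (a b : C) :
  run (a ⊗ b) ∘ (idm (a ⊗ b) ⊗m idm (one C)) = idm (a ⊗ b) ∘ ((idm a ⊗m run b)
      ∘ asc a b (one C)).
Proof. rewrite tensm_id. catn. symmetry. apply run_asc. Qed.

Lemma lun_tens (C : MonCat) (a b : C) :
  idm (a ⊗ b) ∘ (lun a ⊗m idm b) = lun (a ⊗ b) ∘ ((idm (one C) ⊗m idm (a ⊗ b))
      ∘ asc (one C) a b).
Proof. rewrite tensm_id. catn. symmetry. apply lun_asc. Qed.

Lemma run_lun_mid (C : MonCat) (a b : C) :
  idm (a ⊗ b) ∘ (run a ⊗m idm b) = idm (a ⊗ b) ∘ ((idm a ⊗m lun b) ∘ asc a (one C) b).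
Proof. catn. symmetry. apply triangle. Qed.

(** This lemma and the next two say that [b] acts on [G (a, -)] from the left and from
    the right, and that the two actions commute. They are the three identities from
    which the hexagon of the half-braiding is assembled. *)
Lemma absorb_r_tens a b c :
  absorb_r a (b ⊗ c) ∘ asc _ _ _ = rmul a b c ∘ (absorb_r a b ⊗m idm c).
Proof.
  unfold absorb_r, rmul. rewrite <- phi_mul. catn. rewrite <- tensm_comp. catn.
  rewrite (bimul_assoc_pre (k := run a) (k' := lun (one A)) (l := lun (b ⊗ c)) (l' :=
      idm (b ⊗ c))).
  - reflexivity.
  - apply run_lun_one.
  - apply lun_tens.
Qed.

Lemma absorb_l_tens a b c :
  absorb_l a (b ⊗ c) = lmul a b c ∘ ((idm b ⊗m absorb_l a c) ∘ asc _ _ _).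
Proof.
  unfold absorb_l, lmul. rewrite <- phi_mul. catn. rewrite (ra (eq_sym
      (tensm_comp _ _ _ _))). catn.
  apply bimul_assoc_pre.
  - apply lun_lun.
  - symmetry. rewrite <- run_asc, tensm_id. catn. reflexivity.
Qed.

Lemma rmul_absorb_l a b c :
  rmul a b c ∘ (absorb_l a b ⊗m idm c) = lmul a b c ∘ ((idm b ⊗m absorb_r a c) ∘ asc _ _ _).
Proof.
  unfold absorb_l, lmul, rmul, absorb_r. catn.
  rewrite <- tensm_comp, (ra (eq_sym (tensm_comp _ _ _ _))). catn.
  apply bimul_assoc_pre.
  - apply run_lun.
  - apply run_lun_mid.
Qed.

Definition center_mul a a' : hom (G (a, one B) ⊗ G (a', one B)) (G (a ⊗ a', one B)) :=
  bimul (idm (a ⊗ a')) (lun (one B)).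

(** This lemma and the next two move [b] through [G (a, 1) ⊗ G (a', 1)] from right to left,
    one factor at a time; they make multiplication a morphism of the center. *)
Lemma absorb_r_center_mul a a' b :
  absorb_r (a ⊗ a') b ∘ (center_mul a a' ⊗m idm b)
  = bimul (idm (a ⊗ a')) (lun b) ∘ ((idm _ ⊗m absorb_r a' b) ∘ asc _ _ _).
Proof.
  unfold absorb_r, center_mul. catn. rewrite <- tensm_comp. catn.
  rewrite <- (comp_idr (bimul (idm (a ⊗ a')) (lun (one B)))), <- (tensm_id (G (a, one B))
      (G (a', one B))).
  apply bimul_assoc_pre.
  - apply run_tens.
  - apply lun_lun.
Qed.

Lemma bimul_absorb a a' b :
  bimul (idm (a ⊗ a')) (run b) ∘ (absorb_r a b ⊗m idm _)
  = bimul (idm (a ⊗ a')) (lun b) ∘ ((idm _ ⊗m absorb_l a' b) ∘ asc _ _ _).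
Proof.
  unfold absorb_r, absorb_l. apply bimul_assoc_pre.
  - apply run_lun_mid.
  - apply run_lun.
Qed.

Lemma absorb_l_center_mul a a' b :
  absorb_l (a ⊗ a') b ∘ ((idm b ⊗m center_mul a a') ∘ asc _ _ _)
  = bimul (idm (a ⊗ a')) (run b) ∘ (absorb_l a b ⊗m idm _).
Proof.
  unfold absorb_l, center_mul. catn. rewrite (ra (eq_sym (tensm_comp _ _ _ _))). catn.
  rewrite <- (comp_idr (bimul (idm (a ⊗ a')) (lun (one B)))), <- (tensm_id (G (a, one B))
      (G (a', one B))).
  symmetry. apply bimul_assoc_pre.
  - apply lun_tens.
  - apply run_lun_one.
Qed.

Lemma bimu_absorb_r a a' b b' :
  bimu a a' b b' ∘ (absorb_r a b ⊗m idm _)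
  = bimul (idm (a ⊗ a')) (lun (b ⊗ b')) ∘ ((idm _ ⊗m lmul a' b b') ∘ asc _ _ _).
Proof.
  replace (bimu a a' b b') with (bimul (idm (a ⊗ a')) (idm (b ⊗ b')))
    by (unfold bimul; rewrite bimap_id; apply comp_idl).
  unfold absorb_r, lmul. apply bimul_assoc_pre.
  - apply run_lun_mid.
  - apply lun_tens.
Qed.

Lemma center_mul_asc a b c :
  bimap (asc a b c) (idm (one B)) ∘ (center_mul (a ⊗ b) c ∘ (center_mul a b ⊗m idm _))
  = center_mul a (b ⊗ c) ∘ ((idm _ ⊗m center_mul b c) ∘ asc _ _ _).
Proof.
  unfold center_mul. rewrite comp_assoc, bimap_bimul. apply bimul_assoc.
  - rewrite !tensm_id. catn. reflexivity.
  - rewrite comp_idl. apply lun_lun.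
Qed.

Lemma absorb_r_one a : absorb_r a (one B) = run _.
Proof. unfold absorb_r. rewrite lun_run_one. apply bimul_run. Qed.

Lemma absorb_l_one a : absorb_l a (one B) = lun _.
Proof. unfold absorb_l. rewrite <- lun_run_one. apply bimul_lun. Qed.

Lemma absorb_r_phi b : absorb_r (one A) b ∘ (phi (one B) ⊗m idm b) = phi b ∘ lun b.
Proof.
  unfold absorb_r. catn. rewrite <- lun_nat, <- bimul_lun, lun_run_one. catn.
  rewrite <- !tensm_comp. catn. reflexivity.
Qed.

Lemma absorb_l_phi b : absorb_l (one A) b ∘ (idm b ⊗m phi (one B)) = phi b ∘ run b.
Proof.
  unfold absorb_l. catn. rewrite <- run_nat, <- bimul_run, lun_run_one. catn.
  rewrite <- !tensm_comp. catn. reflexivity.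
Qed.

(** The half-braiding compares the two ways of absorbing [b] into the second
    variable of [G], from the left and from the right. *)
Definition center_hb_fun a b : hom (b ⊗ G (a, one B)) (G (a, one B) ⊗ b) :=
  iso_inv (absorb_r_iso a b) ∘ absorb_l a b.

Lemma absorb_hb a b : absorb_r a b ∘ center_hb_fun a b = absorb_l a b.
Proof. unfold center_hb_fun. rewrite comp_assoc, iso_inv_r. catn. reflexivity. Qed.

Lemma absorb_r_center_hb a b c :
  absorb_r a (b ⊗ c) ∘ (asc _ _ _ ∘ ((center_hb_fun a b ⊗m idm c) ∘ asci _ _ _))
  = lmul a b c ∘ (idm b ⊗m absorb_r a c).
Proof.
  rw absorb_r_tens. rewrite (ra (eq_sym (tensm_r _ _ _))), absorb_hb.
  rw rmul_absorb_l. rewrite asc_asci. catn. reflexivity.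
Qed.

Lemma center_hb_nat a b b' (f : hom b b') :
  center_hb_fun a b' ∘ (f ⊗m idm _) = (idm _ ⊗m f) ∘ center_hb_fun a b.
Proof.
  apply (iso_mono (absorb_r_iso a b')). rw absorb_hb.
  rewrite <- (bimap_id a (one B)) at 1. rewrite <- absorb_l_nat, <- bimap_id, (ra (eq_sym
      (absorb_r_nat _ _))).
  catn. rewrite absorb_hb. reflexivity.
Qed.

Lemma center_hb_tens a b c :
  center_hb_fun a (b ⊗ c) = asc _ _ _ ∘ ((center_hb_fun a b ⊗m idm c)
    ∘ (asci _ _ _ ∘ ((idm b ⊗m center_hb_fun a c) ∘ asc _ _ _))).
Proof.
  apply (iso_mono (absorb_r_iso a (b ⊗ c))). rewrite absorb_hb. rw absorb_r_center_hb.
  rewrite (ra (eq_sym (tensm_l _ _ _))), absorb_hb. apply absorb_l_tens.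
Qed.

Program Definition center_hb a : HalfBraiding (G (a, one B)) := {| hb := center_hb_fun a |}.
Next Obligation. apply is_iso_comp; [auto with iso | apply absorb_l_iso]. Qed.
Next Obligation. apply center_hb_nat. Qed.
Next Obligation. apply center_hb_tens. Qed.
Next Obligation. rewrite <- absorb_r_one, absorb_hb. apply absorb_l_one. Qed.

Definition center_ob a : Z1 B := {| z1ob := G (a, one B); z1hb := center_hb a |}.

Program Definition center_map a a' (f : hom a a') : Z1Hom (center_ob a) (center_ob a') :=
  {| z1hom := bimap f (idm (one B)) |}.
Next Obligation.
  apply (iso_mono (absorb_r_iso a' b)). rw absorb_hb.
  rewrite (ra (eq_sym (absorb_r_nat f (idm b)))). catn. rewrite absorb_hb. apply
      absorb_l_nat.
Qed.

Program Definition center_mu a a' : Z1Hom (Z1_tens (center_ob a) (center_ob a'))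
    (center_ob (a ⊗ a')) :=
  {| z1hom := center_mul a a' |}.
Next Obligation.
  apply (iso_mono (absorb_r_iso (a ⊗ a') b)). rw absorb_hb. rw absorb_r_center_mul.
  rewrite (ra (asc_asci _ _ _)), comp_idl, (ra (eq_sym (tensm_l _ _ _))), absorb_hb.
  unfold hbreg. simpl.
  rw (eq_sym (bimul_absorb a a' b)). rewrite (ra (eq_sym (tensm_r _ _ _))), absorb_hb.
  rw (eq_sym (absorb_l_center_mul a a' b)). rewrite asc_asci. catn. reflexivity.
Qed.

Program Definition center_eta : Z1Hom (Z1_one B) (center_ob (one A)) := {| z1hom :=
    leta G |}.
Next Obligation.
  rewrite <- phi_one. apply (iso_mono (absorb_r_iso (one A) b)). rw absorb_hb.
  rw absorb_r_phi. rw lun_luni. rewrite absorb_l_phi. reflexivity.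
Qed.

Program Definition center_lax : LaxMon A (Z1 B) := {|
  lfun := {| fob := center_ob : A -> Z1 B; fmap := center_map |};
  lmu := center_mu; leta := center_eta |}.
Next Obligation. apply Z1Hom_eq, bimap_id. Qed.
Next Obligation.
  apply Z1Hom_eq. simpl. rewrite <- bimap_comp, comp_idl. reflexivity.
Qed.
Next Obligation.
  apply Z1Hom_eq. simpl. unfold center_mul. rewrite bimul_bimap, bimap_bimul,
      tensm_id. catn. reflexivity.
Qed.
Next Obligation. apply Z1Hom_eq, center_mul_asc. Qed.
Next Obligation.
  apply Z1Hom_eq. simpl. unfold center_mul. rewrite comp_assoc, bimap_bimul,
      <- phi_one. catn.
  apply bimul_lun.
Qed.
Next Obligation.
  apply Z1Hom_eq. simpl. unfold center_mul. rewrite comp_assoc, bimap_bimul,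
      <- phi_one. catn.
  rewrite lun_run_one. apply bimul_run.
Qed.

Lemma center_lax_strong : is_strong center_lax.
Proof.
  split; [|intros a a']; apply z1_iso; simpl.
  - apply HG.
  - apply bimul_iso; auto with iso.
Qed.

(** Moving [a'] past [b] in [tens_mu] is by definition re-absorbing [b] on the other
    side of [G (a', 1)], so both sides multiply the same four factors. *)
Lemma absorb_r_mu a b a' b' :
  absorb_r (a ⊗ a') (b ⊗ b') ∘ ((center_mul a a' ⊗m idm (b ⊗ b'))
      ∘ tens_mu (center_ob a) b (center_ob a') b')
  = bimu a a' b b' ∘ (absorb_r a b ⊗m absorb_r a' b').
Proof.
  unfold tens_mu, hbreg. simpl. rw absorb_r_center_mul. rewrite (ra
      (asc_asci _ _ _)), comp_idl.
  rewrite (ra (eq_sym (tensm_l _ _ _))), absorb_r_center_hb, tensm_l. catn.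
  transitivity (bimu a a' b b' ∘ ((absorb_r a b ⊗m idm _) ∘ (idm _ ⊗m absorb_r a' b'))).
  - rw (bimu_absorb_r a a' b b'). rewrite <- asc_nat, tensm_id. reflexivity.
  - rewrite <- tensm_comp. catn. reflexivity.
Qed.

Lemma absorb_r_eta : absorb_r (one A) (one B) ∘ ((leta G ⊗m idm (one B))
    ∘ luni (one B)) = leta G.
Proof.
  rewrite <- phi_one. rw absorb_r_phi. rewrite lun_luni. catn. reflexivity.
Qed.

End Background.

(** * Every action maps to the evaluation action *)

Lemma ecomp_eid_l (A : MonCat) (L : ECategory A) (c : A) (x y : L) (t : hom c (ehom x y)) :
  ecomp x y y ∘ (eid y ⊗m t) = t ∘ lun c.
Proof.
  rewrite <- lun_nat, <- ecomp_idl. catn. rewrite <- tensm_comp. catn. reflexivity.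
Qed.

Lemma ecomp_eid_r (A : MonCat) (L : ECategory A) (c : A) (x y : L) (t : hom c (ehom x y)) :
  ecomp x x y ∘ (t ⊗m eid x) = t ∘ run c.
Proof.
  rewrite <- run_nat, <- ecomp_idr. catn. rewrite <- tensm_comp. catn. reflexivity.
Qed.

(** Here [u], [g] and [al] are the unit, the action and the unit constraint of a left
    unital action. The background of [u] is a unit object only up to the isomorphism
    [u_eta], which is why [psi] below is a composite. *)
Section Existence.
Variables (B : MonCat) (M : LModule B) (EM : EnrichedModule M).
Variables (A : MonCat) (L : ECategory A) (u : EFunctor unit_ecat L)
  (g : EFunctor (prod_ecat L (canonical_ecat EM)) (canonical_ecat EM))
  (al : ENat (efun_comp g (prod_efun u (efun_id (canonical_ecat EM))))
             (snd_efun unit_ecat (canonical_ecat EM))).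
Hypothesis Hu : is_strong (ehat u).
Notation G := (ehat g : LaxMon (prod_mon A B) B).
Notation pt := (ehat u tt : A).

Definition al_hat b : hom (G (pt, b)) b := enhat al (tt, b).
Hypothesis al_hat_iso : forall b, is_iso (al_hat b).

Definition u_eta : hom (one A) pt := leta (ehat u).

Definition u_mu : hom (pt ⊗ pt) pt := lmu (ehat u) tt tt.

Lemma u_mu_eta : u_mu ∘ (u_eta ⊗m u_eta) = u_eta ∘ lun (one A).
Proof. symmetry. exact (mn_mu (mn_unit (ehat u)) tt tt). Qed.

Lemma u_eta_iso : is_iso u_eta.
Proof. apply Hu. Qed.

(** The identification of [G (1, b)] with [b] given by the unit constraint. *)
Definition psi (b : B) : hom (G (one A, b)) b :=
  al_hat b ∘ bimap G u_eta (idm b).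

Lemma psi_iso b : is_iso (psi b).
Proof.
  apply is_iso_comp.
  - apply al_hat_iso.
  - apply is_iso_fmap. apply (is_iso_pair (C := A) (D := B));
      [apply u_eta_iso | apply is_iso_id].
Qed.

Lemma psi_nat b b' (f : hom b b') : psi b' ∘ bimap G (idm _) f = f ∘ psi b.
Proof.
  unfold psi. catn. rewrite <- bimap_comp, comp_idl, comp_idr.
  pose proof (mn_nat (enhat al) (a := (tt, b)) (b := (tt, b')) (tt, f)) as E.
  change (al_hat b' ∘ fmap G (x := (ehat u tt, b)) (y := (ehat u tt, b'))
    (fmap (ehat u) (idm (c := unit_cat) tt), f) = f ∘ al_hat b) in E.
  rewrite fmap_id in E. rewrite comp_assoc, <- E. unfold bimap. catn.
  rewrite <- (fmap_comp G). simpl. catn. reflexivity.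
Qed.

Lemma psi_mul b b' : psi (b ⊗ b') ∘ bimul G (lun (one A)) (idm _) = psi b ⊗m psi b'.
Proof.
  unfold psi. catn. rewrite bimap_bimul, comp_idl.
  assert (E2 : al_hat (b ⊗ b') ∘ (bimap G u_mu (idm _) ∘ bimu G _ _ b b')
    = al_hat b ⊗m al_hat b').
  { pose proof (mn_mu (enhat al) (tt, b) (tt, b')) as E2.
    etransitivity; [exact E2|]. apply comp_idl. }
  rewrite tensm_comp, <- E2. catn.
  transitivity (al_hat (b ⊗ b') ∘ (bimul G u_mu (idm _) ∘ (bimap G u_eta
      (idm b) ⊗m bimap G u_eta (idm b')))).
  - rewrite bimul_bimap, tensm_id, comp_idl, u_mu_eta. reflexivity.
  - unfold bimul. catn. reflexivity.
Qed.

Lemma psi_one : psi (one B) ∘ leta G = idm _.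
Proof.
  unfold psi. catn. exact (mn_eta (enhat al)).
Qed.

Definition phi b := iso_inv (psi_iso b).

Lemma phi_iso b : is_iso (phi b).
Proof. apply is_iso_iso_inv. Qed.

Lemma phi_nat b b' (f : hom b b') : bimap G (idm _) f ∘ phi b = phi b' ∘ f.
Proof.
  apply (iso_mono (psi_iso b')). unfold phi. rewrite comp_assoc, psi_nat. catn.
  rewrite iso_inv_r. rewrite (comp_assoc (psi b')), iso_inv_r. catn. reflexivity.
Qed.

Lemma phi_mul b b' : bimul G (lun (one A)) (idm _) ∘ (phi b ⊗m phi b') = phi (b ⊗ b').
Proof.
  apply (iso_mono (psi_iso (b ⊗ b'))). unfold phi. rewrite comp_assoc, psi_mul, iso_inv_r.
  rewrite <- tensm_comp, !iso_inv_r. apply tensm_id.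
Qed.

Lemma phi_one : phi (one B) = leta G.
Proof.
  apply (iso_mono (psi_iso (one B))). unfold phi. rewrite iso_inv_r, psi_one. reflexivity.
Qed.

Definition gfob (a : L) (x : M) : M := g (a, x).

Definition cmp x y z : hom (ihom EM y z ⊗ ihom EM x y) (ihom EM x z) :=
  ecomp (e := canonical_ecat EM) x y z.

Definition geval (a a' : L) (x y : M)
  : hom (G (ehom a a', ihom EM x y) ⊙ gfob a x) (gfob a' y) :=
  uncurry EM (efhom g (a, x) (a', y)).

Lemma geval_id a x :
  geval a a x x ∘ ((bimap G (eid a) (curry EM (alun x)) ∘ leta G) ⊙m idm (gfob a x))
      = alun (gfob a x).
Proof. exact (uncurry_efhom_id g (a, x)). Qed.

Lemma geval_comp a a' a'' x y z :
  geval a a'' x z ∘ ((bimap G (ecomp a a' a'') (cmp x y z)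
      ∘ bimu G _ _ _ _) ⊙m idm (gfob a x))
  = geval a' a'' y z ∘ ((idm _ ⊙m geval a a' x y) ∘ aasc _ _ _).
Proof. exact (uncurry_efhom_comp g (a, x) (a', y) (a'', z)). Qed.

(** The action on generalised elements [t] of a hom object of [L] and [h] of a hom
    object [[x, y]]. All structure of the transposed functor is of this form:
    [t] an identity of [L] gives the functors [g (a, -)], and [h] the unit constraint of
    [x] gives the transformations between them. *)
Definition gcell (a a' : L) (x y : M) (c : A) (b : B) (t : hom c (ehom a a')) (h
    : hom (b ⊙ x) y)
  : hom (G (c, b) ⊙ gfob a x) (gfob a' y) :=
  geval a a' x y ∘ (bimap G t (curry EM h) ⊙m idm _).

Lemma gcell_nat a a' x y c c' b b' (t : hom c (ehom a a')) (h : hom (b ⊙ x) y)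
  (s : hom c' c) (k : hom b' b) :
  gcell (t ∘ s) (h ∘ (k ⊙m idm x)) = gcell t h ∘ (bimap G s k ⊙m idm _).
Proof. unfold gcell. rewrite curry_nat, bimap_comp, actm_r. catn. reflexivity. Qed.

Lemma gcell_comp a a' a'' x y z c c' b b' (t : hom c (ehom a a')) (h : hom (b ⊙ x) y)
  (t' : hom c' (ehom a' a'')) (h' : hom (b' ⊙ y) z) :
  gcell (ecomp a a' a'' ∘ (t' ⊗m t)) (h' ∘ ((idm b' ⊙m h) ∘ aasc b' b x))
      ∘ (bimu G c' c b' b ⊙m idm _)
  = gcell t' h' ∘ ((idm _ ⊙m gcell t h) ∘ aasc _ _ _).
Proof.
  assert (E : curry EM (h' ∘ ((idm b' ⊙m h) ∘ aasc b' b x))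
     = cmp x y z ∘ (curry EM h' ⊗m curry EM h)).
  { apply (uncurry_inj (E := EM)). etransitivity; [|symmetry; apply uncurry_ecomp].
    rewrite !uncurry_curry. reflexivity. }
  assert (E1 : bimap G (t' ⊗m t) (curry EM h' ⊗m curry EM h) ∘ bimu G c' c b' b
    = bimu G _ _ _ _ ∘ (bimap G t' (curry EM h') ⊗m bimap G t (curry EM h))).
  { symmetry. exact (lmu_nat G (a := (c', b')) (a' := (_, _)) (b := (c, b)) (b' :=
      (_, _)) (t', curry EM h') (t, curry EM h)). }
  unfold gcell. rewrite E, bimap_comp. catn. rewrite <- actm_r. catn.
  rewrite E1, (comp_assoc (bimap G _ _)), actm_r, comp_assoc, geval_comp.
  catn. rewrite aasc_nat_r, actm_l. catn. rewrite (ra (eq_sym (actm_comp _ _ _ _))).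
  rewrite (ra (eq_sym (actm_l _ _ _))), (ra (eq_sym (actm_comp
      (bimap G t' _) _ _ _))). catn.
  reflexivity.
Qed.

Lemma gcell_unit a x : gcell (eid a) (alun x) ∘ (leta G ⊙m idm _) = alun _.
Proof. unfold gcell. catn. rewrite <- actm_r. apply geval_id. Qed.

(** Composition of generalised elements. The composites may be presented by any
    [t2] and [h2] that agree with them up to units, which is what [f] and [l] record. *)
Lemma gcell_bimul a a' a'' x y z c c' d b b' e (t : hom c (ehom a a')) (h : hom (b ⊙ x) y)
  (t' : hom c' (ehom a' a'')) (h' : hom (b' ⊙ y) z)
  (t2 : hom d (ehom a a'')) (h2 : hom (e ⊙ x) z) (f : hom (c' ⊗ c) d) (l : hom (b' ⊗ b) e)
  v w (p : hom v (G (c', b'))) (q : hom w (G (c, b))) :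
  t2 ∘ f = ecomp a a' a'' ∘ (t' ⊗m t) ->
  h2 ∘ (l ⊙m idm x) = h' ∘ ((idm b' ⊙m h) ∘ aasc b' b x) ->
  gcell t2 h2 ∘ ((bimul G f l ∘ (p ⊗m q)) ⊙m idm _)
  = gcell t' h' ∘ ((p ⊙m (gcell t h ∘ (q ⊙m idm _))) ∘ aasc _ _ _).
Proof.
  intros E1 E2. unfold bimul. rewrite !actm_r. catn. rewrite (ra (eq_sym
      (gcell_nat _ _ _ _))), E1, E2.
  rewrite comp_assoc, gcell_comp. catn. rewrite aasc_nat_r.
  rewrite (ra (eq_sym (actm_comp _ _ _ _))). catn. reflexivity.
Qed.

Program Definition glift (a : L) : LiftFunctor M M := {|
  lift_ob := gfob a;
  lift_map := fun c x y h => gcell (eid a) h ∘ (phi c ⊙m idm _) |}.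
Next Obligation.
  rewrite <- (comp_idr (eid a)) at 1. rewrite gcell_nat. catn.
  rewrite <- !actm_r, phi_nat. reflexivity.
Qed.
Next Obligation.
  rewrite <- phi_mul. etransitivity; [apply (gcell_bimul (t := eid a) (h := h) (t' :=
      eid a) (h' := h'))|].
  - symmetry. apply ecomp_eid_l.
  - rewrite actm_id, comp_idr. reflexivity.
  - catn. rewrite (ra (eq_sym (actm_comp _ _ _ _))). catn. reflexivity.
Qed.
Next Obligation. rewrite phi_one. apply gcell_unit. Qed.

Hypothesis HB : rigid B.
Hypothesis Hg : is_strong G.
Notation absorb_r := (absorb_r (G := G) phi).
Notation absorb_l := (absorb_l (G := G) phi).
Notation center_ob := (center_ob (G := G) Hg phi_nat phi_mul phi_one phi_iso).
Notation center_lax := (center_lax (G := G) Hg phi_nat phi_mul phi_one phi_iso).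

Definition gmod (a : L) : ModFun M M := lift_modfun (glift a) HB.

Lemma mlift_gmod a c x y (h : hom (c ⊙ x) y) : mlift (gmod a) h = gcell (eid a) h
    ∘ (phi c ⊙m idm _).
Proof. apply mlift_lift. Qed.

(** Acting by [t] and [h] together is acting by [h] first and then by [t], or, in the
    next lemma, by [t] first and then by [h]. Comparing the two orders is the module
    naturality of the action of [t]. *)
Lemma gcell_absorb_r a a' x y c b (t : hom c (ehom a a')) (h : hom (b ⊙ x) y) :
  gcell t h ∘ (absorb_r c b ⊙m idm _)
  = gcell t (alun y) ∘ ((idm _ ⊙m mlift (gmod a) h) ∘ aasc _ _ _).
Proof.
  rewrite mlift_gmod. apply (gcell_bimul (t := eid a) (t' := t)).
  - symmetry. apply ecomp_eid_r.
  - rewrite (ra (alun_nat h)). catn. rewrite alun_aasc. reflexivity.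
Qed.

Lemma gcell_absorb_l a a' x y c b (t : hom c (ehom a a')) (h : hom (b ⊙ x) y) :
  gcell t h ∘ (absorb_l c b ⊙m idm _)
  = mlift (gmod a') h ∘ ((idm _ ⊙m gcell t (alun x)) ∘ aasc _ _ _).
Proof.
  rewrite mlift_gmod. catn. rewrite (ra (eq_sym (actm_comp _ _ _ _))). catn.
  rewrite <- (comp_idr (gcell t (alun x))), <- (actm_id (G (c, one B)) (gfob a x)).
  apply (gcell_bimul (t := t) (t' := eid a')).
  - symmetry. apply ecomp_eid_l.
  - rewrite act_triangle. reflexivity.
Qed.

Lemma gmodnat_mlift a a' c (t : hom c (ehom a a')) b x y (h : hom (b ⊙ x) y) :
  gcell t (alun y) ∘ mlift (Z1_act (center_ob c) (gmod a)) h = mlift (gmod a') h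
      ∘ (idm b ⊙m gcell t (alun x)).
Proof.
  rewrite mlift_act. simpl. unfold hbact. simpl.
  apply (iso_epi (is_iso_aasc b (G (c, one B)) (gfob a x))). catn.
  rewrite aasci_aasc. rw (eq_sym (gcell_absorb_r t h)).
  rewrite <- actm_r.
  etransitivity; [exact (f_equal (fun k => gcell t h ∘ (k ⊙m idm (gfob a x)))
      (absorb_hb Hg phi_iso c b))|].
  apply gcell_absorb_l.
Qed.

Definition gmodnat a a' c (t : hom c (ehom a a')) : ModNat (Z1_act (center_ob c) (gmod a))
    (gmod a') :=
  mk_modnat (F := Z1_act (center_ob c) (gmod a)) (G := gmod a') (gmodnat_mlift t).

Variable EF : EnrichedModule (FunMod M M).

Lemma gmodnat_id a :
  (gmodnat (idm (ehom a a)) : hom (c := FunMod M M) (act (l :=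
      FunMod M M) (center_lax (ehom a a)) (gmod a)) (gmod a))
    ∘ ((fmap center_lax (eid a) ∘ leta center_lax) ⊙m idm (gmod a : FunMod M M))
        = alun (gmod a : FunMod M M).
Proof.
  apply ModNat_eq. intros x. simpl.
  rewrite actm_r, comp_assoc, <- gcell_nat, comp_idl, actm_id, comp_idr. apply gcell_unit.
Qed.

Lemma gmodnat_comp a a' a'' :
  (gmodnat (idm (ehom a a'')) : hom (c := FunMod M M) (act (l :=
      FunMod M M) (center_lax (ehom a a'')) (gmod a)) (gmod a''))
    ∘ ((fmap center_lax (ecomp a a' a'') ∘ lmu center_lax (ehom a' a'')
        (ehom a a')) ⊙m idm (gmod a : FunMod M M))
  = (gmodnat (idm (ehom a' a'')) : hom (c := FunMod M M) (act (l :=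
      FunMod M M) (center_lax (ehom a' a'')) (gmod a')) (gmod a''))
    ∘ ((idm (center_lax (ehom a' a'')) ⊙m (gmodnat (idm (ehom a a'))
        : hom (c := FunMod M M) (act (l := FunMod M M) (center_lax (ehom a a')) (gmod a))
        (gmod a')))
       ∘ aasc (center_lax (ehom a' a'')) (center_lax (ehom a a')) (gmod a : FunMod M M)).
Proof.
  apply ModNat_eq. intros x.
  change (gcell (idm (ehom a a'')) (alun x) ∘ ((bimap G (ecomp a a' a'') (idm (one B))
      ∘ bimul G (idm (ehom a' a'' ⊗ ehom a a')) (lun (one B))) ⊙m idm (gfob a x))
    = gcell (idm (ehom a' a'')) (alun x) ∘ ((idm (G (ehom a' a'', one B)) ⊙m gcell (idm
        (ehom a a')) (alun x))
       ∘ aasc (G (ehom a' a'', one B)) (G (ehom a a', one B)) (gfob a x))).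
  rewrite bimap_bimul, <- (comp_idr (bimul _ _ _)), <- (tensm_id (G (ehom a' a'', one B))).
  etransitivity; [apply (gcell_bimul (t := idm (ehom a a')) (h := alun x) (t' :=
      idm (ehom a' a'')) (h' := alun x))|].
  - rewrite tensm_id. catn. reflexivity.
  - rewrite act_triangle, lun_run_one. catn. reflexivity.
  - rewrite actm_id, comp_idr. reflexivity.
Qed.

Definition transpose_efun : EFunctor L (canonical_ecat EF) :=
  mk_efun EF (H := center_lax) (F := gmod : L -> FunMod M M) gmodnat_id gmodnat_comp.

Lemma uncurry_transpose a a' : uncurry EF (efhom transpose_efun a a')
    = gmodnat (idm (ehom a a')).
Proof. apply uncurry_curry. Qed.

Notation oneL := (u tt : L).
Definition al_ob x : hom (gfob oneL x) x := dec (al (tt, x)).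
Hypothesis al_ob_iso : forall x, is_iso (al_ob x).

(** The unit constraint identifies the functor of the unit object with the identity;
    enriched naturality of [al] gives its module naturality. *)
Lemma al_ob_nat c x y (h : hom (c ⊙ x) y) :
  al_ob y ∘ mlift (gmod oneL) h = mlift (idmod M) h ∘ (idm c ⊙m al_ob x).
Proof.
  rewrite mlift_gmod, mlift_idmod.
  assert (E : al_ob y ∘ (geval oneL oneL x y ∘ (bimap G (efhom u tt tt) (idm _) ⊙m idm _))
    = ev EM x y ∘ (al_hat (ihom EM x y) ⊙m al_ob x)).
  { etransitivity; [|exact (dec_nat al (tt, x) (tt, y))].
    apply (f_equal (fun k => al_ob y ∘ k)). symmetry.
    exact (uncurry_comp (efhom g (oneL, x) (oneL, y)) (bimap G (efhom u tt tt) (idm _))). }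
  assert (E1 : eid oneL = efhom u tt tt ∘ u_eta).
  { rewrite <- efhom_id. f_equal.
    change (fmap (ehat u) (idm (c := unit_mon) tt) ∘ leta (ehat u) = u_eta).
    rewrite fmap_id. apply comp_idl. }
  unfold gcell. rewrite E1. catn. rewrite <- actm_r, <- (comp_idl (curry EM h)), bimap_comp.
  catn. rewrite actm_r, (comp_assoc (geval _ _ _ _)), comp_assoc, E. catn.
  rewrite <- actm_comp. catn.
  assert (E2 : al_hat (ihom EM x y) ∘ (bimap G u_eta (curry EM h) ∘ phi c) = curry EM h).
  { rewrite <- (comp_idr u_eta), <- (comp_idl (curry EM h)), bimap_comp. catn.
    rewrite phi_nat, !comp_assoc. unfold phi.
    etransitivity; [exact (f_equal (fun k => k ∘ curry EM h) (iso_inv_r (psi_iso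
        (ihom EM x y))))|].
    apply comp_idl. }
  etransitivity; [exact (f_equal (fun k => ev EM x y ∘ (k ⊙m al_ob x)) E2)|].
  transitivity (ev EM x y ∘ ((curry EM h ⊙m idm x) ∘ (idm c ⊙m al_ob x))).
  - rewrite <- actm_comp. catn. reflexivity.
  - rewrite comp_assoc, ev_curry. reflexivity.
Qed.

Definition al_mod : ModNat (gmod oneL) (idmod M) :=
  mk_modnat (F := gmod oneL) (G := idmod M) al_ob_nat.

Lemma al_mod_iso : is_iso (C := ModFunCat M M) al_mod.
Proof. apply modnat_iso. exact al_ob_iso. Qed.

Definition sigma_enat : ENat (point (L := canonical_ecat EF) (idmod M))
    (efun_comp transpose_efun u) :=
  enat_point (x := idmod M : canonical_ecat EF) (F := efun_comp transpose_efun u)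
    (enc EF (x := idmod M) (y := gmod oneL) (iso_inv al_mod_iso)).

Definition eval_transpose := efun_comp (eval_efun EM EF) (prod_efun transpose_efun
    (efun_id (canonical_ecat EM))).

Program Definition rho_mn : MonNat (ehat eval_transpose) G := {|
  mn := fun p => match p return hom (ehat eval_transpose p) (G p) with
      (a, b) => absorb_r a b end |}.
Next Obligation.
  destruct a as [a b0], b as [a' b'], f as [f k]. symmetry. exact
      (absorb_r_nat phi_nat f k).
Qed.
Next Obligation.
  destruct a as [a b0], b as [a' b'].
  etransitivity; [|exact (absorb_r_mu Hg phi_nat phi_mul phi_one phi_iso a b0 a' b')].
  reflexivity.
Qed.
Next Obligation.
  etransitivity; [|exact (absorb_r_eta phi_one)].
  reflexivity.
Qed.

Definition rho_ob (p : (L * M)%type) : hom (eval_transpose p : M) (g p) :=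
  match p with (a, x) => idm (gfob a x) end.

(** Evaluating the transposed functor acts by [[x, y]] first and by the hom object of
    [L] afterwards, whereas [g] acts by both at once: this is [gcell_absorb_r]. *)
Lemma rho_enat_nat (p q : (L * M)%type) :
  rho_ob q ∘ uncurry EM (efhom eval_transpose p q)
  = uncurry EM (efhom g p q)
    ∘ (rho_mn (ehom (e := prod_ecat L (canonical_ecat EM)) p q) ⊙m rho_ob p).
Proof.
  destruct p as [a x], q as [a' y].
  etransitivity; [apply comp_idl|].
  etransitivity; [exact (uncurry_comp (efhom (eval_efun EM EF) (gmod a, x)
      (gmod a', y)) _)|].
  rewrite uncurry_eval_efun.
  etransitivity; [exact (eval_hom_tens (efhom transpose_efun a a') (idm (ihom EM x y)))|].
  rewrite uncurry_transpose.
  change (uncurry EM (idm (ihom EM x y))) with (ev EM x y).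
  etransitivity; [symmetry; exact (gcell_absorb_r (idm (ehom a a')) (ev EM x y))|].
  unfold gcell, ev. rewrite curry_uncurry, bimap_id, actm_id, comp_idr. reflexivity.
Qed.

Definition rho_enat : ENat eval_transpose g :=
  mk_enat (F := eval_transpose) (G := g) (h := rho_mn)
    (s := rho_ob) rho_enat_nat.

Lemma l1_hat b :
  al_hat b ∘ (absorb_r pt b ∘ ((bimap G u_eta (idm (one B)) ∘ leta G) ⊗m idm b)) = lun b.
Proof.
  rewrite tensm_r, (ra (eq_sym (absorb_r_nat phi_nat u_eta (idm b)))), <- phi_one. catn.
  rewrite (absorb_r_phi phi_one). rewrite !comp_assoc.
  etransitivity; [exact (f_equal (fun k => k ∘ lun b) (iso_inv_r
      (psi_iso b)))|]. apply comp_idl.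
Qed.

End Existence.

Section Assemble.
Variables (B : MonCat) (HB : rigid B) (M : LModule B) (EM : EnrichedModule M)
  (EF : EnrichedModule (FunMod M M)) (X : LeftUnitalAction (canonical EM)).
Notation u := (efun (la_unit X)).
Notation g := (efun (la_act X)).

(** The unit constraint of [X], with its type spelled out in terms of enriched
    functors. *)
Definition unitX : @ENat (prod_mon unit_mon B) B (prod_ecat unit_ecat (canonical_ecat EM))
    (canonical_ecat EM)
  (@efun_comp (prod_mon unit_mon B) (prod_mon (bg X) B) B _ (prod_ecat X
      (canonical_ecat EM)) _ g (prod_efun u (efun_id (canonical_ecat EM))))
  (snd_efun unit_ecat (canonical_ecat EM)) := la_alpha X.

Notation Hu := (efun_strong (la_unit X)).
Notation Hg := (efun_strong (la_act X)).

Lemma unitX_hat_iso b : is_iso (al_hat (u := u) (g := g) unitX b).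
Proof. exact (ecat2_iso_hat (L := prod0 unit0 (canonical EM)) (tt, b)
    (la_alpha_iso X)). Qed.

Lemma unitX_ob_iso x : is_iso (al_ob (u := u) (g := g) unitX x).
Proof.
  apply uiso_dec.
  exact (ecat2_iso_uiso (L := prod0 unit0 (canonical EM)) (tt, x) (la_alpha_iso X)).
Qed.

Definition transpose1 : ECat1 X (canonical EF) :=
  @Build_ECat1 X (canonical EF) (transpose_efun Hu unitX_hat_iso HB Hg EF)
      (center_lax_strong Hg _ _ _ _).

Definition transpose_sigma : idmod_point EF ⇒ comp1 transpose1 (la_unit X) :=
  sigma_enat Hu unitX_hat_iso HB Hg EF unitX_ob_iso.

Definition transpose_rho : comp1 (eval_efun1 EM EF) (prod1 transpose1 (one1
    (canonical EM))) ⇒ la_act X :=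
  rho_enat Hu unitX_hat_iso HB Hg EF.

Lemma transpose_sigma_iso : is_iso transpose_sigma.
Proof.
  apply ecat2_iso.
  - intros []. apply (is_strong_comp (efun_strong transpose1) Hu).
  - intros []. apply (uiso_dec (E := EF) (x := idmod M) (y :=
      gmod Hu unitX_hat_iso HB (u tt))).
    unfold transpose_sigma, sigma_enat. simpl. rewrite dec_enc. apply is_iso_iso_inv.
Qed.

Lemma transpose_rho_iso : is_iso transpose_rho.
Proof.
  apply ecat2_iso.
  - intros [a b]. apply (absorb_r_iso Hg), (phi_iso Hu unitX_hat_iso).
  - intros [a x]. apply (uiso_dec (E := EM) (x := gfob g a x) (y := gfob g a x)).
    unfold transpose_rho, rho_enat. simpl. rewrite dec_enc. apply is_iso_id.
Qed.

Lemma transpose_law :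
  la_alpha X
    ∘ whisk_r transpose_rho (prod1 (la_unit X) (one1 (canonical EM)))
    ∘ (assoc2 (eval_efun1 EM EF) (prod1 transpose1 (one1 (canonical EM))) (prod1
        (la_unit X) (one1 (canonical EM)))
       ∘ whisk_l (eval_efun1 EM EF) (prod_comp2 (canonical EM) transpose1 (la_unit X)))
    ∘ whisk_l (eval_efun1 EM EF) (prod2 transpose_sigma (idm (c :=
        ECatHom (canonical EM) (canonical EM)) (one1 (canonical EM))))
    = eval_alpha EM EF.
Proof.
  apply ENat_eq.
  - intros [[] b].
    transitivity (al_hat (u := u) (g := g) unitX b ∘ absorb_r (G :=
        ehat g) (phi Hu unitX_hat_iso) (ehat u tt) b
      ∘ (idm _ ∘ (idm _ ⊗m idm b)) ∘ ((bimap (ehat g) (u_eta u) (idm (one B))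
          ∘ leta (ehat g)) ⊗m idm b)).
    + reflexivity.
    + rewrite tensm_id. catn. exact (l1_hat Hu unitX_hat_iso b).
  - intros [[] x]. apply (dec_inj (E := EM)).
    pose (F := gmod Hu unitX_hat_iso HB (u tt)).
    pose (v := iso_inv (al_mod_iso Hu unitX_hat_iso HB unitX_ob_iso)).
    etransitivity; [exact (dec_unit_chain (F := F) (enat unitX (tt, x))
      (enc EM (idm (F x : M))) (enc EF (x := idmod M) (y := F) v))|].
    rewrite !dec_enc, comp_idl.
    etransitivity; [|symmetry; exact (dec_enc EM (idm x))].
    exact (f_equal (fun n : ModNat (idmod M) (idmod M) => mnat n x)
      (iso_inv_r (al_mod_iso Hu unitX_hat_iso HB unitX_ob_iso))).
Qed.

Lemma lua1_exists : inhabited (LUA1 X (eval_action EM EF)).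
Proof.
  constructor. exact (@Build_LUA1 _ X (eval_action EM EF) transpose1 transpose_sigma
      transpose_rho transpose_sigma_iso transpose_rho_iso transpose_law).
Qed.

End Assemble.

(** * Evaluation is fully faithful in the functor variable *)

(** A transformation [th] between evaluation along [P] and evaluation along [Q] comes
    from exactly one transformation [P => Q], provided that it is the evident one on
    pairs [(1, b)]. *)
Section FullyFaithful.
Variables (B : MonCat) (M : LModule B) (EM : EnrichedModule M) (EF
    : EnrichedModule (FunMod M M)).
Variables (A : MonCat) (L : ECategory A) (P Q : EFunctor L (canonical_ecat EF)).
Notation PP := (ehat P).
Notation QQ := (ehat Q).

Definition eval_with (P : EFunctor L (canonical_ecat EF)) :
  EFunctor (prod_ecat L (canonical_ecat EM)) (canonical_ecat EM) :=
  efun_comp (eval_efun EM EF) (prod_efun P (efun_id (canonical_ecat EM))).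

Variable th : ENat (eval_with P) (eval_with Q).

Definition th_hat (a : A) (b : B) : hom (z1ob (PP a) ⊗ b) (z1ob (QQ a) ⊗ b) :=
    enhat th (a, b).

Hypothesis th_unit : forall b,
  th_hat (one A) b ∘ (z1hom (leta PP) ⊗m idm b) = z1hom (leta QQ) ⊗m idm b.

Lemma th_hat_nat a a' b b' (f : hom a a') (k : hom b b') :
  th_hat a' b' ∘ (z1hom (fmap PP f) ⊗m k) = (z1hom (fmap QQ f) ⊗m k) ∘ th_hat a b.
Proof. exact (mn_nat (enhat th) (a := (a, b)) (b := (a', b')) (f, k)). Qed.

Lemma th_hat_mu a a' b b' :
  th_hat (a ⊗ a') (b ⊗ b') ∘ ((z1hom (lmu PP a a') ⊗m idm (b ⊗ b'))
      ∘ tens_mu (PP a) b (PP a') b')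
  = (z1hom (lmu QQ a a') ⊗m idm (b ⊗ b')) ∘ (tens_mu (QQ a) b (QQ a') b'
      ∘ (th_hat a b ⊗m th_hat a' b')).
Proof.
  etransitivity; [exact (mn_mu (enhat th) (a, b) (a', b'))|]. symmetry. apply comp_assoc.
Qed.

Lemma z1_lmu_run (R : LaxMon A (Z1 B)) a :
  z1hom (fmap R (run a)) ∘ (z1hom (lmu R a (one A)) ∘ (idm (z1ob (R a)) ⊗m z1hom (leta R)))
  = run (z1ob (R a)).
Proof. exact (f_equal (@z1hom _ _ _) (lmu_run R a)). Qed.

Lemma z1_lmu_lun (R : LaxMon A (Z1 B)) a :
  z1hom (fmap R (lun a)) ∘ (z1hom (lmu R (one A) a) ∘ (z1hom (leta R) ⊗m idm (z1ob (R a))))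
  = lun (z1ob (R a)).
Proof. exact (f_equal (@z1hom _ _ _) (lmu_lun R a)). Qed.

Lemma tens_mu_nat_r (a c c' : Z1 B) (b d : B) (f : Z1Hom c c') :
  tens_mu a b c' d ∘ (idm (z1ob a ⊗ b) ⊗m (z1hom f ⊗m idm d))
  = ((idm (z1ob a) ⊗m z1hom f) ⊗m idm (b ⊗ d)) ∘ tens_mu a b c d.
Proof.
  rewrite <- !tensm_id. exact (tens_mu_nat (Z1_id a) (idm b) f (idm d)).
Qed.

Lemma tens_mu_nat_l (a a' c : Z1 B) (b d : B) (f : Z1Hom a a') :
  tens_mu a' b c d ∘ ((z1hom f ⊗m idm b) ⊗m idm (z1ob c ⊗ d))
  = ((z1hom f ⊗m idm (z1ob c)) ⊗m idm (b ⊗ d)) ∘ tens_mu a b c d.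
Proof.
  rewrite <- !tensm_id. exact (tens_mu_nat f (idm b) (Z1_id c) (idm d)).
Qed.

(** In the background of an evaluation functor, the product of [(a, 1)] and [(1, b)] is
    [(a, b)]. In the opposite order, treated in the next lemma, the product is formed
    through the half-braiding of [R a]. *)
Lemma unit_mu_r (R : LaxMon A (Z1 B)) a b :
  (z1hom (fmap R (run a)) ⊗m lun b) ∘ ((z1hom (lmu R a (one A)) ⊗m idm (one B ⊗ b))
    ∘ (tens_mu (R a) (one B) (R (one A)) b ∘ (idm _ ⊗m ((z1hom (leta R) ⊗m idm b)
        ∘ luni b))))
  = run (z1ob (R a)) ⊗m idm b.
Proof.
  transitivity ((run (z1ob (R a)) ⊗m lun b) ∘ (tens_mu (R a) (one B) (Z1_one B) b
      ∘ (idm _ ⊗m luni b))).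
  - rewrite tensm_l, (ra (tens_mu_nat_r _ _ _ _)), <- z1_lmu_run, !comp_assoc.
    rewrite <- !tensm_comp. catn. reflexivity.
  - unfold tens_mu. simpl. rewrite hbreg_hbone, tensm_l. catn.
    transitivity ((idm (z1ob (R a)) ⊗m lun b) ∘ ((run (z1ob (R a)) ⊗m idm (one B ⊗ b))
      ∘ (asci _ _ _ ∘ ((idm (z1ob (R a)) ⊗m luni (one B ⊗ b))
          ∘ ((idm (z1ob (R a)) ⊗m (idm (one B) ⊗m lun b))
      ∘ (asc _ _ _ ∘ (idm (z1ob (R a) ⊗ one B) ⊗m luni b))))))).
    { rewrite (ra (eq_sym (tensm_comp (idm _) (run _) _ _))). catn. reflexivity. }
    rewrite <- triangle. catn. rw (asc_asci (m := B)). rewrite (ra (tensm_l_eq (z1ob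
        (R a)) (lun_luni (one B ⊗ b)))), tensm_id.
    catn. rewrite <- (tensm_id (z1ob (R a)) (one B)), asc_nat.
    rewrite (ra (tensm_l_eq (z1ob (R a)) (tensm_l_eq (one B)
        (lun_luni b)))), !tensm_id. catn.
    apply triangle.
Qed.

Lemma unit_mu_l (R : LaxMon A (Z1 B)) a b :
  (z1hom (fmap R (lun a)) ⊗m run b) ∘ ((z1hom (lmu R (one A) a) ⊗m idm (b ⊗ one B))
    ∘ (tens_mu (R (one A)) b (R a) (one B) ∘ (((z1hom (leta R) ⊗m idm b)
        ∘ luni b) ⊗m idm _)))
  = z1hb (R a) b ∘ (idm b ⊗m run (z1ob (R a))).
Proof.
  transitivity ((lun (z1ob (R a)) ⊗m run b) ∘ (tens_mu (Z1_one B) b (R a) (one B)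
      ∘ (luni b ⊗m idm _))).
  - rewrite tensm_r, (ra (tens_mu_nat_l _ _ _ _)), <- z1_lmu_lun, !comp_assoc.
    rewrite <- !tensm_comp. catn. reflexivity.
  - unfold tens_mu. simpl. catn.
    transitivity ((idm (z1ob (R a)) ⊗m run b) ∘ ((lun (z1ob (R a)) ⊗m idm (b ⊗ one B))
      ∘ (asci (one B) (z1ob (R a)) (b ⊗ one B) ∘ ((idm (one B) ⊗m hbreg (z1hb (R a)) b
          (one B))
      ∘ (asc _ _ _ ∘ (luni b ⊗m idm (z1ob (R a) ⊗ one B))))))).
    { rewrite (ra (eq_sym (tensm_comp (idm _) (lun _) _ _))). catn. reflexivity. }
    rewrite <- lun_asc. catn. rw (asc_asci (m := B)). rw (lun_nat (m := B)). rw lun_asc.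
    rewrite <- tensm_r, lun_luni, tensm_id. catn. unfold hbreg.
    rw run_asc. rw (run_nat (m := B)). rewrite <- run_asc. catn. rewrite asc_asci. catn.
    reflexivity.
Qed.

Lemma tensm_one_eta (a b : B) (f : hom (a ⊗ one B) (b ⊗ one B)) :
  f = (run b ∘ (f ∘ runi a)) ⊗m idm (one B).
Proof.
  apply (iso_mono (is_iso_run b)). rewrite run_nat. catn. rewrite runi_run. catn.
      reflexivity.
Qed.

Definition xi a : hom (z1ob (PP a)) (z1ob (QQ a)) :=
  run _ ∘ (th_hat a (one B) ∘ runi _).

Lemma th_hat_one a : th_hat a (one B) = xi a ⊗m idm (one B).
Proof. apply tensm_one_eta. Qed.

(** [(a, b)] is the product of [(a, 1)] and [(1, b)], and the transformation is fixed
    on the second factor. *)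
Lemma th_hat_xi a b : th_hat a b = xi a ⊗m idm b.
Proof.
  assert (I : is_iso (run (z1ob (PP a)) ⊗m idm b)) by auto with iso.
  apply (iso_epi I). rewrite <- unit_mu_r at 1. rw (th_hat_nat (run a) (lun b)).
  rw (th_hat_mu a (one A) (one B) b). rewrite <- (tensm_comp (th_hat a (one B))).
  rewrite (comp_assoc (th_hat (one A) b)), th_unit, comp_idr.
  transitivity (z1hom (fmap QQ (run a)) ⊗m lun b
    ∘ (z1hom (lmu QQ a (one A)) ⊗m idm (one B ⊗ b)
     ∘ (tens_mu (QQ a) (one B) (QQ (one A)) b
        ∘ ((idm (z1ob (QQ a) ⊗ one B) ⊗m (z1hom (leta QQ) ⊗m idm b ∘ luni b))
           ∘ (th_hat a (one B) ⊗m idm b))))).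
  - rewrite <- tensm_comp. catn. reflexivity.
  - rewrite (ra4 (unit_mu_r QQ a b)), <- !tensm_r, th_hat_one, run_nat. reflexivity.
Qed.

(** The same argument for the product of [(1, b)] and [(a, 1)]. *)
Lemma xi_hb a b : (xi a ⊗m idm b) ∘ z1hb (PP a) b = z1hb (QQ a) b ∘ (idm b ⊗m xi a).
Proof.
  assert (I : is_iso (idm b ⊗m run (z1ob (PP a)))) by auto with iso.
  apply (iso_epi I). catn. rewrite <- unit_mu_l. rewrite <- th_hat_xi.
  rw (th_hat_nat (lun a) (run b)). rw (th_hat_mu (one A) a b (one B)).
  rewrite <- (tensm_comp (th_hat (one A) b)), (comp_assoc (th_hat
      (one A) b)), th_unit, comp_idr.
  transitivity (z1hom (fmap QQ (lun a)) ⊗m run b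
    ∘ (z1hom (lmu QQ (one A) a) ⊗m idm (b ⊗ one B)
     ∘ (tens_mu (QQ (one A)) b (QQ a) (one B)
        ∘ (((z1hom (leta QQ) ⊗m idm b ∘ luni b) ⊗m idm (z1ob (QQ a) ⊗ one B))
           ∘ (idm b ⊗m th_hat a (one B)))))).
  - rewrite <- tensm_comp. catn. reflexivity.
  - rewrite (ra4 (unit_mu_l QQ a b)). catn. rewrite <- !tensm_l, th_hat_one,
      run_nat. reflexivity.
Qed.

Definition xi1 a : Z1Hom (PP a) (QQ a) := {| z1hom := xi a; z1hom_hb := xi_hb a |}.

Lemma tensm_one_inj (a b : B) (f k : hom a b) :
  f ⊗m idm (one B ⊗ one B) = k ⊗m idm (one B ⊗ one B) -> f = k.
Proof.
  intros E. apply tensm_idr_inj.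
  assert (I : is_iso (idm a ⊗m lun (one B))) by auto with iso.
  apply (iso_epi I). rewrite !tensm_lr, E. reflexivity.
Qed.

Lemma xi_eta : xi (one A) ∘ z1hom (leta PP) = z1hom (leta QQ).
Proof. apply tensm_idr_inj. rewrite tensm_r, <- th_hat_xi. apply th_unit. Qed.

Program Definition xi_mn : MonNat PP QQ := {| mn := xi1 |}.
Next Obligation.
  apply Z1Hom_eq. simpl. apply tensm_idr_inj.
  rewrite !tensm_r, <- !th_hat_xi. exact (th_hat_nat f (idm (one B))).
Qed.
Next Obligation.
  apply Z1Hom_eq. simpl. apply tensm_one_inj. rewrite !tensm_r, <- th_hat_xi.
  apply (iso_epi (tens_mu_iso (PP a) (one B) (PP b) (one B))). catn.
  rewrite th_hat_mu, !th_hat_xi. f_equal.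
  rewrite <- (tensm_id (one B) (one B)).
  exact (tens_mu_nat (xi1 a) (idm (one B)) (xi1 b) (idm (one B))).
Qed.
Next Obligation. apply Z1Hom_eq, xi_eta. Qed.

Definition th_ob (a : L) (x : M) : hom (mfun (P a : ModFun M M) x) (mfun (Q a
    : ModFun M M) x) :=
  dec (enat th (a, x)).

(** The action of a generalised element of a hom object of [L] through [R]. *)
Definition hom_eval (R : EFunctor L (canonical_ecat EF)) a a' c (t : hom c (ehom a a'))
  : ModNat (Z1_act (ehat R c) (R a)) (R a') := uncurry EF (efhom R a a' ∘ fmap (ehat R) t).

Lemma uncurry_eval_with (R : EFunctor L (canonical_ecat EF)) a a' x y c b (t
    : hom c (ehom a a')) (h : hom (b ⊙ x) y) :
  uncurry EM (efhom (eval_with R) (a, x) (a', y))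
    ∘ ((z1hom (fmap (ehat R) t) ⊗m curry EM h) ⊙m idm (mfun (R a : ModFun M M) x))
  = mnat (hom_eval R t) y ∘ ((idm (z1ob (ehat R c)) ⊙m mlift (R a : ModFun M M) h)
      ∘ aasc _ _ _).
Proof.
  etransitivity; [exact (f_equal (fun k => k ∘ _) (uncurry_comp (efhom (eval_efun EM EF)
      (_, x) (_, y)) _))|].
  rewrite uncurry_eval_efun. catn. rewrite <- actm_r.
  change (eval_hom EM EF (R a) (R a') x y ∘ (((z1hom (efhom R a a') ⊗m idm (ihom EM x y))
    ∘ (z1hom (fmap (ehat R) t) ⊗m curry EM h)) ⊙m idm (mfun (R a : ModFun M M) x))
    = mnat (hom_eval R t) y ∘ ((idm (z1ob (ehat R c)) ⊙m mlift (R a : ModFun M M) h)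
        ∘ aasc _ _ _)).
  rewrite <- tensm_comp, comp_idl.
  etransitivity; [exact (eval_hom_tens (efhom R a a' ∘ fmap (ehat R) t) (curry EM h))|].
  rewrite uncurry_curry. reflexivity.
Qed.

(** Naturality of [th] on generalised elements. Taking for [t] an identity of [L] gives
    module naturality of the components in [x]; taking for [h] a unit constraint gives
    enriched naturality in [a]. *)
Lemma th_ob_nat a a' x y c b (t : hom c (ehom a a')) (h : hom (b ⊙ x) y) :
  th_ob a' y ∘ (mnat (hom_eval P t) y ∘ ((idm (z1ob (PP c)) ⊙m mlift (P a : ModFun M M) h)
      ∘ aasc _ _ _))
  = mnat (hom_eval Q t) y ∘ ((idm (z1ob (QQ c)) ⊙m mlift (Q a : ModFun M M) h) ∘ (aasc _ _ _
      ∘ ((xi c ⊗m idm b) ⊙m th_ob a x))).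
Proof.
  rewrite <- uncurry_eval_with, comp_assoc.
  etransitivity; [exact (f_equal (fun k => k ∘ _) (dec_nat th (a, x) (a', y)))|].
  transitivity (uncurry EM (efhom (eval_with Q) (a, x) (a', y))
    ∘ ((z1hom (fmap QQ t) ⊗m curry EM h) ⊙m idm (mfun (Q a : ModFun M M) x))
    ∘ ((xi c ⊗m idm b) ⊙m th_ob a x)).
  - catn. f_equal. rewrite <- th_hat_xi.
    etransitivity; [symmetry; exact (actm_comp (th_hat (ehom a a') (ihom EM x y)) _
        (th_ob a x) (idm _))|].
    etransitivity; [|exact (actm_comp (z1hom (fmap QQ t) ⊗m curry EM h) _ (idm _)
        (th_ob a x))].
    rewrite th_hat_nat. catn. reflexivity.
  - rewrite uncurry_eval_with. catn. reflexivity.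
Qed.

Lemma hom_eval_eid (R : EFunctor L (canonical_ecat EF)) a y :
  mnat (hom_eval R (eid a)) y ∘ (z1hom (leta (ehat R)) ⊙m idm (mfun (R a : ModFun M M) y))
  = alun (mfun (R a : ModFun M M) y).
Proof.
  pose proof (uncurry_efhom_id R a) as E.
  unfold hom_eval. rewrite uncurry_comp. rewrite actm_r, comp_assoc in E.
  exact (f_equal (fun n : ModNat _ _ => mnat n y) E).
Qed.

Lemma hom_eval_mlift (R : EFunctor L (canonical_ecat EF)) a b x y (h : hom (b ⊙ x) y) :
  mnat (hom_eval R (eid a)) y ∘ ((idm (z1ob (ehat R (one A))) ⊙m mlift (R a
      : ModFun M M) h) ∘ (aasc _ _ _
      ∘ (((z1hom (leta (ehat R)) ⊗m idm b) ∘ luni b) ⊙m idm (mfun (R a : ModFun M M) x))))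
  = mlift (R a : ModFun M M) h.
Proof.
  rewrite actm_r, (ra (aasc_nat_r _ _ _)). catn. rewrite actm_id, aasc_aluni.
  rewrite (ra (eq_sym (actm_lr _ _))). catn. rewrite comp_assoc.
  etransitivity; [exact (f_equal (fun k => k ∘ _) (hom_eval_eid R a y))|].
  simpl. rewrite <- aluni_nat. rw (alun_aluni (l := M)). reflexivity.
Qed.

Lemma hom_eval_id (R : EFunctor L (canonical_ecat EF)) a a' :
  hom_eval R (idm (ehom a a')) = uncurry EF (efhom R a a').
Proof. unfold hom_eval. rewrite fmap_id, comp_idr. reflexivity. Qed.

Lemma th_ob_mlift a b x y (h : hom (b ⊙ x) y) :
  th_ob a y ∘ mlift (P a : ModFun M M) h = mlift (Q a : ModFun M M) h
      ∘ (idm b ⊙m th_ob a x).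
Proof.
  rewrite <- (hom_eval_mlift P a h). rw (th_ob_nat (eid a) h). rewrite <- actm_comp.
  rewrite (comp_assoc (xi (one A) ⊗m idm b)), <- tensm_r, xi_eta. catn.
  etransitivity; [|exact (f_equal (fun k => k ∘ _) (hom_eval_mlift Q a h))].
  catn. rewrite <- actm_comp. catn. reflexivity.
Qed.

Definition xi_mod (a : L) : ModNat (P a) (Q a) :=
  mk_modnat (F := P a) (G := Q a) (n := th_ob a) (th_ob_mlift a).

Lemma xi_law a a' :
  (xi_mod a' : hom (c := FunMod M M) (P a') (Q a')) ∘ uncurry EF (efhom P a a')
  = uncurry EF (efhom Q a a')
    ∘ (xi_mn (ehom a a') ⊙m (xi_mod a : hom (c := FunMod M M) (P a) (Q a))).
Proof.
  rewrite <- !hom_eval_id. apply ModNat_eq. intros x. simpl.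
  assert (T : forall R : EFunctor L (canonical_ecat EF),
    (idm (z1ob (ehat R (ehom a a'))) ⊙m mlift (R a : ModFun M M) (alun x))
     ∘ (aasc _ _ _ ∘ (runi _ ⊙m idm _)) = idm (z1ob (ehat R (ehom a a')) ⊙ mfun (R a
         : ModFun M M) x)).
  { intros R. rewrite mlift_alun. rw (act_triangle (l := M)).
    rewrite <- actm_r, run_runi. apply actm_id. }
  transitivity (th_ob a' x ∘ (mnat (hom_eval P (idm (ehom a a'))) x
    ∘ ((idm _ ⊙m mlift (P a : ModFun M M) (alun x)) ∘ (aasc _ _ _ ∘ (runi _ ⊙m idm _))))).
  { rewrite (T P), comp_idr. reflexivity. }
  rw (th_ob_nat (idm (ehom a a')) (alun x)). rewrite <- actm_comp, <- runi_nat, comp_idr.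
  transitivity (mnat (hom_eval Q (idm (ehom a a'))) x
    ∘ ((idm _ ⊙m mlift (Q a : ModFun M M) (alun x)) ∘ (aasc _ _ _ ∘ (runi _ ⊙m idm _)))
    ∘ (xi (ehom a a') ⊙m th_ob a x)).
  - catn. rewrite <- actm_comp. catn. reflexivity.
  - rewrite (T Q), comp_idr. reflexivity.
Qed.

Definition xi_enat : ENat P Q :=
  mk_enat (F := P) (G := Q) (h := xi_mn) (s := xi_mod) xi_law.

Definition eval_with_nat (s : ENat P Q) : ENat (eval_with P) (eval_with Q) :=
  enat_whisk_l (eval_efun EM EF) (prod_enat s (enat_id (efun_id (canonical_ecat EM)))).

Lemma eval_with_nat_ob (s : ENat P Q) a x : dec (enat (eval_with_nat s) (a, x))
    = mnat (dec (s a)) x.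
Proof.
  etransitivity; [exact (dec_umap_eval_efun (s a) (eid (e := canonical_ecat EM) x))|].
  rewrite dec_eid, fmap_id. apply comp_idr.
Qed.

Lemma eval_with_nat_xi : eval_with_nat xi_enat = th.
Proof.
  apply ENat_eq.
  - intros [a b]. symmetry. exact (th_hat_xi a b).
  - intros [a x]. apply (dec_inj (E := EM)). rewrite eval_with_nat_ob.
    exact (f_equal (fun n : ModNat (P a) (Q a) => mnat n x)
      (dec_enc EF (xi_mod a : hom (c := FunMod M M) (P a) (Q a)))).
Qed.

End FullyFaithful.

Lemma eval_with_nat_inj (B : MonCat) (M : LModule B) (EM : EnrichedModule M)
  (EF : EnrichedModule (FunMod M M)) (A : MonCat) (L : ECategory A)
  (P Q : EFunctor L (canonical_ecat EF)) (s t : ENat P Q) : eval_with_nat EM s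
      = eval_with_nat EM t -> s = t.
Proof.
  intros E. apply ENat_eq.
  - intros a. apply Z1Hom_eq, tensm_idr_inj.
    exact (f_equal (fun r : ENat (eval_with EM P) (eval_with EM Q) => enhat r
        (a, one B)) E).
  - intros a. apply (dec_inj (E := EF)), ModNat_eq. intros x. rewrite <- (eval_with_nat_ob
      (EM := EM) s), <- (eval_with_nat_ob (EM := EM) t), E.
    reflexivity.
Qed.

(** * Terminality *)

Section Unique.
Variables (B : MonCat) (M : LModule B) (EM : EnrichedModule M)
  (EF : EnrichedModule (FunMod M M)) (X : LeftUnitalAction (canonical EM)).
Notation Z := (eval_action EM EF).
Notation u := (la_unit X).
Implicit Types p q : LUA1 X Z.

Notation G := (ehat (la_act X) : LaxMon (prod_mon (bg X) B) B).

Definition hat2 (K L N : ECat) (F H : ECat1 (prod0 K L) N) (s : F ⇒ H) (a : bg K) (b : bg L)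
  : hom (c := bg N) (ehat F (a, b)) (ehat H (a, b)) := enhat s (a, b).

Definition ob2 (K L N : ECat) (F H : ECat1 (prod0 K L) N) (s : F ⇒ H) (a : K) (b : L)
  : uhom (L := ecat N) (F (a, b)) (H (a, b)) := enat s (a, b).

Definition ph p : LaxMon (bg X) (Z1 B) := ehat (l1_fun p).

Definition rhoh p (a : bg X) (b : B) : hom (z1ob (ph p a) ⊗ b) (G (a, b)) :=
  enhat (l1_rho p) (a, b).

Definition sigh p : Z1Hom (Z1_one B) (ph p (ehat u tt)) := enhat (l1_sigma p) tt.

Lemma sigh_eta p : z1hom (sigh p) = z1hom (fmap (ph p) (u_eta u)) ∘ z1hom (leta (ph p)).
Proof. exact (f_equal (@z1hom _ _ _) (enhat_point (l1_sigma p))). Qed.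

Lemma rhoh_nat p a a' b b' (f : hom a a') (k : hom b b') :
  rhoh p a' b' ∘ (z1hom (fmap (ph p) f) ⊗m k) = bimap G f k ∘ rhoh p a b.
Proof. exact (mn_nat (enhat (l1_rho p)) (a := (a, b)) (b := (a', b')) (f, k)). Qed.

(** The unit axiom of [p] on backgrounds and, in [rhob_unit], on objects. Neither right
    hand side depends on [p], so the composite on the left is the same for any two
    1-morphisms. *)
Lemma rhoh_unit p b :
  al_hat (unitX X) b ∘ (bimap G (u_eta u) (idm b)
    ∘ (rhoh p (one _) b ∘ (z1hom (leta (ph p)) ⊗m idm b))) = lun b.
Proof.
  transitivity (al_hat (unitX X) b ∘ rhoh p (ehat u tt) b ∘ (idm _ ∘ (idm _ ⊗m idm b))
    ∘ (z1hom (sigh p) ⊗m idm b)).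
  - rewrite (ra (eq_sym (rhoh_nat _ _ _))), tensm_id, sigh_eta, tensm_r. catn. reflexivity.
  - exact (f_equal (fun r => hat2 (K := unit0) (L := canonical EM) r tt b) (l1_eq p)).
Qed.

Definition gobj (a : X) (x : M) : M := la_act X (a, x).

Definition pob p (a : X) : ModFun M M := l1_fun p a.

Definition rhob p (a : X) (x : M) : hom (pob p a x) (gobj a x) :=
  dec (enat (l1_rho p) (a, x)).

Definition sigd p : ModNat (idmod M) (pob p (u tt)) := dec (enat (l1_sigma p) tt).

Definition alob (x : M) : hom (gobj (u tt) x) x := dec (enat (unitX X) (tt, x)).

Lemma rhob_unit p x : alob x ∘ (rhob p (u tt) x ∘ mnat (sigd p) x) = idm x.
Proof.
  etransitivity; [symmetry; exact (dec_unit_chain (F := pob p (u tt))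
    (enat (unitX X) (tt, x)) (enat (l1_rho p) (u tt, x)) (enat (l1_sigma p) tt))|].
  etransitivity; [exact (f_equal
    (fun r : comp1 (eval_efun1 EM EF) (prod1 (idmod_point EF) (one1 (canonical EM)))
       ⇒ lunit1 (canonical EM) =>
     dec (E := EM) (x := x) (y := x) (ob2 (K := unit0) (L := canonical EM) r tt x))
    (l1_eq p))|].
  exact (dec_enc EM (idm x)).
Qed.

(** Two names for one transformation: the first is typed as a morphism between composite
    1-morphisms, the second as a transformation between evaluation functors. *)
Definition theta2 p q : comp1 (la_act Z) (prod1 (l1_fun p) (one1 (canonical EM)))
  ⇒ comp1 (la_act Z) (prod1 (l1_fun q) (one1 (canonical EM))) :=
  iso_inv (l1_rho_iso q) ∘ l1_rho p.

Lemma rho_theta p q : l1_rho q ∘ theta2 p q = l1_rho p.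
Proof. unfold theta2. rewrite comp_assoc, iso_inv_r. apply comp_idl. Qed.

Definition theta p q : ENat (eval_with EM (l1_fun p)) (eval_with EM (l1_fun q)) :=
    theta2 p q.

Lemma rhoh_theta p q a b : rhoh q a b ∘ th_hat (theta p q) a b = rhoh p a b.
Proof. exact (f_equal (fun r => hat2 (K := X) (L := canonical EM) r a b)
    (rho_theta p q)). Qed.

Lemma rhob_theta p q a x : rhob q a x ∘ th_ob (theta p q) a x = rhob p a x.
Proof.
  unfold rhob, th_ob. etransitivity; [symmetry; apply (dec_ucomp (E := EM))|].
  exact (f_equal (fun r : comp1 (eval_efun1 EM EF) (prod1 (l1_fun p) (one1
      (canonical EM))) ⇒ la_act X =>
    dec (E := EM) (x := pob p a x) (y := gobj a x) (ob2 (K := X) (L :=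
        canonical EM) r a x)) (rho_theta p q)).
Qed.

Lemma rhoh_iso p a b : is_iso (rhoh p a b).
Proof. exact (ecat2_iso_hat (L := prod0 X (canonical EM)) (a, b) (l1_rho_iso p)). Qed.

Lemma rhob_iso p a x : is_iso (rhob p a x).
Proof.
  apply uiso_dec. exact (ecat2_iso_uiso (L := prod0 X (canonical EM)) (a, x)
      (l1_rho_iso p)).
Qed.

Lemma theta_unit p q b :
  th_hat (theta p q) (one (bg X)) b ∘ (z1hom (leta (ph p)) ⊗m idm b)
      = z1hom (leta (ph q)) ⊗m idm b.
Proof.
  apply (iso_mono (rhoh_iso q (one (bg X)) b)). rewrite comp_assoc.
  etransitivity; [exact (f_equal (fun k => k ∘ _) (rhoh_theta p q (one (bg X)) b))|].
  apply (iso_mono (psi_iso (efun_strong u) (unitX_hat_iso X) b)).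
  unfold psi. catn.
  exact (eq_trans (rhoh_unit p b) (eq_sym (rhoh_unit q b))).
Qed.

Lemma alob_iso x : is_iso (alob x).
Proof. exact (unitX_ob_iso X x). Qed.

Definition lua2_nat p q : ENat (l1_fun p) (l1_fun q) := xi_enat (th :=
    theta p q) (theta_unit p q).

Lemma lua2_sigma p q : whisk_r (lua2_nat p q : l1_fun p ⇒ l1_fun q) u
    ∘ l1_sigma p = l1_sigma q.
Proof.
  apply ENat_eq.
  - intros []. etransitivity; [exact (enhat_point _)|]. symmetry. exact (enhat_point
      (l1_sigma q)).
  - intros []. apply (dec_inj (E := EF)). etransitivity; [apply (dec_ucomp (E := EF))|].
    apply ModNat_eq. intros x.
    etransitivity; [exact (f_equal (fun n : ModNat _ _ => mnat n x ∘ mnat (sigd p) x)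
      (dec_enc EF (xi_mod (theta_unit p q) (u tt) : hom (c :=
          FunMod M M) (pob p (u tt)) (pob q (u tt)))))|].
    apply (iso_mono (rhob_iso q (u tt) x)). apply (iso_mono (alob_iso x)).
    etransitivity; [|symmetry; exact (rhob_unit q x)].
    etransitivity; [|exact (rhob_unit p x)].
    rewrite <- (rhob_theta p q). catn. reflexivity.
Qed.

Lemma lua2_rho p q : l1_rho q ∘ whisk_l (eval_efun1 EM EF)
   (prod2 (lua2_nat p q : l1_fun p ⇒ l1_fun q) (idm (c := ECatHom (canonical EM)
       (canonical EM)) (one1 (canonical EM)))) = l1_rho p.
Proof.
  etransitivity; [|exact (rho_theta p q)].
  exact (f_equal (fun r : comp1 (la_act Z) (prod1 (l1_fun p) (one1 (canonical EM)))
    ⇒ comp1 (la_act Z) (prod1 (l1_fun q) (one1 (canonical EM))) => l1_rho q ∘ r)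
    (eval_with_nat_xi (theta_unit p q))).
Qed.

Definition lua2 p q : LUA2 p q := @Build_LUA2 _ X Z p q (lua2_nat p q) (lua2_sigma p q)
    (lua2_rho p q).

(** The axiom on [rho] determines the image of a 2-morphism under evaluation, and
    evaluation is faithful. *)
Lemma lua2_unique p q (s t : LUA2 p q) : s = t.
Proof.
  apply LUA2_eq. apply (eval_with_nat_inj (EM := EM)).
  exact (iso_mono (l1_rho_iso q) (eq_trans (l2_rho s) (eq_sym (l2_rho t)))).
Qed.

Lemma lua_contractible (HB : rigid B) : contractible_groupoid (LUAHom X Z).
Proof.
  split; [exact (lua1_exists HB EF X)|]. split.
  - intros p q s. exists (lua2 q p). split; apply lua2_unique.
  - intros p q. exists (lua2 p q). intros s. apply lua2_unique.
Qed.

End Unique.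

(** The composite of two identities is an identity only up to this coherence
    transformation. *)
Program Definition one_one (L : ECat) : one1 L ⇒ comp1 (one1 L) (one1 L) :=
  {| enhat := {| mn := fun a => idm a |}; enat := fun x => eid x |}.
Next Obligation. catn. reflexivity. Qed.
Next Obligation. rewrite tensm_id. catn. reflexivity. Qed.
Next Obligation. catn. reflexivity. Qed.
Next Obligation. rewrite epost_id, epre_id. catn. reflexivity. Qed.

Lemma ecat_equiv_refl (L : ECat) : ecat_equiv L L.
Proof.
  assert (I : is_iso (one_one L)).
  { apply ecat2_iso; intros x.
    - apply is_iso_id.
    - exists (eid x). split; apply ucomp_idl. }
  exists (one1 L), (one1 L), (one_one L), (iso_inv I).
  split; [exact I | apply is_iso_iso_inv].
Qed.

Theorem corollary4p41 (B : MonCat) (HB : rigid B) (M : LModule B)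
    (EM : EnrichedModule M) (EF : EnrichedModule (FunMod M M)) :
  exists Z : E0Center (canonical EM), ecat_equiv Z (canonical EF).
Proof.
  exists {| e0_action := eval_action EM EF; e0_terminal := fun X => lua_contractible EF X
      HB |}.
  apply ecat_equiv_refl.
Qed.
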